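(* The two bases $\{P_m\}_{m\in\mathbb Z}$ and $\{P_n'\}_{n\in\mathbb Z}$ of $\mathcal A$ form a bi-orthogonal system with respect to the non-degenerate bilinear form $\langle\cdot,\cdot\rangle$, i.e. $\langle P_m,P_n'\rangle=0$ for all $m,n\in\mathbb Z$ with $m\neq n$.
   Context: Parameters: $q\in\mathbb C$ with $0<|q|<1$ and a fixed square root $q^{1/2}$; $\underline t=(k_0,k_1,u_0,u_1)$ nonzero complex numbers with $k_0^2,k_1^2,u_1^2\notin\{\pm q^j:j\in\mathbb Z\}$. Set $a=k_1u_1$, $b=-k_1u_1^{-1}$, $c=q^{1/2}k_0u_0$, $d=-q^{1/2}k_0u_0^{-1}$ and assume $ef\notin q^{\mathbb Z}$ for all $e,f\in\{a,b,c,d\}$. $\mathcal A=\mathbb C[x^{\pm1}]$. Define linear operators on $\mathcal A$ by $(T_1f)(x)=k_1f(x)+k_1^{-1}\frac{(1-k_1u_1x)(1+k_1u_1^{-1}x)}{1-x^2}\bigl(f(x^{-1})-f(x)\bigr)$ and $(T_0f)(x)=k_0f(x)+k_0^{-1}\frac{(1-q^{1/2}k_0u_0x^{-1})(1+q^{1/2}k_0u_0^{-1}x^{-1})}{1-qx^{-2}}\bigl(f(qx^{-1})-f(x)\bigr)$, and $Y=T_1T_0$. Let $\epsilon(m)=1$ for $m\ge0$, $\epsilon(m)=-1$ for $m<0$, $\gamma_m=(k_0k_1)^{\epsilon(m)}q^m$. Order the monomials by $1\prec x^{-1}\prec x\prec x^{-2}\prec x^2\prec\cdots$. The monic non-symmetric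 Askey-Wilson polynomial $P_m$ ($m\in\mathbb Z$) is the unique Laurent polynomial of the form $x^m+$ lower order terms w.r.t. $\preceq$ with $YP_m=\gamma_mP_m$. $P_m'$ denotes the polynomial obtained by the same construction with $k_0,k_1,u_0,u_1,q,q^{1/2}$ all replaced by their inverses. $(y;q)_\infty=\prod_{j\ge0}(1-yq^j)$ and $(y_1,\dots,y_r;q)_\infty=\prod_i(y_i;q)_\infty$. The bilinear form on $\mathcal A$ is $$\langle f,g\rangle=\frac1{2\pi i}\int_{C}f(x)g(x^{-1})\Delta(x)\frac{dx}{x},\qquad \Delta(x)=\frac{(x^2,qx^{-2};q)_\infty}{(ax,bx,cx,dx,qax^{-1},qbx^{-1},cx^{-1},dx^{-1};q)_\infty},$$ where $C$ is a counterclockwise continuous rectifiable Jordan curve such that $aq^k,bq^k,cq^k,dq^k$ ($k\in\mathbb Z_{\ge0}$) lie in its interior and $a^{-1}q^{-k},b^{-1}q^{-k},c^{-1}q^{-k},d^{-1}q^{-k}$ ($k\in\mathbb Z_{\ge0}$) lie in its exterior. *)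

(* Defs.v *)
From HB Require Import structures.
From mathcomp Require Import all_boot all_order all_algebra.
From mathcomp Require Import complex.
From mathcomp Require Import all_classical all_reals all_analysis.

Set Implicit Arguments.
Unset Strict Implicit.
Unset Printing Implicit Defensive.

Import Order.TTheory GRing.Theory Num.Theory.
Import numFieldNormedType.Exports.

Local Open Scope classical_set_scope.
Local Open Scope ring_scope.

(** * Complex numbers *)

(* Declaring R[i] at type numClosedFieldType gives it the topology of its
   norm, which the bare carrier R[i] does not have. *)
Definition Cx (R : realType) : numClosedFieldType := R[i].

(** * Laurent polynomials *)

Definition finite_supp (K : fieldType) : {pred int -> K^o} :=
  fun f => `[< finite_set [set m | f m != 0] >].

Lemma finite_supp_submod_closed (K : fieldType) :
  submod_closed (@finite_supp K).
Proof.
split.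
  apply/asboolP; rewrite (_ : [set _ | _] = set0) //.
  by apply/seteqP; split => m //=; rewrite eqxx.
move=> a f g /asboolP hf /asboolP hg; apply/asboolP.
apply: (sub_finite_set _ (B := [set m | f m != 0] `|` [set m | g m != 0])).
  move=> m /=; have [f0|] := eqVneq (f m) 0; last by left.
  have [g0|] := eqVneq (g m) 0; last by right.
  by rewrite /GRing.add /= /GRing.scale /= f0 g0 scaler0 addr0 eqxx.
by rewrite finite_setU.
Qed.

HB.instance Definition _ (K : fieldType) :=
  GRing.isSubmodClosed.Build K (int -> K^o) (@finite_supp K)
    (@finite_supp_submod_closed K).

(* The Laurent polynomial with coefficient [lcoef f m] at x^m. *)
Record laurent (K : fieldType) := Laurent {
  lcoef :> int -> K^o;
  _ : lcoef \in @finite_supp K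
}.

HB.instance Definition _ (K : fieldType) := [isSub for @lcoef K].
HB.instance Definition _ (K : fieldType) := [Choice of laurent K by <:].
HB.instance Definition _ (K : fieldType) :=
  [SubChoice_isSubLmodule of laurent K by <:].

Section LaurentPolynomials.
Variable K : fieldType.
Implicit Types (f g p : laurent K) (x : K).

(* Meaningful for x != 0. *)
Definition leval f x : K := \sum_(m \in [set: int]) (f m : K) * x ^ m.

(* Here c only serves as a finitely supported family of coefficients. *)
Definition is_basis (P : int -> laurent K) : Prop :=
  forall f, exists! c : laurent K, f = \sum_(m \in [set: int]) (c m : K) *: P m.

(* 1 < x^-1 < x < x^-2 < x^2 < ... *)
Definition mono_lt (m n : int) : bool :=
  (`|m|%N < `|n|%N)%N || ((`|m|%N == `|n|%N) && (m < n)).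

Definition monic_of_degree (m : int) p : Prop :=
  p m = 1 /\ forall n : int, p n != 0 -> n != m -> mono_lt n m.

(** * Difference-reflection operators *)

(* [T1 f] and [T0 f] are the Laurent polynomials whose values are given by the
   defining formulas wherever the denominators do not vanish. For K = C and
   q != 0 there is exactly one such Laurent polynomial, so the default value 0
   is never used. *)

Definition T1 (k1 u1 : K) f : laurent K :=
  xget 0 [set g | forall x, x != 0 -> 1 - x ^+ 2 != 0 ->
    leval g x = k1 * leval f x
      + k1^-1 * ((1 - k1 * u1 * x) * (1 + k1 * u1^-1 * x) / (1 - x ^+ 2))
        * (leval f x^-1 - leval f x)].

(* qh stands for q^{1/2} *)
Definition T0 (q qh k0 u0 : K) f : laurent K :=
  xget 0 [set g | forall x, x != 0 -> 1 - q * x ^- 2 != 0 ->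
    leval g x = k0 * leval f x
      + k0^-1 * ((1 - qh * k0 * u0 * x^-1) * (1 + qh * k0 * u0^-1 * x^-1)
                 / (1 - q * x ^- 2))
        * (leval f (q * x^-1) - leval f x)].

Definition Yop (q qh k0 k1 u0 u1 : K) f : laurent K :=
  T1 k1 u1 (T0 q qh k0 u0 f).

Definition eps (m : int) : int := if 0 <= m then 1 else -1.

Definition spectrum (q k0 k1 : K) (m : int) : K := (k0 * k1) ^ eps m * q ^ m.

Definition monic_eigen (q qh k0 k1 u0 u1 : K) (m : int) p : Prop :=
  monic_of_degree m p /\
  Yop q qh k0 k1 u0 u1 p = spectrum q k0 k1 m *: p.

(* P_m is the unique monic eigenfunction, for every m *)
Definition nonsym_AW (q qh k0 k1 u0 u1 : K) (P : int -> laurent K) : Prop :=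
  forall m : int, unique (monic_eigen q qh k0 k1 u0 u1 m) (P m).

Definition is_bilinear_form (B : laurent K -> laurent K -> K) : Prop :=
  (forall (z : K) f1 f2 g, B (z *: f1 + f2) g = z * B f1 g + B f2 g) /\
  (forall (z : K) f g1 g2, B f (z *: g1 + g2) = z * B f g1 + B f g2).

Definition nondegenerate_form (B : laurent K -> laurent K -> K) : Prop :=
  (forall f, (forall g, B f g = 0) -> f = 0) /\
  (forall g, (forall f, B f g = 0) -> g = 0).

Definition AW_a (k1 u1 : K) : K := k1 * u1.
Definition AW_b (k1 u1 : K) : K := - (k1 * u1^-1).
Definition AW_c (qh k0 u0 : K) : K := qh * k0 * u0.
Definition AW_d (qh k0 u0 : K) : K := - (qh * k0 * u0^-1).

End LaurentPolynomials.

(** * Contours, parametrized by [0, 1] *)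

Section Contours.
Variable R : realType.
Local Notation C := (Cx R).
Implicit Types (gam : R -> C) (F : C -> C) (z : C) (s : seq R).

Definition increments gam s (i : nat) : C := gam s`_i - gam (0 :: s)`_i.

Definition rectifiable gam : Prop :=
  exists M : C, forall s, itv_partition 0 1 s ->
    \sum_(i < size s) `|increments gam s i| <= M.

Definition curve gam : set C := gam @` `[0, 1].

Definition rectifiable_jordan_curve gam : Prop :=
  [/\ {within `[0, 1], continuous gam}, gam 0 = gam 1,
      {in `[0, 1[ &, injective gam} & rectifiable gam].

(* The interior is the bounded component of the complement of the curve and
   the exterior is the unbounded one. *)
Definition jordan_interior gam : set C := [set z | (~` curve gam) z /\
  bounded_set (connected_component (~` curve gam) z)].

Definition jordan_exterior gam : set C := [set z | (~` curve gam) z /\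
  ~ bounded_set (connected_component (~` curve gam) z)].

(* I is the limit of the Riemann-Stieltjes sums of F dx along gam as the mesh of
   the tagged partition tends to 0. *)
Definition is_contour_integral gam F (I : C) : Prop :=
  forall e : C, 0 < e -> exists2 h : R, 0 < h &
    forall s (t : nat -> R), itv_partition 0 1 s ->
      (forall i, (i < size s)%N ->
        s`_i - (0 :: s)`_i < h /\ (0 :: s)`_i <= t i <= s`_i) ->
      `|\sum_(i < size s) F (gam (t i)) * increments gam s i - I| < e.

Definition contour_integral gam F : C := xget 0 (is_contour_integral gam F).

Definition two_pi_i : C := 2 * (pi%:C)%C * 'i.

(* winding number 1 around the interior points *)
Definition counterclockwise gam : Prop := forall z, jordan_interior gam z ->
  is_contour_integral gam (fun x => (x - z)^-1) two_pi_i.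

Definition qpoch (q z : C) : C :=
  limn (fun n => \prod_(j < n) (1 - z * q ^+ j)).

Definition qpochs (q : C) (zs : seq C) : C := \prod_(z <- zs) qpoch q z.

Definition AW_weight (q a b c d x : C) : C :=
  qpochs q [:: x ^+ 2; q * x ^- 2] /
  qpochs q [:: a * x; b * x; c * x; d * x;
               q * a * x^-1; q * b * x^-1; c * x^-1; d * x^-1].

(* The points a q^k accumulate at 0, which therefore lies in the interior or on
   the curve; the latter is excluded because the integrand is singular at 0. *)
Definition AW_contour (q a b c d : C) gam : Prop :=
  [/\ rectifiable_jordan_curve gam, counterclockwise gam, ~ curve gam 0 &
      forall e, e \in [:: a; b; c; d] -> forall k : nat,
        jordan_interior gam (e * q ^+ k) /\ jordan_exterior gam (e^-1 * q ^- k)].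

Definition AW_form (q a b c d : C) gam (f g : laurent C) : C :=
  two_pi_i^-1 * contour_integral gam (fun x =>
    leval f x * leval g x^-1 * AW_weight q a b c d x / x).

End Contours.

(* Main.v *)
Require Import Defs.
From mathcomp Require Import all_boot all_order all_algebra.
From mathcomp Require Import complex.
From mathcomp Require Import all_classical all_reals all_analysis.
From mathcomp Require Import ring lra zify.
Import Order.TTheory GRing.Theory Num.Theory.
Import numFieldNormedType.Exports.
Set Implicit Arguments.
Unset Strict Implicit.
Unset Printing Implicit Defensive.
Local Open Scope classical_set_scope.
Local Open Scope ring_scope.

(** Let [L h] be the integral of [h] against the weight.  Then [T1] and [T0]
   satisfy [<T_i f, T_i' g> = <f, g>], [T_i'] having inverted parameters; hence
   [<Y f, Y' g> = <f, g>], and eigenvectors with different eigenvalues are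
   orthogonal.  Eigenvalues do differ, for otherwise the monic eigenfunctions would
   not be unique.  The isometry property only uses two reflection identities,
   [L ((1-ax)(1-bx) h(1/x)) = - L ((1-ax)(1-bx) x^-2 h(x))] and its analogue for
   [x |-> q/x].  These come from the invariance of a truncated, rational weight
   under [x |-> s/x] (with [s = 1] or [s = q]) and a passage to the uniform limit:
   a rational function of [x] whose poles [e s] lie inside the curve and [1/e] outside
   has the same integral against [dx/x] as its composition with [x |-> s/x],
   since partial fractions reduce both integrals to the same winding numbers.

   For nondegeneracy, the [f] with [<f, g> = 0] for all [g] form an ideal.  By the
   reflection identities, a common zero [z] of this ideal yields the common zeros
   [q^n z] and [q^-n z] until [1/z] or [z] meets a parameter, and both happening
   contradicts [e f <> q^j].  So a nonzero ideal contains [1], that is, [L = 0].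
   But multiplying the weight by the Laurent polynomials [(a x, ..., d/x; q)_n]
   gives [(x^2, q/x^2; q)_oo] in the limit, whose integral is nonzero by
   the finite Jacobi triple product. *)

(** * Complex modulus *)

(** The curve is merely rectifiable, so no residue calculus and no deformation of contours is used.
    What is known about it are the integrals of [1/(x - z)]: [2 pi i] for [z] inside, which is how
    the orientation is expressed, and 0 for [z] outside, which is proved because this number is
    locally constant and vanishes far away. All other powers of [x - z] have primitives. As the
    poles of the weight accumulate at 0, partial fractions are available only for its truncations.
    The weight itself is not symmetric: the factors [(1 - a x)(1 - b x)] and [(1 - c/x)(1 - d/x)] of
    the reflection identities shift two denominators by [q], so that they match their reflections.
    They are also the numerators in [T1] and [T0], which is why the same identities govern the
    operators. Evaluating [g] at [1/x] in the form is what inverts the parameters of the second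
    operator. *)

Section Cabs.
Variable R : realType.
Local Notation C := (Cx R).
Implicit Types (x y z : C) (u : nat -> C).

(** The norm of [Cx R] takes its values in [Cx R] itself; a real-valued modulus keeps all estimates
    in the ordered field [R]. *)
Definition cabs z : R := Normc.normc z.

Lemma cabsE z : `|z| = (cabs z)%:C%C :> C.
Proof. by []. Qed.

Lemma cabs0 : cabs 0 = 0. Proof. exact: Normc.normc0. Qed.
Lemma cabs1 : cabs 1 = 1. Proof. exact: Normc.normc1. Qed.
Lemma cabsM x y : cabs (x * y) = cabs x * cabs y.
Proof. exact: Normc.normcM. Qed.
Lemma cabsV x : cabs x^-1 = (cabs x)^-1. Proof. exact: Normc.normcV. Qed.
Lemma cabsN x : cabs (- x) = cabs x. Proof. exact: normcN. Qed.
Lemma cabsD x y : cabs (x + y) <= cabs x + cabs y.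
Proof. exact: le_normcD. Qed.
Lemma cabs_ge0 x : 0 <= cabs x.
Proof. by have := normr_ge0 x; rewrite cabsE ler0c. Qed.

Lemma cabsB x y : cabs (x - y) = cabs (y - x).
Proof. by rewrite -opprB cabsN. Qed.

Lemma cabs_eq0 x : (cabs x == 0) = (x == 0).
Proof. by apply/eqP/eqP => [/(@Normc.eq0_normc R)//|->]; rewrite cabs0. Qed.

Lemma cabs_gt0 x : (0 < cabs x) = (x != 0).
Proof. by rewrite lt_neqAle cabs_ge0 andbT eq_sym cabs_eq0. Qed.

Lemma cabsX x n : cabs (x ^+ n) = cabs x ^+ n.
Proof. by elim: n => [|n ih]; rewrite ?expr0 ?cabs1// !exprS cabsM ih. Qed.

Lemma cabs_sum (I : Type) (r : seq I) (P : pred I) (F : I -> C) :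
  cabs (\sum_(i <- r | P i) F i) <= \sum_(i <- r | P i) cabs (F i).
Proof.
elim/big_rec2: _ => [|i y x _ h]; first by rewrite cabs0.
by rewrite (le_trans (cabsD _ _))// lerD2l.
Qed.

Lemma cabs_lt (e : C) z : 0 < e -> (`|z| < e) = (cabs z < complex.Re e).
Proof.
move=> e0; rewrite cabsE -[in LHS](@RRe_real R e) ?ltcR//.
by rewrite realE ltW.
Qed.

Lemma Re_gt0 (e : C) : 0 < e -> 0 < complex.Re e.
Proof. by rewrite ltcE => /andP[_]. Qed.

Lemma real_complex_gt0 (r : R) : 0 < r -> 0 < (r%:C)%C :> C.
Proof. by move=> r0; rewrite ltcR. Qed.

Lemma Re_le_cabs z : `|complex.Re z| <= cabs z.
Proof.
case: z => a b; rewrite /cabs /= -sqrtr_sqr ler_sqrt ?addr_ge0 ?sqr_ge0//.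
by rewrite lerDl sqr_ge0.
Qed.

Lemma Im_le_cabs z : `|complex.Im z| <= cabs z.
Proof.
case: z => a b; rewrite /cabs /= -sqrtr_sqr ler_sqrt ?addr_ge0 ?sqr_ge0//.
by rewrite lerDr sqr_ge0.
Qed.

Lemma cabs_le_ReIm z : cabs z <= `|complex.Re z| + `|complex.Im z|.
Proof.
case: z => a b; rewrite /cabs /=.
rewrite -(ger0_norm (addr_ge0 (normr_ge0 a) (normr_ge0 b))) -sqrtr_sqr.
rewrite ler_sqrt ?sqr_ge0// sqrrD !real_normK ?num_real//.
by rewrite addrAC lerDl mulrn_wge0// mulr_ge0.
Qed.

(** Here epsilon is real; the topology of [Cx R] quantifies over positive complex ones, and [ccvgP]
    translates. *)
Definition ccvg u l :=
  forall e : R, 0 < e -> exists n0, forall n, (n0 <= n)%N -> cabs (u n - l) < e.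

Lemma ccvgP u l : u @ \oo --> l <-> ccvg u l.
Proof.
split=> [ul e e0|ul].
  have /cvgrPdist_lt/(_ (e%:C)%C (real_complex_gt0 e0)) [n0 _ h] := ul.
  by exists n0 => n /h; rewrite cabs_lt ?real_complex_gt0// cabsB.
apply/cvgrPdist_lt => e e0; have [n0 h] := ul _ (Re_gt0 e0).
by exists n0 => // n /= /h; rewrite cabsB cabs_lt.
Qed.

Lemma ccvg_unique u l l' : ccvg u l -> ccvg u l' -> l = l'.
Proof.
move=> /ccvgP ul /ccvgP ul'; apply: (cvg_unique _ ul ul').
exact: norm_hausdorff.
Qed.

(** Completeness is inherited from [R]: real and imaginary parts are additive and bounded by the
    modulus, so both are Cauchy. *)
Lemma ccauchy u :
  (forall e : R, 0 < e -> exists n0, forall m n, (n0 <= m)%N -> (n0 <= n)%N ->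
     cabs (u m - u n) < e) -> exists l, ccvg u l.
Proof.
move=> hu.
have hR (f : C -> R) : (forall z w, f (z - w) = f z - f w) ->
    (forall z, `|f z| <= cabs z) -> exists l : R, (f \o u) @ \oo --> l.
  move=> fB fN; apply/cvg_ex/cauchy_cvgP/cauchy_exP => e e0.
  have [n0 h] := hu _ e0; exists (f (u n0)); exists n0 => // n /= n0n.
  by rewrite /ball /= -fB (le_lt_trans (fN _))// h.
have [||a ua] := hR (@complex.Re R); [by case=> ? ? [] | exact: Re_le_cabs |].
have [||b ub] := hR (@complex.Im R); [by case=> ? ? [] | exact: Im_le_cabs |].
exists (a +i* b)%C => e e0; have e20 : 0 < e / 2 by rewrite divr_gt0.
have /cvgrPdist_lt/(_ _ e20) [n1 _ h1] := ua.
have /cvgrPdist_lt/(_ _ e20) [n2 _ h2] := ub.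
exists (maxn n1 n2) => n; rewrite geq_max => /andP[/h1 /= l1 /h2 /= l2].
rewrite cabsB (le_lt_trans (cabs_le_ReIm _))// [ltRHS]splitr ltrD//.
  by case: (u n) l1.
by case: (u n) l2.
Qed.

End Cabs.

(** * Uniform continuity *)

Section UniformContinuity.
Variable R : realType.
Local Notation C := (Cx R).
Implicit Types f : R -> C.

Definition ucont f :=
  forall e : R, 0 < e -> exists2 h : R, 0 < h & forall x y,
    0 <= x <= 1 -> 0 <= y <= 1 -> `|x - y| < h -> cabs (f x - f y) < e.

(** Heine-Cantor, with compactness in the form of near coverings: [P n x] holds for all large [n]
    and all points near a given one, hence for one [n] on the whole segment. *)
Lemma within_ucont f : {within `[0, 1], continuous f} -> ucont f.
Proof.
move=> fc e e0.
have /compact_near_coveringP cov := @segment_compact R 0 1.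
pose P (n : nat) (x : R) := 0 <= x <= 1 -> forall y, 0 <= y <= 1 ->
  `|x - y| < n.+1%:R^-1 -> cabs (f x - f y) < e.
have [x x01|n _ hn] := cov nat \oo P _; last first.
  exists n.+1%:R^-1; rewrite ?invr_gt0// => x y x01 y01 xy.
  by apply: (hn n) => //=; rewrite in_itv /=.
have e20 : (0 : C) < ((e / 2)%:C)%C by apply: real_complex_gt0; rewrite divr_gt0.
have /subspace_continuousP/(_ x x01)/cvgrPdist_lt/(_ _ e20) := fc.
rewrite /prop_near1 -/(within _ _ _) => /nbhs_ballP[/= d d0 hd].
have d20 : 0 < d / 2 by rewrite divr_gt0.
have [n0 _ hn0] := near_infty_natSinv_lt (PosNum d20).
exists (ball x (d / 2), [set n | (n0 <= n)%N]).
  by split; [exact: nbhsx_ballx|exists n0].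
case=> z n [/= xz n0n] z01 y y01 zy.
have zd : `|x - z| < d / 2 by exact: xz.
have yd : `|x - y| < d.
  rewrite [ltRHS]splitr -(subrKA z) (le_lt_trans (ler_normD _ _))// ltrD//.
  by rewrite (lt_trans zy)// (hn0 n).
have zd' : `|x - z| < d by rewrite (lt_le_trans zd)// ler_pdivrMr// ler_pMr// ler1n.
have := hd z zd'; rewrite /= in_itv /= => /(_ z01); rewrite cabs_lt// => fz.
have := hd y yd; rewrite /= in_itv /= => /(_ y01); rewrite cabs_lt// => fy.
rewrite -(subrKA (f x)) (le_lt_trans (cabsD _ _))//.
by rewrite [ltRHS]splitr ltrD// cabsB.
Qed.

(** Walk from 0 to [x] in steps of length [1/(n+1) < h]: each step changes [f] by less than 1. *)
Lemma ucont_bounded f : ucont f ->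
  exists2 B : R, 0 < B & forall x, 0 <= x <= 1 -> cabs (f x) <= B.
Proof.
move=> /(_ _ ltr01)[h h0 hf].
have [n _ hn] := near_infty_natSinv_lt (PosNum h0).
have {}hn : n.+1%:R^-1 < h by apply: (hn n) => /=.
have key k x : (k <= n.+1)%N -> 0 <= x <= k%:R / n.+1%:R ->
    cabs (f x) <= cabs (f 0) + k%:R.
  elim: k x => [|k ih] x kn.
    by rewrite mul0r -eq_le => /eqP <-; rewrite addr0.
  case/andP=> x0 xk; have [xk'|xk'] := leP x (k%:R / n.+1%:R).
    by rewrite (le_trans (ih x (ltnW kn) _)) ?x0// lerD2l ler_nat.
  have k1 : k%:R / n.+1%:R <= 1 :> R by rewrite ler_pdivrMr// mul1r ler_nat ltnW.
  have k'1 : k.+1%:R / n.+1%:R <= 1 :> R by rewrite ler_pdivrMr// mul1r ler_nat.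
  have k0 : 0 <= k%:R / n.+1%:R :> R by rewrite divr_ge0.
  rewrite -(subrK (f (k%:R / n.+1%:R)) (f x)) (le_trans (cabsD _ _))//.
  rewrite -[k.+1%:R]natr1 addrA addrC lerD ?ih ?(ltnW kn) ?k0 ?lexx// ltW// hf ?k0 ?x0//.
    by rewrite (le_trans xk).
  rewrite ger0_norm ?subr_ge0 1?ltW//; apply: le_lt_trans hn.
  by rewrite lerBlDl (le_trans xk)// -[k.+1%:R]natr1 mulrDl mul1r.
exists (cabs (f 0) + n.+1%:R); first by rewrite ltr_wpDl// cabs_ge0.
by move=> x x01; apply: key => //; rewrite divff.
Qed.

Lemma ucont_cst (z : C) : ucont (fun=> z).
Proof. by move=> e e0; exists 1 => // x y _ _ _; rewrite subrr cabs0. Qed.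

Lemma ucontD f g : ucont f -> ucont g -> ucont (f \+ g).
Proof.
move=> fc gc e e0; have e20 : 0 < e / 2 by rewrite divr_gt0.
have [h h0 hf] := fc _ e20; have [k k0 kg] := gc _ e20.
exists (Num.min h k); first by rewrite lt_min h0.
move=> x y x01 y01; rewrite lt_min => /andP[/(hf _ _ x01 y01) fe].
move=> /(kg _ _ x01 y01) ge /=.
have -> : f x + g x - (f y + g y) = (f x - f y) + (g x - g y) by ring.
by rewrite (le_lt_trans (cabsD _ _))// [ltRHS]splitr ltrD.
Qed.

Lemma ucontM f g : ucont f -> ucont g -> ucont (f \* g).
Proof.
move=> fc gc e e0; have [A A0 fA] := ucont_bounded fc.
have [B B0 gB] := ucont_bounded gc.
have [h h0 hf] := fc _ (divr_gt0 e0 (mulr_gt0 (ltr0n _ 2) B0)).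
have [k k0 kg] := gc _ (divr_gt0 e0 (mulr_gt0 (ltr0n _ 2) A0)).
exists (Num.min h k); first by rewrite lt_min h0.
move=> x y x01 y01; rewrite lt_min => /andP[/(hf _ _ x01 y01) fe].
move=> /(kg _ _ x01 y01) ge /=.
have -> : f x * g x - f y * g y = (f x - f y) * g y + f x * (g x - g y) by ring.
rewrite (le_lt_trans (cabsD _ _))// !cabsM [ltRHS]splitr.
have A2 : e / 2 = A * (e / (2 * A)) by field; rewrite gt_eqF.
have B2 : e / 2 = (e / (2 * B)) * B by field; rewrite gt_eqF.
apply: ler_ltD.
  by rewrite B2 ler_pM ?cabs_ge0 ?gB// ltW.
rewrite A2 (le_lt_trans (ler_wpM2r (cabs_ge0 _) (fA x x01)))//.
by rewrite ltr_pM2l.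
Qed.

(* As [0^-1 = 0], the inverse is continuous only away from [0]. *)
Lemma ucontV f (d : R) : ucont f -> 0 < d ->
  (forall x, 0 <= x <= 1 -> d <= cabs (f x)) -> ucont (fun x => (f x)^-1).
Proof.
move=> fc d0 fd e e0; have [h h0 hf] := fc _ (mulr_gt0 e0 (mulr_gt0 d0 d0)).
exists h => // x y x01 y01 xy.
have [fx fy] := (fd _ x01, fd _ y01).
have fx0 : f x != 0 by rewrite -cabs_gt0 (lt_le_trans d0).
have fy0 : f y != 0 by rewrite -cabs_gt0 (lt_le_trans d0).
have -> : (f x)^-1 - (f y)^-1 = (f y - f x) / (f x * f y).
  by field; rewrite fx0 fy0.
rewrite cabsM cabsV cabsM ltr_pdivrMr ?mulr_gt0 ?cabs_gt0//.
rewrite cabsB (lt_le_trans (hf _ _ x01 y01 xy))// ler_pM2l//.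
by rewrite ler_pM// ltW.
Qed.

End UniformContinuity.

(** * Contour integrals and winding numbers *)

Section ContourIntegral.
Variables (R : realType) (gam : R -> Cx R).
Local Notation C := (Cx R).
Implicit Types (F G : C -> C) (I J : C) (s : seq R) (t : nat -> R).

Definition tagged (h : R) s t := itv_partition 0 1 s /\
  forall i, (i < size s)%N -> s`_i - (0 :: s)`_i < h /\ (0 :: s)`_i <= t i <= s`_i.

Definition rsum F s t : C :=
  \sum_(i < size s) F (gam (t i)) * increments gam s i.

Lemma partition_in s i : itv_partition 0 1 s -> (i <= size s)%N ->
  0 <= (0 :: s)`_i <= 1.
Proof.
move=> ps si; have si' : (i < (size s).+1)%N by [].
rewrite (set_nth_default 1)// (itv_partition_nth_ge si' ps).
exact: itv_partition_nth_le si' ps.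
Qed.

Lemma tagged_in h s t i : tagged h s t -> (i < size s)%N ->
  [/\ 0 <= (0 :: s)`_i <= 1, 0 <= s`_i <= 1, 0 <= t i <= 1,
      `|s`_i - t i| < h & `|(0 :: s)`_i - t i| < h].
Proof.
case=> ps hs si; have [sh /andP[t1 t2]] := hs _ si.
have /andP[a0 a1] := partition_in ps (ltnW si).
have /= /andP[b0 b1] := @partition_in s i.+1 ps si.
by split; rewrite ?ltr_norml; lra.
Qed.

Lemma taggedS h h' s t : h <= h' -> tagged h s t -> tagged h' s t.
Proof.
move=> hh' [ps hs]; split=> // i /hs[si ti]; split=> //.
exact: lt_le_trans hh'.
Qed.

(** Partitions of every mesh must exist for the integral to be unique, as otherwise any value would
    satisfy its definition vacuously. *)
Lemma exists_tagged h : 0 < h -> exists s t, tagged h s t.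
Proof.
move=> h0; have [n _ hn] := near_infty_natSinv_lt (PosNum h0).
have {}hn : n.+1%:R^-1 < h by apply: (hn n) => /=.
pose s : seq R := mkseq (fun i => i.+1%:R / n.+1%:R) n.+1.
have s0 i : (i < n.+1)%N -> (0 :: s)`_i = i%:R / n.+1%:R :> R.
  by case: i => [|i] ni /=; [rewrite mul0r|rewrite nth_mkseq// ltnW].
exists s, (nth 0 s); split.
  split.
    apply/(pathP 0) => i; rewrite size_mkseq => ni.
    by rewrite s0// nth_mkseq// ltr_pM2r ?invr_gt0 ?ltr_nat ?ltr0n.
  by rewrite (last_nth 0) size_mkseq /= nth_mkseq// divff.
move=> i; rewrite size_mkseq => ni; rewrite s0// nth_mkseq//.
rewrite -mulrBl -natr1 addrAC subrr add0r mul1r; split=> //.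
by rewrite ler_pM2r ?invr_gt0// lerDl ler01 lexx.
Qed.

Lemma contour_integralP F I : is_contour_integral gam F I <->
  forall e : R, 0 < e -> exists2 h : R, 0 < h &
    forall s t, tagged h s t -> cabs (rsum F s t - I) < e.
Proof.
split=> [FI e e0|FI e e0].
  have [h h0 hF] := FI _ (real_complex_gt0 e0); exists h => // s t [ps hs].
  by have := hF s t ps hs; rewrite cabs_lt// real_complex_gt0.
have [h h0 hF] := FI _ (Re_gt0 e0); exists h => // s t ps hs.
by rewrite cabs_lt//; apply: hF.
Qed.

Lemma is_contour_integral_unique F I J :
  is_contour_integral gam F I -> is_contour_integral gam F J -> I = J.
Proof.
move=> /contour_integralP FI /contour_integralP FJ.
apply/eqP; rewrite -subr_eq0 -cabs_eq0 eq_le cabs_ge0 andbT.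
rewrite leNgt; apply/negP => e0.
have e20 : 0 < cabs (I - J) / 2 by rewrite divr_gt0.
have [h h0 hI] := FI _ e20; have [k k0 kJ] := FJ _ e20.
have hk0 : 0 < Num.min h k by rewrite lt_min h0.
have [s [t st]] := exists_tagged hk0.
have lI : cabs (rsum F s t - I) < cabs (I - J) / 2.
  by apply: hI; apply: taggedS st; rewrite ge_min lexx.
have lJ : cabs (rsum F s t - J) < cabs (I - J) / 2.
  by apply: kJ; apply: taggedS st; rewrite ge_min lexx orbT.
suff : cabs (I - J) < cabs (I - J) by rewrite ltxx.
have {1}-> : I - J = (I - rsum F s t) + (rsum F s t - J) by ring.
by rewrite (le_lt_trans (cabsD _ _))// [ltRHS]splitr ltrD// cabsB.
Qed.

Lemma contour_integral_eq F I :
  is_contour_integral gam F I -> contour_integral gam F = I.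
Proof.
move=> FI; apply: (@is_contour_integral_unique F) => //.
by apply: (@xgetPex _ 0 (is_contour_integral gam F)); exists I.
Qed.

Lemma is_contour_integral_ext F G I :
  (forall x, 0 <= x <= 1 -> F (gam x) = G (gam x)) ->
  is_contour_integral gam F I -> is_contour_integral gam G I.
Proof.
move=> FG /contour_integralP FI; apply/contour_integralP => e /FI[h h0 hF].
exists h => // s t st; rewrite (_ : rsum G s t = rsum F s t) ?hF//.
apply: eq_bigr => i _; have [_ _ ti _ _] := tagged_in st (ltn_ord i).
by rewrite FG.
Qed.

Lemma is_contour_integral_lin (z : C) F G I J :
  is_contour_integral gam F I -> is_contour_integral gam G J ->
  is_contour_integral gam (fun x => z * F x + G x) (z * I + J).
Proof.
move=> /contour_integralP FI /contour_integralP GJ.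
apply/contour_integralP => e e0.
have e20 : 0 < e / 2 by rewrite divr_gt0.
have z0 : 0 < cabs z + 1 by rewrite ltr_wpDl ?cabs_ge0.
have [h h0 hF] := FI _ (divr_gt0 e20 z0); have [k k0 kG] := GJ _ e20.
exists (Num.min h k); first by rewrite lt_min h0.
move=> s t st.
have lI : cabs (rsum F s t - I) < e / 2 / (cabs z + 1).
  by apply: hF; apply: taggedS st; rewrite ge_min lexx.
have lJ : cabs (rsum G s t - J) < e / 2.
  by apply: kG; apply: taggedS st; rewrite ge_min lexx orbT.
have -> : rsum (fun x => z * F x + G x) s t = z * rsum F s t + rsum G s t.
  rewrite /rsum mulr_sumr -big_split/=; apply: eq_bigr => i _.
  by rewrite mulrDl mulrA.
have -> : z * rsum F s t + rsum G s t - (z * I + J) =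
  z * (rsum F s t - I) + (rsum G s t - J) by ring.
rewrite (le_lt_trans (cabsD _ _))// [ltRHS]splitr ler_ltD// cabsM.
rewrite (le_trans (ler_wpM2l (cabs_ge0 _) (ltW lI)))//.
rewrite mulrCA -[leRHS]mulr1 ler_wpM2l ?(ltW e20)//.
by rewrite ler_pdivrMr// mul1r lerDl.
Qed.

Lemma is_contour_integral0 : is_contour_integral gam (fun=> 0) 0.
Proof.
apply/contour_integralP => e e0; exists 1 => // s t _.
by rewrite /rsum big1 ?subrr ?cabs0// => i _; rewrite mul0r.
Qed.

Lemma is_contour_integralZ (z : C) F I : is_contour_integral gam F I ->
  is_contour_integral gam (fun x => z * F x) (z * I).
Proof.
move=> FI; rewrite -[z * I]addr0.
apply: is_contour_integral_ext (is_contour_integral_lin z FI is_contour_integral0).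
by move=> x _; rewrite addr0.
Qed.

Lemma is_contour_integralD F G I J :
  is_contour_integral gam F I -> is_contour_integral gam G J ->
  is_contour_integral gam (fun x => F x + G x) (I + J).
Proof.
move=> FI GJ; rewrite -[I]mul1r.
apply: is_contour_integral_ext (is_contour_integral_lin 1 FI GJ).
by move=> x _; rewrite mul1r.
Qed.

Lemma is_contour_integral_sum (T : Type) (r : seq T) (F : T -> C -> C)
    (I : T -> C) : (forall i, is_contour_integral gam (F i) (I i)) ->
  is_contour_integral gam (fun x => \sum_(i <- r) F i x) (\sum_(i <- r) I i).
Proof.
move=> FI; elim: r => [|i r ih].
  rewrite big_nil; apply: is_contour_integral_ext is_contour_integral0 => x _.
  by rewrite big_nil.
rewrite big_cons; apply: is_contour_integral_ext (is_contour_integralD (FI i) ih).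
by move=> x _; rewrite big_cons.
Qed.

Hypothesis gam_rect : rectifiable gam.

Lemma rectifiable_bound : exists2 L : R, 0 < L & forall s,
  itv_partition 0 1 s -> \sum_(i < size s) cabs (increments gam s i) <= L.
Proof.
have [M hM] := gam_rect.
have sumE s : \sum_(i < size s) `|increments gam s i| =
    ((\sum_(i < size s) cabs (increments gam s i))%:C)%C.
  rewrite rmorph_sum; apply: eq_bigr => i _; exact: cabsE.
(* The sums are real, so the real part of the complex bound [M] bounds them; adding 1 makes the
   bound strictly positive. *)
exists (complex.Re M + 1).
  have /hM := @itv_partition1 _ R 0 1 ltr01.
  rewrite sumE lecE => /andP[_ /=].
  move=> h; rewrite ltr_pwDr// (le_trans _ h)// sumr_ge0// => i _.
  exact: cabs_ge0.
move=> s /hM; rewrite sumE lecE => /andP[_ /=] h.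
by rewrite (le_trans h)// lerDl.
Qed.

Lemma rsum_le F (B L : R) h s t : (forall s, itv_partition 0 1 s ->
    \sum_(i < size s) cabs (increments gam s i) <= L) -> 0 <= B ->
  (forall x, 0 <= x <= 1 -> cabs (F (gam x)) <= B) -> tagged h s t ->
  cabs (rsum F s t) <= B * L.
Proof.
move=> hL B0 FB st; rewrite (le_trans (cabs_sum _ _ _))//.
apply: (@le_trans _ _ (\sum_(i < size s) B * cabs (increments gam s i))).
  apply: ler_sum => i _; rewrite cabsM ler_wpM2r ?cabs_ge0// FB//.
  by have [] := tagged_in st (ltn_ord i).
by rewrite -mulr_sumr ler_wpM2l// hL//; case: st.
Qed.

Lemma is_contour_integral_le (L B : R) F I : (forall s, itv_partition 0 1 s ->
    \sum_(i < size s) cabs (increments gam s i) <= L) -> 0 <= B ->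
  is_contour_integral gam F I ->
  (forall x, 0 <= x <= 1 -> cabs (F (gam x)) <= B) -> cabs I <= B * L.
Proof.
move=> hL B0 /contour_integralP FI FB; apply/ler_addgt0Pr => e e0.
have [h h0 hF] := FI _ e0; have [s [t st]] := exists_tagged h0.
rewrite -(subrK (rsum F s t) I) (le_trans (cabsD _ _))// addrC lerD//.
  exact: rsum_le st.
by rewrite cabsB ltW// hF.
Qed.

Definition unif (F : nat -> C -> C) G := forall e : R, 0 < e -> exists n0,
  forall n x, (n0 <= n)%N -> 0 <= x <= 1 -> cabs (F n (gam x) - G (gam x)) < e.

(** The integrals form a Cauchy sequence because an integral is at most a bound of the integrand
    times the length. A three-term estimate identifies their limit. Existence of the integrals
    against the infinite-product weight comes from here. *)
Lemma is_contour_integral_unif (F : nat -> C -> C) G (I : nat -> C) :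
  unif F G -> (forall n, is_contour_integral gam (F n) (I n)) ->
  exists2 J, is_contour_integral gam G J & ccvg I J.
Proof.
move=> FG FI; have [L L0 hL] := rectifiable_bound.
have [J IJ] : exists J, ccvg I J.
  apply: ccauchy => e e0.
  have e40 : 0 < e / (4 * L) by rewrite divr_gt0// mulr_gt0.
  have [n0 hn0] := FG _ e40; exists n0 => m n n0m n0n.
  have := is_contour_integral_lin (-1) (FI n) (FI m); rewrite mulN1r addrC => Imn.
  apply: (@le_lt_trans _ _ (e / (2 * L) * L)).
    apply: (is_contour_integral_le hL _ Imn) => [|x x01].
      by rewrite ltW// divr_gt0// mulr_gt0.
    rewrite mulN1r addrC -(subrKA (G (gam x))) (le_trans (cabsD _ _))//.
    have := hn0 m x n0m x01; have := hn0 n x n0n x01; rewrite [in X in X -> _]cabsB.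
    have -> : e / (2 * L) = e / (4 * L) + e / (4 * L) by field; rewrite gt_eqF.
    lra.
  have -> : e / (2 * L) * L = e / 2 by field; rewrite gt_eqF.
  by rewrite ltr_pdivrMr// ltr_pMr// ltr1n.
exists J => //; apply/contour_integralP => e e0.
have e30 : 0 < e / 3 by rewrite divr_gt0.
have [n0 hn0] := FG _ (divr_gt0 e30 L0).
have [n1 hn1] := IJ _ e30.
pose n := maxn n0 n1.
have /contour_integralP/(_ _ e30)[h h0 hF] := FI n.
exists h => // s t st.
have -> : rsum G s t - J =
    - (rsum (fun x => -1 * G x + F n x) s t) + (rsum (F n) s t - I n) + (I n - J).
  have -> : rsum (fun x => -1 * G x + F n x) s t = rsum (F n) s t - rsum G s t.
    rewrite /rsum -sumrB; apply: eq_bigr => i _; ring.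
  ring.
have l1 : cabs (rsum (fun x => -1 * G x + F n x) s t) <= e / 3 / L * L.
  apply: (rsum_le hL _ _ st) => [|x x01]; first by rewrite ltW// divr_gt0.
  by rewrite mulN1r addrC ltW// hn0// leq_maxl.
have l2 := hF s t st.
have l3 := hn1 n (leq_maxr _ _).
rewrite mulfVK ?gt_eqF// in l1.
rewrite (le_lt_trans (cabsD _ _))// (@lt_le_trans _ _ (e / 3 + e / 3 + e / 3))//.
  rewrite ltrD// (le_lt_trans (cabsD _ _))// cabsN ler_ltD//.
by rewrite le_eqVlt; apply/orP; left; apply/eqP; field.
Qed.

(* [F] is a primitive of [f] along the curve, in a strong uniform sense that is
   stable under products. *)
Definition primitive (F f : R -> C) := [/\ ucont F, ucont f &
  forall e : R, 0 < e -> exists2 h : R, 0 < h & forall x y z,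
    0 <= x <= 1 -> 0 <= y <= 1 -> 0 <= z <= 1 -> `|x - z| < h -> `|y - z| < h ->
    cabs (F y - F x - f z * (gam y - gam x)) <= e * cabs (gam y - gam x)].

Hypothesis gam_closed : gam 0 = gam 1.

(** Along a closed curve the increments of the primitive telescope to 0, and each differs from its
    term in the Riemann-Stieltjes sum by a small multiple of the chord. *)
Lemma primitive_integral (F : C -> C) f : primitive (F \o gam) (f \o gam) ->
  is_contour_integral gam f 0.
Proof.
case=> Fc _ Ff; have [L L0 hL] := rectifiable_bound.
apply/contour_integralP => e e0.
have e20 : 0 < e / 2 by rewrite divr_gt0.
have [h h0 hF] := Ff _ (divr_gt0 e20 L0).
exists h => // s t st; rewrite subr0.
have tele : \sum_(i < size s) (F (gam s`_i) - F (gam (0 :: s)`_i)) = 0.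
  rewrite -(big_mkord xpredT (fun i => F (gam (0 :: s)`_i.+1) - F (gam (0 :: s)`_i))).
  rewrite telescope_sumr//.
  have -> : (0 :: s)`_(size s) = 1.
    by case: st => -[_ /eqP <-] _; rewrite (last_nth 0).
  by rewrite /= gam_closed subrr.
rewrite -[rsum _ _ _]subr0 -tele /rsum -sumrB.
rewrite (le_lt_trans (cabs_sum _ _ _))//.
apply: (@le_lt_trans _ _ (\sum_(i < size s) e / 2 / L * cabs (increments gam s i))).
  apply: ler_sum => i _; rewrite cabsB.
  have [? ? ? ? ?] := tagged_in st (ltn_ord i).
  exact: hF.
rewrite -mulr_sumr (@le_lt_trans _ _ (e / 2 / L * L))//.
  by rewrite ler_wpM2l ?(ltW (divr_gt0 _ _))// hL//; case: st.
by rewrite mulfVK ?gt_eqF// ltr_pdivrMr// ltr_pMr// ltr1n.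
Qed.

Lemma primitiveM (F f G g : R -> C) : primitive F f -> primitive G g ->
  primitive (F \* G) (fun x => f x * G x + F x * g x).
Proof.
case=> Fc fc Ff [Gc gc Gg]; split.
- exact: ucontM.
- by apply: (@ucontD _ (f \* G) (F \* g)); exact: ucontM.
move=> e e0.
have [A A0 FA] := ucont_bounded Fc; have [B B0 GB] := ucont_bounded Gc.
have [a a0 fa] := ucont_bounded fc; have [b b0 gb] := ucont_bounded gc.
have e40 : 0 < e / 4 by rewrite divr_gt0.
have [h1 h10 l1] := Gg _ (divr_gt0 e40 A0).
have [h2 h20 l2] := Fc _ (divr_gt0 e40 b0).
have [h3 h30 l3] := Ff _ (divr_gt0 e40 B0).
have [h4 h40 l4] := Gc _ (divr_gt0 e40 a0).
exists (Num.min (Num.min h1 h2) (Num.min h3 h4)); first by rewrite !lt_min h10 h20 h30.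
move=> x y z x01 y01 z01; rewrite !lt_min.
move=> /andP[/andP[x1 x2] /andP[x3 x4]] /andP[/andP[y1 y2] /andP[y3 y4]].
set D := gam y - gam x.
(* Product rule with error: two terms come from the primitives, two from moving [F] and [G] to the
   tag [z]. Each receives a quarter of [e]. *)
have -> : (F \* G) y - (F \* G) x - (f z * G z + F z * g z) * D =
    F y * (G y - G x - g z * D) + (F y - F z) * (g z * D)
    + (G x * (F y - F x - f z * D) + (G x - G z) * (f z * D)) by rewrite /=; ring.
have bnd (M m : R) (P Q : C) : 0 < M -> cabs P <= M ->
    cabs Q <= e / 4 / M * m -> cabs (P * Q) <= e / 4 * m.
  move=> M0 PM Qm; rewrite cabsM.
  have -> : e / 4 * m = M * (e / 4 / M * m) by field; rewrite gt_eqF.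
  by rewrite ler_pM ?cabs_ge0.
have t1 := bnd _ _ _ _ A0 (FA y y01) (l1 x y z x01 y01 z01 x1 y1).
have t3 := bnd _ _ _ _ B0 (GB x x01) (l3 x y z x01 y01 z01 x3 y3).
have t2 : cabs ((F y - F z) * (g z * D)) <= e / 4 * cabs D.
  rewrite mulrCA; apply: (bnd _ _ _ _ b0 (gb z z01)).
  by rewrite cabsM ler_wpM2r ?cabs_ge0// ltW// l2.
have t4 : cabs ((G x - G z) * (f z * D)) <= e / 4 * cabs D.
  rewrite mulrCA; apply: (bnd _ _ _ _ a0 (fa z z01)).
  by rewrite cabsM ler_wpM2r ?cabs_ge0// ltW// l4.
rewrite (le_trans (cabsD _ _))//.
rewrite (le_trans (lerD (cabsD _ _) (cabsD _ _)))//.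
have -> : e * cabs D = e / 4 * cabs D + e / 4 * cabs D
  + (e / 4 * cabs D + e / 4 * cabs D) by field.
by rewrite !lerD.
Qed.

Lemma primitiveX (F f : R -> C) n : primitive F f ->
  primitive (fun x => F x ^+ n.+1) (fun x => n.+1%:R * (f x * F x ^+ n)).
Proof.
move=> Ff; elim: n => [|n ih].
  have -> : (fun x => F x ^+ 1) = F by apply/funext => x; rewrite expr1.
  suff -> : (fun x => 1%:R * (f x * F x ^+ 0)) = f by [].
  by apply/funext => x; rewrite expr0 mulr1 mul1r.
have := primitiveM Ff ih.
have -> : F \* (fun x => F x ^+ n.+1) = (fun x => F x ^+ n.+2).
  by apply/funext => x; rewrite /= -exprS.
set g := (X in primitive _ X -> _).
suff -> : g = fun x => n.+2%:R * (f x * F x ^+ n.+1) by [].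
by apply/funext => x; rewrite /g exprS -[n.+2%:R]natr1 /=; ring.
Qed.

Hypothesis gam_cont : {within `[0, 1], continuous gam}.

Let gam_ucont : ucont gam := within_ucont gam_cont.

Lemma primitive_id : primitive gam (fun=> 1).
Proof.
split; [exact: gam_ucont|exact: ucont_cst|move=> e e0; exists 1 => //].
by move=> x y z _ _ _ _ _; rewrite mul1r subrr cabs0 mulr_ge0 ?cabs_ge0// ltW.
Qed.

Lemma curve_dist z : ~ curve gam z ->
  exists2 d : R, 0 < d & forall x, 0 <= x <= 1 -> d <= cabs (gam x - z).
Proof.
move=> zc; have : closed (curve gam).
  apply: compact_closed; first exact: norm_hausdorff.
  by apply: continuous_compact => //; exact: segment_compact.
move=> /closed_openC; rewrite openE => /(_ z zc) /nbhs_ballP[/= e e0 he].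
exists (complex.Re e); first exact: Re_gt0.
move=> x x01; rewrite leNgt; apply/negP => xz.
apply: (he (gam x)); last by exists x.
by rewrite -ball_normE /= cabs_lt// cabsB.
Qed.

Lemma primitive_inv z : ~ curve gam z ->
  primitive (fun x => (gam x - z)^-1) (fun x => - (gam x - z)^-1 ^+ 2).
Proof.
move=> /curve_dist[d d0 zd].
have uc : ucont (fun x => (gam x - z)^-1).
  by apply: ucontV zd => //; apply: ucontD => //; exact: ucont_cst.
have [B B0 uB] := ucont_bounded uc.
split => //.
  have -> : (fun x => - (gam x - z)^-1 ^+ 2) = (fun=> -1) \*
      ((fun x => (gam x - z)^-1) \* (fun x => (gam x - z)^-1)).
    by apply/funext => x; rewrite /= mulN1r expr2.
  by apply: ucontM; [exact: ucont_cst|exact: ucontM].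
move=> e e0; have [h h0 hu] := uc _ (divr_gt0 e0 (mulr_gt0 (ltr0n _ 2) B0)).
exists h => // x y w x01 y01 w01 xw yw.
have nz v : 0 <= v <= 1 -> gam v - z != 0.
  by move=> /zd; rewrite -cabs_gt0; exact: lt_le_trans.
pose u v := (gam v - z)^-1.
(* The increment of [u] is [- u x * u y] times that of [gam], so the error factor is
   [u w ^+ 2 - u x * u y]. *)
have -> : u y - u x - - u w ^+ 2 * (gam y - gam x) =
   (u w * (u w - u y) + u y * (u w - u x)) * (gam y - gam x).
  by rewrite /u; field; rewrite !nz.
rewrite cabsM ler_wpM2r ?cabs_ge0// (le_trans (cabsD _ _))// !cabsM.
have -> : e = B * (e / (2 * B)) + B * (e / (2 * B)) by field; rewrite gt_eqF.
rewrite lerD// ler_pM ?cabs_ge0 ?uB// cabsB ltW//; exact: hu.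
Qed.

Lemma contour_integral_expr n : is_contour_integral gam (fun x => x ^+ n) 0.
Proof.
have P := primitiveX n primitive_id.
have := @primitive_integral (fun x => x ^+ n.+1)
  (fun x => n.+1%:R * (1 * x ^+ n)) P.
move/(is_contour_integralZ n.+1%:R^-1); rewrite mulr0.
by apply: is_contour_integral_ext => x _; rewrite mul1r mulKf// pnatr_eq0.
Qed.

(** The exponent starts at 2: the simple pole is excluded, as it carries the winding number. *)
Lemma contour_integral_exprV z n : ~ curve gam z ->
  is_contour_integral gam (fun x => (x - z)^-1 ^+ n.+2) 0.
Proof.
move=> zc; have P := primitiveX n (primitive_inv zc).
have := @primitive_integral (fun x => (x - z)^-1 ^+ n.+1)
  (fun x => n.+1%:R * (- (x - z)^-1 ^+ 2 * (x - z)^-1 ^+ n)) P.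
move/(is_contour_integralZ (- n.+1%:R^-1)); rewrite mulr0.
apply: is_contour_integral_ext => x _.
by rewrite mulNr mulKf ?pnatr_eq0// mulNr opprK -exprD.
Qed.

Lemma expr_small (r : R) : 0 <= r -> r < 1 -> forall e : R, 0 < e ->
  exists n0, forall n, (n0 <= n)%N -> r ^+ n < e.
Proof.
move=> r0 r1 e e0; have r1' : `|r| < 1 by rewrite ger0_norm.
have /cvgrPdist_lt/(_ _ e0)[n0 _ h] := cvg_expr r1'.
by exists n0 => n /h /=; rewrite sub0r normrN ger0_norm// exprn_ge0.
Qed.

(* [1 / (x - z - w)] is the sum of the geometric series with general term
   [w ^+ k / (x - z) ^+ k.+1], of which only the term [k = 0] contributes. *)
Lemma winding_near (d : R) z w I : 0 < d ->
  (forall x, 0 <= x <= 1 -> d <= cabs (gam x - z)) -> cabs w < d / 2 ->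
  is_contour_integral gam (fun x => (x - z)^-1) I ->
  is_contour_integral gam (fun x => (x - (z + w))^-1) I.
Proof.
move=> d0 zd wd zI.
have zc : ~ curve gam z.
  by case=> x x01 xz; have := zd x x01; rewrite xz subrr cabs0 leNgt d0.
pose F n x := \sum_(k < n.+1) w ^+ k * (x - z)^-1 ^+ k.+1.
have FI n : is_contour_integral gam (F n) I.
  have -> : I = \sum_(k < n.+1) (if k == ord0 then I else 0) :> C.
    by rewrite -big_mkcond big_pred1_eq.
  apply: is_contour_integral_sum => -[[|k] kn] /=; last first.
    rewrite -[0 in X in is_contour_integral _ _ X](mulr0 (w ^+ k.+1)).
    exact/is_contour_integralZ/contour_integral_exprV.
  apply: is_contour_integral_ext zI => x _; by rewrite expr0 expr1 mul1r.
have FG : unif F (fun x => (x - (z + w))^-1).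
  move=> e e0; have ed0 : 0 < e * (d / 2) by rewrite mulr_gt0// divr_gt0.
  (* On the curve [w / (x - z)] has modulus at most 1/2, and the remainder of the geometric series
     has a denominator of modulus at least [d / 2]. *)
  have [||n0 hn0] := @expr_small 2^-1 _ _ _ ed0.
  - by rewrite invr_ge0.
  - by rewrite invf_lt1// ltr1n.
  exists n0 => n x n0n x01; have dx := zd x x01.
  have x0 : gam x - z != 0 by rewrite -cabs_gt0 (lt_le_trans d0).
  have dw : d / 2 <= cabs (gam x - (z + w)).
    have := cabsD (gam x - (z + w)) w.
    have -> : gam x - (z + w) + w = gam x - z by ring.
    lra.
  have xw0 : gam x - (z + w) != 0 by rewrite -cabs_gt0 (lt_le_trans _ dw)// divr_gt0.
  have -> : F n (gam x) - (gam x - (z + w))^-1 =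
      - (w / (gam x - z)) ^+ n.+1 / (gam x - (z + w)).
    have -> : F n (gam x) = (gam x - z)^-1 * \sum_(k < n.+1) (w / (gam x - z)) ^+ k.
      by rewrite mulr_sumr; apply: eq_bigr => k _; rewrite exprS exprMn; ring.
    have := subrX1 (w / (gam x - z)) n.+1.
    set S := \sum_(k < n.+1) _ => H.
    have -> : (w / (gam x - z)) ^+ n.+1 = 1 + (w / (gam x - z) - 1) * S by rewrite -H; ring.
    by field; rewrite x0 xw0.
  rewrite mulNr cabsN cabsM cabsV cabsX cabsM cabsV ltr_pdivrMr; last first.
    by rewrite (lt_le_trans _ dw)// divr_gt0.
  apply: (@lt_le_trans _ _ (e * (d / 2))); last by rewrite ler_pM2l.
  apply: le_lt_trans (hn0 n.+1 (leqW n0n)).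
  rewrite lerXn2r ?nnegrE ?divr_ge0 ?cabs_ge0 ?invr_ge0//.
  rewrite ler_pdivrMr ?(lt_le_trans d0)// ltW// (lt_le_trans wd)//; lra.
have [J GJ IJ] := is_contour_integral_unif FG FI.
have -> // : I = J.
by apply: ccvg_unique IJ => e e0; exists 0%N => n _; rewrite subrr cabs0.
Qed.

(** Here the geometric series is in [x / z], of modulus at most 1/2: all its terms are multiples of
    nonnegative powers of [x], which integrate to 0. *)
Lemma winding_far (B : R) z : (forall x, 0 <= x <= 1 -> cabs (gam x) <= B) ->
  0 < B -> 2 * B < cabs z -> is_contour_integral gam (fun x => (x - z)^-1) 0.
Proof.
move=> gB B0 zB.
have z0 : z != 0 by rewrite -cabs_gt0 (lt_trans _ zB)// mulr_gt0.
pose F n x := \sum_(k < n.+1) (- z^-1 ^+ k.+1) * x ^+ k.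
have FI n : is_contour_integral gam (F n) 0.
  have -> : 0 = \sum_(k < n.+1) (0 : C) by rewrite big1.
  apply: is_contour_integral_sum => k.
  rewrite -[0 in X in is_contour_integral _ _ X](mulr0 (- z^-1 ^+ k.+1)).
  exact/is_contour_integralZ/contour_integral_expr.
have FG : unif F (fun x => (x - z)^-1).
  move=> e e0; have ed0 : 0 < e * B by rewrite mulr_gt0.
  have [||n0 hn0] := @expr_small 2^-1 _ _ _ ed0.
  - by rewrite invr_ge0.
  - by rewrite invf_lt1// ltr1n.
  exists n0 => n x n0n x01; have dx := gB x x01.
  have dw : B <= cabs (gam x - z).
    have := cabsD (gam x - z) (- gam x).
    have -> : gam x - z + - gam x = - z by ring.
    rewrite !cabsN; lra.
  have x0 : gam x - z != 0 by rewrite -cabs_gt0 (lt_le_trans B0).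
  have -> : F n (gam x) - (gam x - z)^-1 = - (gam x / z) ^+ n.+1 / (gam x - z).
    have -> : F n (gam x) = - z^-1 * \sum_(k < n.+1) (gam x / z) ^+ k.
      by rewrite mulr_sumr; apply: eq_bigr => k _; rewrite exprS exprMn; ring.
    have := subrX1 (gam x / z) n.+1.
    set S := \sum_(k < n.+1) _ => H.
    have -> : (gam x / z) ^+ n.+1 = 1 + (gam x / z - 1) * S by rewrite -H; ring.
    by field; rewrite x0 z0.
  rewrite mulNr cabsN cabsM cabsV cabsX cabsM cabsV ltr_pdivrMr; last first.
    by rewrite (lt_le_trans _ dw).
  apply: (@lt_le_trans _ _ (e * B)); last by rewrite ler_pM2l.
  apply: le_lt_trans (hn0 n.+1 (leqW n0n)).
  rewrite lerXn2r ?nnegrE ?divr_ge0 ?cabs_ge0 ?invr_ge0//.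
  rewrite ler_pdivrMr ?cabs_gt0//; lra.
have [J GJ IJ] := is_contour_integral_unif FG FI.
have -> // : 0 = J.
by apply: ccvg_unique IJ => e e0; exists 0%N => n _; rewrite subrr cabs0.
Qed.

(** On the component of [z] the set [O] is open and closed by [winding_near], and it is nonempty
    because an unbounded component contains points to which [winding_far] applies. *)
Lemma winding_exterior z : jordan_exterior gam z ->
  is_contour_integral gam (fun x => (x - z)^-1) 0.
Proof.
case=> zc unb.
have [B B0 gB] := ucont_bounded gam_ucont.
pose K := connected_component (~` curve gam) z.
have KC : K `<=` ~` curve gam by exact: connected_component_sub.
have [z1 Kz1 z1B] : exists2 z1, K z1 & 2 * B < cabs z1.
  apply: contrapT => no; apply: unb.
  exists ((2 * B)%:C)%C; split; first by rewrite complex_real.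
  move=> M hM w Kw /=; rewrite cabsE (le_trans _ (ltW hM))// lecR leNgt.
  by apply/negP => wB; apply: no; exists w.
have z10 := winding_far gB B0 z1B.
pose O := [set w | ~ curve gam w /\ is_contour_integral gam (fun x => (x - w)^-1) 0].
pose O' := [set w | ~ curve gam w /\ ~ is_contour_integral gam (fun x => (x - w)^-1) 0].
have ballP (w v : C) (r : R) : 0 < r -> ball w ((r%:C)%C : C) v -> cabs (v - w) < r.
  by move=> r0; rewrite -ball_normE /= cabs_lt ?real_complex_gt0// cabsB.
have opO : open O.
  rewrite openE => w [wc wI]; have [d d0 wd] := curve_dist wc.
  have d20 : 0 < d / 2 by rewrite divr_gt0.
  apply/nbhs_ballP; exists ((d / 2)%:C)%C; first exact: real_complex_gt0.
  move=> v /(ballP _ _ _ d20) vw; split.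
    case=> x x01 xv; have := wd x x01; rewrite xv; lra.
  have := winding_near d0 wd vw wI.
  by rewrite [w + _]addrC subrK.
have opO' : open O'.
  rewrite openE => w [wc wI]; have [d d0 wd] := curve_dist wc.
  (* For [v] within [d / 4] of [w], the curve keeps distance [3 d / 4] from [v], and [d / 4] is less
     than half of that: [winding_near] leads back from [v] to [w]. *)
  have d40 : 0 < d / 4 by rewrite divr_gt0.
  apply/nbhs_ballP; exists ((d / 4)%:C)%C; first exact: real_complex_gt0.
  move=> v /(ballP _ _ _ d40) vw; split.
    case=> x x01 xv; have := wd x x01; rewrite xv; lra.
  move=> vI; apply: wI.
  have vd x : 0 <= x <= 1 -> d * (3 / 4) <= cabs (gam x - v).
    move=> /wd; have := cabsD (gam x - v) (v - w).
    rewrite subrKA; lra.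
  have := @winding_near (d * (3 / 4)) v (w - v) 0 _ vd _ vI.
  rewrite [v + _]addrC subrK; apply; rewrite ?mulr_gt0 ?divr_gt0//.
  by rewrite cabsB; lra.
have : K `&` O = K.
  apply: (@component_connected _ (~` curve gam) z).
  - by exists z1; split=> //; split=> //; exact: KC.
  - by exists O.
  - exists (~` O'); first exact: open_closedC.
    apply/seteqP; split => w [Kw]; first by case=> wc wI; split=> // -[].
    move=> wO'; split=> //; split; first exact: KC.
    by apply: contrapT => wI; apply: wO'; split=> //; exact: KC.
move/seteqP => [_ /(_ z)] [|_ [] //].
exact: connected_component_refl.
Qed.

End ContourIntegral.

(** * Laurent polynomial functions *)

Section LaurentFunctions.
Variable K : fieldType.
Implicit Types (f g : K -> K) (p : {poly K}).

(** These are the Laurent polynomials seen as functions. Nothing is required at 0, where [x^-1]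
    takes the default value 0. *)
Definition lfun f := exists p k, forall x, x != 0 -> f x = p.[x] / x ^+ k.

Lemma lfun_ext f g : (forall x, x != 0 -> f x = g x) -> lfun f -> lfun g.
Proof.
by move=> fg [p [k fE]]; exists p, k => x x0; rewrite -fg// fE.
Qed.

Lemma lfun_horner p : lfun (horner p).
Proof. by exists p, 0%N => x _; rewrite expr0 divr1. Qed.

Lemma lfun_cst (c : K) : lfun (fun=> c).
Proof. by apply: lfun_ext (lfun_horner c%:P) => x _; rewrite hornerC. Qed.

Lemma lfun_id : lfun id.
Proof. by apply: lfun_ext (lfun_horner 'X) => x _; rewrite hornerX. Qed.

Lemma lfunV : lfun (fun x => x^-1).
Proof. by exists 1, 1%N => x _; rewrite hornerC expr1 mul1r. Qed.

Lemma lfunD f g : lfun f -> lfun g -> lfun (fun x => f x + g x).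
Proof.
move=> [p [k fE]] [r [l gE]]; exists (p * 'X^l + r * 'X^k), (k + l)%N => x x0.
by rewrite fE// gE// ?hornerD !hornerM ?hornerXn exprD; field; rewrite !expf_neq0.
Qed.

Lemma lfunM f g : lfun f -> lfun g -> lfun (fun x => f x * g x).
Proof.
move=> [p [k fE]] [r [l gE]]; exists (p * r), (k + l)%N => x x0.
by rewrite fE// gE// ?hornerD !hornerM ?hornerXn exprD; field; rewrite !expf_neq0.
Qed.

Lemma lfunZ (c : K) f : lfun f -> lfun (fun x => c * f x).
Proof. by move=> hf; apply: lfunM => //; exact: lfun_cst. Qed.

Lemma lfunN f : lfun f -> lfun (fun x => - f x).
Proof. by move=> /(lfunZ (-1)); apply: lfun_ext => x _; rewrite mulN1r. Qed.

Lemma lfunB f g : lfun f -> lfun g -> lfun (fun x => f x - g x).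
Proof. by move=> hf hg; apply: lfunD => //; exact: lfunN. Qed.

Lemma lfunX f n : lfun f -> lfun (fun x => f x ^+ n).
Proof.
move=> hf; elim: n => [|n ih]; first exact: lfun_cst.
by apply: lfun_ext (lfunM hf ih) => x _; rewrite exprS.
Qed.

Lemma lfunXz (n : int) : lfun (fun x => x ^ n).
Proof.
case: n => n; first exact: lfunX lfun_id.
apply: lfun_ext (lfunX n.+1 lfunV) => x _; by rewrite exprVn.
Qed.

Lemma lfun_sum (I : Type) (r : seq I) (F : I -> K -> K) :
  (forall i, lfun (F i)) -> lfun (fun x => \sum_(i <- r) F i x).
Proof.
move=> hF; elim: r => [|i r ih].
  by apply: lfun_ext (lfun_cst 0) => x _; rewrite big_nil.
by apply: lfun_ext (lfunD (hF i) ih) => x _; rewrite big_cons.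
Qed.

Lemma lfun_prod (I : Type) (r : seq I) (F : I -> K -> K) :
  (forall i, lfun (F i)) -> lfun (fun x => \prod_(i <- r) F i x).
Proof.
move=> hF; elim: r => [|i r ih].
  by apply: lfun_ext (lfun_cst 1) => x _; rewrite big_nil.
by apply: lfun_ext (lfunM (hF i) ih) => x _; rewrite big_cons.
Qed.

Lemma lfunE f : lfun f -> exists (c : nat -> K) n k, forall x, x != 0 ->
  f x = \sum_(i < n) c i * x ^ (i%:Z - k%:Z).
Proof.
move=> [p [k fE]]; exists (fun i => p`_i), (size p), k => x x0.
rewrite fE// horner_coef mulr_suml; apply: eq_bigr => i _.
by rewrite expfzDr// -exprnN -exprnP mulrA.
Qed.

Lemma lfun_comp f (s : K) : s != 0 -> lfun f -> lfun (fun x => f (s / x)).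
Proof.
move=> s0 /lfunE[c [n [k fE]]].
have : lfun (fun x => \sum_(i < n)
    c i * (s ^ (i%:Z - k%:Z) * x ^ (- (i%:Z - k%:Z)))).
  by apply: lfun_sum => i; do 2 apply: lfunZ; exact: lfunXz.
apply: lfun_ext => x x0; rewrite fE ?mulf_neq0 ?invr_eq0//.
by apply: eq_bigr => i _; rewrite exprzMl ?unitfE ?invr_eq0// exprz_inv.
Qed.

End LaurentFunctions.

(** * Integrals of rational functions with separated poles *)

Section Residues.
Variables (R : realType) (gam : R -> Cx R).
Local Notation C := (Cx R).
Implicit Types (F G : C -> C) (I J : C) (l : seq C) (e f x : C) (n : int).
Hypothesis gam_rect : rectifiable gam.
Hypothesis gam_closed : gam 0 = gam 1.
Hypothesis gam_cont : {within `[0, 1], continuous gam}.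

Local Notation cint := (is_contour_integral gam).
Local Notation tpi := (two_pi_i R).

(* In terms of winding numbers: [e s] is enclosed by the curve, [1/e] is not. *)
Definition separated s e := [/\ e != 0, ~ curve gam (e * s), ~ curve gam e^-1,
  cint (fun x => (x - e * s)^-1) tpi & cint (fun x => (x - e^-1)^-1) 0].

Hypothesis gam0 : ~ curve gam 0.
Hypothesis wind0 : cint (fun x => (x - 0)^-1) tpi.

Definition rprod l (y : C) := \prod_(e <- l) (1 - e * y)^-1.

Lemma gam_neq0 (t : R) : 0 <= t <= 1 -> gam t != 0.
Proof. by move=> t01; apply/eqP => g0; apply: gam0; exists t. Qed.

Lemma two_pi_i_neq0 : tpi != 0.
Proof.
rewrite /two_pi_i !mulf_neq0 ?pnatr_eq0//; last exact: neq0Ci.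
by rewrite eq_complex /= negb_and gt_eqF ?pi_gt0.
Qed.

Lemma contour_integral_laurent n :
  cint (fun x => x ^ n / x) (if n == 0 then tpi else 0).
Proof.
case: n => [[|n]|n] /=.
- by apply: is_contour_integral_ext wind0 => t _; rewrite subr0 expr0z mul1r.
- apply: is_contour_integral_ext (contour_integral_expr gam_rect gam_closed gam_cont n).
  by move=> t t01; rewrite -exprnP exprSr mulfK// gam_neq0.
apply: is_contour_integral_ext
  (contour_integral_exprV gam_rect gam_closed gam_cont n gam0) => t _.
by rewrite subr0 NegzE -exprnN -exprVn [LHS]exprSr.
Qed.

Section Separated.
Variable s : C.
Hypothesis s0 : s != 0.

Lemma sep_inner e (t : R) : separated s e -> 0 <= t <= 1 -> 1 - e * (s / gam t) != 0.
Proof.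
move=> [_ es _ _ _] t01; apply/eqP => /(congr1 ( *%R^~ (gam t))).
rewrite mul0r mulrBl mul1r -!mulrA mulVf ?gam_neq0// mulr1 => /eqP.
by rewrite subr_eq0 => /eqP ge; apply: es; exists t.
Qed.

Lemma sep_outer e (t : R) : separated s e -> 0 <= t <= 1 -> 1 - e * gam t != 0.
Proof.
move=> [e0 _ es _ _] t01; apply/eqP => /eqP; rewrite subr_eq0 => /eqP e1.
by apply: es; exists t => //; rewrite -[RHS]mulr1 e1 mulKf.
Qed.

(** If [e f s = 1], then [e s = 1/f], and the integral of [1/(x - e s)] would be both [2 pi i] and
    0. *)
Lemma sep_sep e f : separated s e -> separated s f -> 1 - e * f * s != 0.
Proof.
move=> [e0 _ _ eI _] [f0 _ _ _ fI]; apply/eqP => /eqP; rewrite subr_eq0 => /eqP ef.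
have efs : e * s = f^-1 by rewrite -[RHS]mul1r ef mulrAC mulfK.
rewrite efs in eI; have := is_contour_integral_unique eI fI.
by apply/eqP; exact: two_pi_i_neq0.
Qed.

(** With [r = 1/(1 - e x)] one has [r^(n+1)/x = r^n/x + e r^(n+1)]. The last term integrates to 0:
    for [n = 0] because [1/e] is not enclosed, otherwise because it has a primitive. *)
Lemma integral_power_outer e (n : nat) : separated s e ->
  cint (fun x => (1 - e * x)^-1 ^+ n / x) tpi.
Proof.
move=> se; have [e0 _ ec _ eI] := se.
elim: n => [|n ih].
  by apply: is_contour_integral_ext (contour_integral_laurent 0) => t _.
have step : cint (fun x => (x - e^-1)^-1 ^+ n.+1) 0.
  case: n {ih} => [|n]; last exact: contour_integral_exprV.
  by apply: is_contour_integral_ext eI => t _; rewrite expr1.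
rewrite -[tpi]add0r -[0 in X in cint _ X](mulr0 (e * (- e^-1) ^+ n.+1)).
apply: is_contour_integral_ext (is_contour_integral_lin _ step ih) => t t01.
have g0 := gam_neq0 t01; have r0 := sep_outer se t01.
have -> : gam t - e^-1 = - e^-1 * (1 - e * gam t) by field.
rewrite -mulrA -exprMn; have -> : - e^-1 * (- e^-1 * (1 - e * gam t))^-1 =
  (1 - e * gam t)^-1 by field; rewrite e0 r0.
by rewrite exprS; field; rewrite r0 g0.
Qed.

(** With [u = 1/(x - e s)] the factor is [x u = 1 + e s u]. Raising the exponent from [n+1] to [n+2]
    adds [e s u^2 (x u)^n], whose binomial expansion contains only powers of [u] from the second on,
    and these integrate to 0. Exponents 0 and 1 are treated directly. *)
Lemma integral_power_inner e (n : nat) : separated s e ->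
  cint (fun x => (1 - e * (s / x))^-1 ^+ n / x) tpi.
Proof.
move=> se; have [e0 ec _ eI _] := se.
have es0 : e * s != 0 by rewrite mulf_neq0.
have rE t : 0 <= t <= 1 ->
    (1 - e * (s / gam t))^-1 = gam t * (gam t - e * s)^-1 /\ gam t - e * s != 0.
  move=> t01; have g0 := gam_neq0 t01; have r0 := sep_inner se t01.
  have r1 : gam t - e * s = gam t * (1 - e * (s / gam t)) by field.
  by rewrite r1 invfM mulVKf// mulf_neq0.
elim: n => [|[_|n ih]].
- by apply: is_contour_integral_ext (contour_integral_laurent 0) => t _.
- apply: is_contour_integral_ext eI => t t01; have [-> _] := rE t t01.
  by rewrite expr1 mulrAC mulfV ?mul1r// gam_neq0.
have step : cint (fun x => \sum_(k < n.+1)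
    (e * s) ^+ k *+ 'C(n, k) * (x - e * s)^-1 ^+ k.+2) (\sum_(k < n.+1) 0).
  apply: is_contour_integral_sum => k.
  rewrite -[0 in X in cint _ X](mulr0 ((e * s) ^+ k *+ 'C(n, k))).
  exact/is_contour_integralZ/contour_integral_exprV.
rewrite big1// in step.
rewrite -[tpi]add0r -[0 in X in cint _ X](mulr0 (e * s)).
apply: is_contour_integral_ext (is_contour_integral_lin _ step ih) => t t01.
have g0 := gam_neq0 t01; have [-> r1] := rE t t01.
set u := (gam t - e * s)^-1; set g := gam t.
have gu : g * u = 1 + e * s * u.
  by rewrite -[g](subrK (e * s)) mulrDl mulfV.
have -> : \sum_(k < n.+1) (e * s) ^+ k *+ 'C(n, k) * u ^+ k.+2 = u ^+ 2 * (g * u) ^+ n.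
  rewrite gu exprDn mulr_sumr; apply: eq_bigr => k _.
  rewrite expr1n mul1r (exprMn _ (e * s)) -add2n exprD !mulrnAl !mulrnAr.
  by congr (_ *+ _); ring.
rewrite [in RHS]exprS [in LHS](exprS _ n) [in RHS](exprS _ n).
have -> : e * s * (u ^+ 2 * (g * u) ^+ n) = (e * s * u) * u * (g * u) ^+ n by ring.
have -> : e * s * u = g * u - 1 by rewrite gu addrC addKr.
by field.
Qed.

(* Equal factors are handled by the powers above; distinct ones are separated
   by [r_e r_f = (e r_e - f r_f) / (e - f)], where [r_e = 1 / (1 - e y)]. *)
Lemma integral_rprod (y : C -> C) :
  (forall e (t : R), separated s e -> 0 <= t <= 1 -> 1 - e * y (gam t) != 0) ->
  (forall e (n : nat), separated s e -> cint (fun x => (1 - e * y x)^-1 ^+ n / x) tpi) ->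
  forall l, (forall e, e \in l -> separated s e) -> cint (fun x => rprod l (y x) / x) tpi.
Proof.
move=> y0 yI l; have [m] := ubnP (size l).
elim: m l => // m ih [|e l] /= lm hl.
  apply: is_contour_integral_ext (contour_integral_laurent 0) => t _.
  by rewrite /rprod big_nil.
have [|] := boolP (all (pred1 e) l).
  move/all_pred1P => ->; apply: is_contour_integral_ext (yI e (size l).+1 _) => [t _|].
    by rewrite /rprod big_cons big_nseq iter_mulr mulr1 exprS.
  by apply: hl; rewrite inE eqxx.
rewrite -has_predC => /hasP[f fl /= fe].
have pl := perm_to_rem fl; set l' := rem f l in pl.
have size_l : size l = (size l').+1 by rewrite (perm_size pl).
have fel : forall z, z \in e :: f :: l' -> separated s z.
  by move=> z; rewrite inE -(perm_mem pl) -in_cons; exact: hl.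
have I1 : cint (fun x => rprod (e :: l') (y x) / x) tpi.
  apply: ih => [|z zl]; first by rewrite /= -size_l.
  by apply: fel; move: zl; rewrite !inE => /orP[->//|->]; rewrite !orbT.
have I2 : cint (fun x => rprod (f :: l') (y x) / x) tpi.
  apply: ih => [|z zl]; first by rewrite /= -size_l.
  by apply: fel; rewrite in_cons zl orbT.
have ef : e - f != 0 by rewrite subr_eq0 eq_sym.
(* The two partial fraction coefficients add up to 1, so the value stays [2 pi i]. *)
have -> : tpi = e / (e - f) * tpi + - (f / (e - f)) * tpi by field.
apply: is_contour_integral_ext
  (is_contour_integral_lin _ I1 (is_contour_integralZ _ I2)) => t t01.
have e0 : 1 - e * y (gam t) != 0 by apply: y0 => //; apply: fel; rewrite inE eqxx.
have f0 : 1 - f * y (gam t) != 0 by apply: y0 => //; apply: fel; rewrite !inE eqxx orbT.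
rewrite /rprod !big_cons (perm_big _ pl) /= big_cons.
by field; rewrite ef e0 f0 gam_neq0.
Qed.

(** Existence of both integrals is part of the notion, since [contour_integral] could compare
    default values. *)
Definition same_integral F G :=
  exists2 I, cint (fun x => F x / x) I & cint (fun x => G x / x) I.

Lemma same_lin (z : C) F F' G G' : same_integral F F' -> same_integral G G' ->
  same_integral (fun x => z * F x + G x) (fun x => z * F' x + G' x).
Proof.
move=> [I FI F'I] [J GJ G'J]; exists (z * I + J).
  apply: is_contour_integral_ext (is_contour_integral_lin z FI GJ) => t _.
  by rewrite mulrDl mulrA.
apply: is_contour_integral_ext (is_contour_integral_lin z F'I G'J) => t _.
by rewrite mulrDl mulrA.
Qed.

Lemma same_ext F F' G G' :
  (forall t : R, 0 <= t <= 1 -> F (gam t) = F' (gam t) /\ G (gam t) = G' (gam t)) ->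
  same_integral F G -> same_integral F' G'.
Proof.
move=> FG [I FI GI]; exists I.
  by apply: is_contour_integral_ext FI => t /FG[->].
by apply: is_contour_integral_ext GI => t /FG[_ ->].
Qed.

Lemma same_sym F G : same_integral F G -> same_integral G F.
Proof. by case=> I FI GI; exists I. Qed.

Lemma same0 : same_integral (fun=> 0) (fun=> 0).
Proof.
by exists 0; apply: is_contour_integral_ext (is_contour_integral0 gam) => t _;
  rewrite mul0r.
Qed.

Lemma sameZ (z : C) F G : same_integral F G ->
  same_integral (fun x => z * F x) (fun x => z * G x).
Proof.
move=> /(same_lin z)/(_ same0); apply: same_ext => t _; by rewrite !addr0.
Qed.

Lemma sameD F F' G G' : same_integral F F' -> same_integral G G' ->
  same_integral (fun x => F x + G x) (fun x => F' x + G' x).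
Proof.
move=> FF' GG'; apply: same_ext (same_lin 1 FF' GG') => t _; by rewrite !mul1r.
Qed.

Lemma same_sum (T : Type) (r : seq T) (F G : T -> C -> C) :
  (forall i, same_integral (F i) (G i)) ->
  same_integral (fun x => \sum_(i <- r) F i x) (fun x => \sum_(i <- r) G i x).
Proof.
move=> FG; elim: r => [|i r ih].
  by apply: same_ext same0 => t _; rewrite !big_nil.
by apply: same_ext (sameD (FG i) ih) => t _; rewrite !big_cons.
Qed.

(** Induction on the poles, then on [n]: with [r = 1/(1 - e y)], the relation
    [e y^(k+1) r = y^k r - y^k] moves the exponent by one at the price of a term without the pole
    [e]. At exponent 0 both integrals are [2 pi i] by [integral_rprod]; without poles every other
    exponent gives 0. *)
Lemma same_pure l n : (forall e, e \in l -> separated s e) ->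
  same_integral (fun x => (s / x) ^ n * rprod l (s / x)) (fun x => x ^ n * rprod l x).
Proof.
elim: l n => [|e l ih] n hl.
  have [->|n0] := eqVneq n 0.
    have I0 := contour_integral_laurent 0.
    by exists tpi; apply: is_contour_integral_ext I0 => t _;
      rewrite !expr0z /rprod big_nil mulr1.
  exists 0; last first.
    have := contour_integral_laurent n; rewrite (negPf n0).
    by apply: is_contour_integral_ext => t _; rewrite /rprod big_nil mulr1.
  rewrite -(mulr0 (s ^ n)).
  have := contour_integral_laurent (- n); rewrite oppr_eq0 (negPf n0).
  move/(is_contour_integralZ (s ^ n)); apply: is_contour_integral_ext => t t01.
  by rewrite /rprod big_nil mulr1 exprzMl ?unitfE ?invr_eq0 ?gam_neq0// exprz_inv mulrA.
have se : separated s e by apply: hl; rewrite inE eqxx.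
have e0 : e != 0 by case: se.
have {}ih k : same_integral (fun x => (s / x) ^ k * rprod l (s / x))
    (fun x => x ^ k * rprod l x).
  by apply: ih => f fl; apply: hl; rewrite inE fl orbT.
have recE (y : C) (k : int) : y != 0 -> 1 - e * y != 0 ->
    e * (y ^ (k + 1) * rprod (e :: l) y) = y ^ k * rprod (e :: l) y - y ^ k * rprod l y.
  move=> y0 r0; rewrite /rprod big_cons expfzDr// expr1z; by field.
have nz (t : R) : 0 <= t <= 1 -> [/\ gam t != 0, s / gam t != 0,
    1 - e * (s / gam t) != 0 & 1 - e * gam t != 0].
  move=> t01; rewrite mulf_neq0 ?invr_eq0 ?gam_neq0//.
  by rewrite sep_inner// sep_outer.
elim/int_ind: n => [|n Hn|n Hn].
- exists tpi.
    apply: is_contour_integral_ext (@integral_rprod (fun x => s / x) _ _ (e :: l) hl).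
    + by move=> t _; rewrite expr0z mul1r.
    + by move=> f t sf t01; exact: sep_inner.
    + by move=> f k sf; exact: integral_power_inner.
  apply: is_contour_integral_ext (@integral_rprod id _ _ (e :: l) hl).
  + by move=> t _; rewrite expr0z mul1r.
  + by move=> f t sf t01; exact: sep_outer.
  + by move=> f k sf; exact: integral_power_outer.
- apply: same_ext (sameZ e^-1 (same_lin (-1) (ih n) Hn)) => t /nz[g0 sg0 r1 r2].
  have [h1 h2] := (recE _ n sg0 r1, recE _ n g0 r2).
  by rewrite -[n.+1]addn1 PoszD !mulN1r ![- _ + _]addrC -h1 -h2 !mulKf.
apply: same_ext (same_lin e Hn (ih (- n.+1%:Z))) => t /nz[g0 sg0 r1 r2].
have := (recE _ (- n.+1%:Z) sg0 r1, recE _ (- n.+1%:Z) g0 r2).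
have -> : - n.+1%:Z + 1 = - n%:Z by lia.
by case=> -> ->; rewrite !subrK.
Qed.

(* Mixed products are reduced by
   [r_e(s/x) r_f(x) = (r_e(s/x) + r_f(x) - 1) / (1 - e f s)]. *)
Lemma same_mixed l1 l2 n : (forall e, e \in l1 -> separated s e) ->
  (forall e, e \in l2 -> separated s e) ->
  same_integral (fun x => x ^ n * rprod l1 (s / x) * rprod l2 x)
       (fun x => (s / x) ^ n * rprod l1 x * rprod l2 (s / x)).
Proof.
elim: l1 l2 => [|e l1 ih1] l2 h1 h2.
  apply: same_ext (same_sym (same_pure n h2)) => t _.
  by split; rewrite [rprod [::] _]big_nil mulr1.
have se : separated s e by apply: h1; rewrite inE eqxx.
have {}ih1 l : (forall e, e \in l -> separated s e) ->
    same_integral (fun x => x ^ n * rprod l1 (s / x) * rprod l x)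
       (fun x => (s / x) ^ n * rprod l1 x * rprod l (s / x)).
  by move=> hl; apply: ih1 => // f fl; apply: h1; rewrite inE fl orbT.
elim: l2 h2 => [_|f l2 ih2 h2].
  (* With [l2] empty, [x ^ n = s ^ n * (s / x) ^ (- n)] makes the integrand a function of [s / x]
     alone. *)
  apply: same_ext (sameZ (s ^ n) (same_pure (- n) h1)) => t t01.
  have g0 := gam_neq0 t01.
  have sn (y : C) : y != 0 -> s ^ n * y ^ (- n) = (s / y) ^ n.
    by move=> y0; rewrite -exprz_inv -exprzMl ?unitfE ?invr_eq0.
  have sg0 : s / gam t != 0 by rewrite mulf_neq0 ?invr_eq0.
  have sg : s / (s / gam t) = gam t by rewrite invf_div mulrCA mulfV ?mulr1.
  by split; rewrite mulrA sn ?sg// [rprod [::] _]big_nil mulr1.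
have sf : separated s f by apply: h2; rewrite inE eqxx.
have {}h2' g : g \in l2 -> separated s g by move=> gl; apply: h2; rewrite inE gl orbT.
have efs := sep_sep se sf.
apply: same_ext (sameZ (1 - e * f * s)^-1
  (sameD (ih2 h2') (same_lin (-1) (ih1 l2 h2') (ih1 (f :: l2) h2)))) => t t01.
have g0 := gam_neq0 t01.
have [p1 p2] := (sep_inner se t01, sep_inner sf t01).
have [p3 p4] := (sep_outer se t01, sep_outer sf t01).
rewrite /rprod !big_cons.
have rr (y1 y2 A B D : C) : y1 * y2 = s -> 1 - e * y1 != 0 -> 1 - f * y2 != 0 ->
    (1 - e * f * s)^-1 * (D * ((1 - e * y1)^-1 * A) * B
      + (-1 * (D * A * B) + D * A * ((1 - f * y2)^-1 * B)))
    = D * ((1 - e * y1)^-1 * A) * ((1 - f * y2)^-1 * B).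
  move=> ys e1 f1; rewrite -ys in efs *.
  by field; rewrite e1 f1 efs.
by split; apply: rr => //; field.
Qed.

Lemma same_lfun l1 l2 (h : C -> C) : lfun h -> (forall e, e \in l1 -> separated s e) ->
  (forall e, e \in l2 -> separated s e) ->
  same_integral (fun x => h x * (rprod l1 (s / x) * rprod l2 x))
       (fun x => h (s / x) * (rprod l1 x * rprod l2 (s / x))).
Proof.
move=> /lfunE[c [n [k hE]]] h1 h2.
have := same_sum (index_enum 'I_n) (fun i =>
  sameZ (c i) (same_mixed (i%:Z - k%:Z) h1 h2)).
apply: same_ext => t t01; have g0 := gam_neq0 t01.
have sg0 : s / gam t != 0 by rewrite mulf_neq0 ?invr_eq0.
by split; rewrite hE// mulr_suml; apply: eq_bigr => i _; rewrite !mulrA.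
Qed.

End Separated.
End Residues.

(** * Infinite products *)

Section UniformProducts.
Variables (R : realType) (gam : R -> Cx R).
Local Notation C := (Cx R).
Implicit Types (F G : nat -> C -> C) (f g y : C -> C).

Definition bounded_on f := exists2 B : R, 0 < B &
  forall t : R, 0 <= t <= 1 -> cabs (f (gam t)) <= B.

(** The bound common to all [n] makes the notion stable under products. *)
Definition unifb F f := unif gam F f /\ exists2 B : R, 0 < B &
  forall n (t : R), 0 <= t <= 1 -> cabs (F n (gam t)) <= B.

Lemma unifb_ext F G f g :
  (forall n (t : R), 0 <= t <= 1 -> F n (gam t) = G n (gam t)) ->
  (forall t : R, 0 <= t <= 1 -> f (gam t) = g (gam t)) ->
  unifb F f -> unifb G g.
Proof.
move=> FG fg [Ff [B B0 FB]]; split.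
  by move=> e /Ff[n0 h]; exists n0 => n t n0n t01; rewrite -FG// -fg// h.
by exists B => // n t t01; rewrite -FG// FB.
Qed.

Lemma unifb_cst f : bounded_on f -> unifb (fun=> f) f.
Proof.
move=> [B B0 fB]; split; last by exists B.
by move=> e e0; exists 0%N => n t _ _; rewrite subrr cabs0.
Qed.

Lemma unif_bounded F f : unifb F f -> bounded_on f.
Proof.
move=> [Ff [B B0 FB]]; exists (B + 1); first by rewrite addr_gt0.
move=> t t01; have [n0 h] := Ff _ ltr01.
have {h}h := h n0 t (leqnn _) t01; rewrite -(subrK (F n0 (gam t)) (f _)).
by rewrite (le_trans (cabsD _ _))// addrC lerD ?FB// cabsB ltW.
Qed.

Lemma unifb_shift F f : unifb F f -> unifb (fun n => F n.+1) f.
Proof.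
move=> [Ff [B B0 FB]]; split; last by exists B => // n t; exact: FB.
by move=> e /Ff[n0 h]; exists n0 => n t n0n; apply: h; exact: leqW.
Qed.

Lemma unifbM F G f g : unifb F f -> unifb G g ->
  unifb (fun n x => F n x * G n x) (fun x => f x * g x).
Proof.
move=> uF uG; have [A A0 gA] := unif_bounded uG.
case: uF uG => Ff [B B0 FB] [Gg [D D0 GD]]; split; last first.
  exists (B * D); first by rewrite mulr_gt0.
  by move=> n t t01; rewrite cabsM ler_pM ?cabs_ge0 ?FB ?GD.
move=> e e0.
have [n1 h1] := Ff _ (divr_gt0 e0 (mulr_gt0 (ltr0n _ 2) A0)).
have [n2 h2] := Gg _ (divr_gt0 e0 (mulr_gt0 (ltr0n _ 2) B0)).
exists (maxn n1 n2) => n t; rewrite geq_max => /andP[n1n n2n] t01.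
have {}h1 := h1 n t n1n t01; have {}h2 := h2 n t n2n t01.
have -> : F n (gam t) * G n (gam t) - f (gam t) * g (gam t) =
  F n (gam t) * (G n (gam t) - g (gam t)) + (F n (gam t) - f (gam t)) * g (gam t).
  by ring.
have -> : e = B * (e / (2 * B)) + (e / (2 * A)) * A by field; rewrite !gt_eqF.
rewrite (le_lt_trans (cabsD _ _))// !cabsM ltr_leD//.
  by rewrite (le_lt_trans (ler_wpM2r (cabs_ge0 _) (FB n t t01)))// ltr_pM2l.
by rewrite ler_pM ?cabs_ge0 ?gA// ltW.
Qed.

Lemma unif_ccvg F f (t : R) : unifb F f -> 0 <= t <= 1 ->
  ccvg (fun n => F n (gam t)) (f (gam t)).
Proof. by move=> [Ff _] t01 e /Ff[n0 h]; exists n0 => n n0n; exact: h. Qed.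

Lemma ccvg_lim (u : nat -> C) (l : C) : ccvg u l -> limn u = l.
Proof. by move=> /ccvgP ul; apply: cvg_lim => //; exact: norm_hausdorff. Qed.

Lemma geometric_sum_le (r : R) n : 0 <= r < 1 ->
  \sum_(j < n) r ^+ j <= (1 - r)^-1.
Proof.
move=> /andP[r0 r1]; have := subrX1 r n.
set S := \sum_(j < n) _ => h; rewrite -[leRHS]mul1r ler_pdivlMr ?subr_gt0//.
have := exprn_ge0 n r0; lra.
Qed.

(** Since [1 + t <= exp t], the partial products are at most [exp (M / (1 - r))]; consecutive ones
    then differ by at most a constant times [r^n], and the tails are geometric. *)
Lemma prod_unif (w : nat -> C -> C) (M r : R) : 0 < M -> 0 <= r < 1 ->
  (forall j (t : R), 0 <= t <= 1 -> cabs (w j (gam t)) <= M * r ^+ j) ->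
  unifb (fun n x => \prod_(j < n) (1 + w j x))
        (fun x => limn (fun n => \prod_(j < n) (1 + w j x))).
Proof.
move=> M0 r01 wM; have /andP[r0 r1] := r01.
have r1' : 0 < 1 - r by rewrite subr_gt0.
pose F n x := \prod_(j < n) (1 + w j x).
pose B := expR (M / (1 - r)).
have B0 : 0 < B by exact: expR_gt0.
have FB n (t : R) : 0 <= t <= 1 -> cabs (F n (gam t)) <= B.
  move=> t01; have : cabs (F n (gam t)) <= expR (\sum_(j < n) M * r ^+ j).
    rewrite /F; elim: n => [|n ih]; first by rewrite !big_ord0 cabs1 expR0.
    rewrite !big_ord_recr /= cabsM expRD ler_pM ?cabs_ge0//.
    rewrite (le_trans (cabsD _ _))// cabs1 (le_trans _ (expR_ge1Dx _))//.
    by rewrite lerD2l wM.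
  move=> /le_trans; apply; rewrite ler_expR -mulr_sumr ler_wpM2l ?(ltW M0)//.
  exact: geometric_sum_le.
have FF n k (t : R) : 0 <= t <= 1 ->
    cabs (F (n + k)%N (gam t) - F n (gam t)) <= B * M / (1 - r) * r ^+ n.
  move=> t01.
  have : cabs (F (n + k)%N (gam t) - F n (gam t)) <=
      B * M * r ^+ n * \sum_(j < k) r ^+ j.
    elim: k => [|k ih]; first by rewrite addn0 subrr cabs0 big_ord0 mulr0.
    rewrite addnS /F big_ord_recr -/(F _ _) /= mulrDr mulr1 addrAC.
    rewrite (le_trans (cabsD _ _))// big_ord_recr /= mulrDr lerD//.
    rewrite cabsM -[leRHS]mulrA -exprD -mulrA ler_pM ?cabs_ge0 ?FB//.
    exact: wM.
  move=> /le_trans; apply.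
  rewrite [leRHS]mulrAC ler_wpM2l ?geometric_sum_le//.
  by rewrite !mulr_ge0 ?exprn_ge0// ltW.
have small e : 0 < e -> exists n0, forall n, (n0 <= n)%N ->
    B * M / (1 - r) * r ^+ n < e.
  move=> e0; have b0 : 0 < B * M / (1 - r) by rewrite divr_gt0// mulr_gt0.
  have [n0 h] := expr_small r0 r1 (divr_gt0 e0 b0).
  by exists n0 => n /h; rewrite ltr_pdivlMr// mulrC.
split; last by exists B.
have lim (t : R) : 0 <= t <= 1 ->
    ccvg (fun n => F n (gam t)) (limn (fun n => F n (gam t))).
  move=> t01; have [e e0|l ul] := @ccauchy _ (fun n => F n (gam t)).
    have [n0 h] := small _ (divr_gt0 e0 (ltr0n _ 2)); exists n0 => m n n0m n0n.
    have e2 k : (n0 <= k)%N -> cabs (F k (gam t) - F n0 (gam t)) < e / 2.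
      by move=> /subnKC <-; rewrite (le_lt_trans (FF _ _ _ t01))// h.
    rewrite -(subrKA (F n0 (gam t))) (le_lt_trans (cabsD _ _))//.
    by rewrite [ltRHS]splitr ltrD ?e2// cabsB e2.
  by rewrite (ccvg_lim ul).
move=> e e0; have [n0 h] := small _ (divr_gt0 e0 (ltr0n _ 2)).
exists n0 => n t n0n t01; have [n1 h1] := lim t t01 _ (divr_gt0 e0 (ltr0n _ 2)).
have := FF n n1 t t01; have := h n n0n; have {h1} := h1 _ (leq_addl n n1).
rewrite -/(F n _) -/(F _) -(subrKA (F (n + n1)%N (gam t)) (F n _)) => l1 l2 l3.
rewrite (le_lt_trans (cabsD _ _))// [ltRHS]splitr ltrD//.
by rewrite cabsB (le_lt_trans l3).
Qed.

Variable q : C.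
Hypothesis q_lt1 : cabs q < 1.

Definition pochN n (z : C) := \prod_(j < n) (1 - z * q ^+ j).

Definition bounded_away f := exists2 d : R, 0 < d &
  forall t : R, 0 <= t <= 1 -> d <= cabs (f (gam t)).

Lemma pochN_unif y : bounded_on y ->
  unifb (fun n x => pochN n (y x)) (fun x => qpoch q (y x)).
Proof.
move=> [M M0 yM]; apply: (@prod_unif (fun j x => - (y x * q ^+ j)) M (cabs q)) => //.
  by rewrite cabs_ge0.
by move=> j t t01; rewrite cabsN cabsM cabsX ler_wpM2r ?exprn_ge0 ?cabs_ge0 ?yM.
Qed.

(** Only finitely many [j] need their own lower bound: from [n0] on, [|y q^j| <= 1/2]. *)
Lemma bounded_away_uniform y : bounded_on y ->
  (forall j, bounded_away (fun x => 1 - y x * q ^+ j)) ->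
  exists2 d : R, 0 < d & forall j (t : R), 0 <= t <= 1 ->
    d <= cabs (1 - y (gam t) * q ^+ j).
Proof.
move=> [M M0 yM] ya.
have [n0 hn0] := expr_small (cabs_ge0 q) q_lt1
  (divr_gt0 ltr01 (mulr_gt0 (ltr0n _ 2) M0)).
have [d d0 hd] : exists2 d : R, 0 < d & forall j (t : R), (j < n0)%N ->
    0 <= t <= 1 -> d <= cabs (1 - y (gam t) * q ^+ j).
  elim: n0 {hn0} => [|n [d d0 hd]]; first by exists 1.
  have [d' d'0 hd'] := ya n; exists (Num.min d d'); first by rewrite lt_min d0.
  move=> j t; rewrite ltnS leq_eqVlt => /orP[/eqP-> t01|jn t01].
    by rewrite ge_min hd' ?orbT.
  by rewrite ge_min hd.
exists (Num.min d 2^-1); first by rewrite lt_min d0 invr_gt0 ltr0n.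
move=> j t t01; rewrite ge_min; have [jn|jn] := ltnP j n0; first by rewrite hd.
apply/orP; right; have := cabsD (1 - y (gam t) * q ^+ j) (y (gam t) * q ^+ j).
rewrite subrK cabs1 cabsM cabsX => h.
have : cabs (y (gam t)) * cabs q ^+ j <= 2^-1.
  have -> : 2^-1 = M * (1 / (2 * M)) by field; rewrite gt_eqF.
  by rewrite ler_pM ?cabs_ge0 ?exprn_ge0 ?yM ?cabs_ge0// ltW// hn0.
lra.
Qed.

(** The inverse of [1 - z] is [1 + z / (1 - z)], so the inverses again form a product to which
    [prod_unif] applies. The two limits have product 1, which also shows that the infinite product
    does not vanish. *)
Lemma pochNV_unif y : bounded_on y ->
  (forall j, bounded_away (fun x => 1 - y x * q ^+ j)) ->
  unifb (fun n x => (pochN n (y x))^-1) (fun x => (qpoch q (y x))^-1) /\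
  (forall t : R, 0 <= t <= 1 -> qpoch q (y (gam t)) != 0).
Proof.
move=> yb ya; have [M M0 yM] := yb; have [d d0 hd] := bounded_away_uniform yb ya.
have nz j (t : R) : 0 <= t <= 1 -> 1 - y (gam t) * q ^+ j != 0.
  by move=> t01; rewrite -cabs_gt0 (lt_le_trans d0)// hd.
have := @prod_unif (fun j x => y x * q ^+ j / (1 - y x * q ^+ j)) (M / d) (cabs q).
have Md0 : 0 < M / d by rewrite divr_gt0.
move=> /(_ Md0); rewrite cabs_ge0 => /(_ q_lt1)[j t t01|].
  rewrite !cabsM cabsV cabsX mulrAC ler_wpM2r ?exprn_ge0 ?cabs_ge0//.
  rewrite ler_pM ?invr_ge0 ?cabs_ge0 ?yM//.
  by rewrite lef_pV2 ?hd// posrE// (lt_le_trans d0)// hd.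
set G := fun x => limn _ => u1.
move=> u2; have {u1 u2}uG := conj u1 u2.
have {uG}uG : unifb (fun n x => (pochN n (y x))^-1) G.
  apply: unifb_ext uG => // n t t01; rewrite /pochN -prodfV.
  apply: eq_bigr => j _; have := nz j t t01; set z := y (gam t) * q ^+ j.
  by move=> z0; field.
have G1 (t : R) : 0 <= t <= 1 -> qpoch q (y (gam t)) * G (gam t) = 1.
  move=> t01; have := unif_ccvg (unifbM (pochN_unif yb) uG) t01.
  move/ccvg_unique; apply => e e0; exists 0%N => n _.
  by rewrite divff ?subrr ?cabs0//; apply/prodf_neq0 => j _; exact: nz.
have q0 (t : R) : 0 <= t <= 1 -> qpoch q (y (gam t)) != 0.
  by move=> /G1; apply: contra_eq_neq => ->; rewrite mul0r eq_sym oner_neq0.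
split=> //; apply: unifb_ext uG => // t t01.
by rewrite -[RHS]mulr1 -(G1 t t01) mulKf ?q0.
Qed.

Definition qseq (E : seq C) n := [seq e * q ^+ j | e <- E, j <- iota 0 n].

Lemma mem_qseq E n z : z \in qseq E n -> exists2 e, e \in E & exists j, z = e * q ^+ j.
Proof. by case/allpairsP => -[e j] /= [eE _ ->]; exists e => //; exists j. Qed.

Lemma rprod_qseq E n (z : C) :
  rprod (qseq E n) z = \prod_(e <- E) (pochN n (e * z))^-1.
Proof.
rewrite /rprod big_allpairs_dep; apply: eq_bigr => e _.
rewrite /pochN -prodfV -(big_mkord xpredT (fun j => (1 - e * z * q ^+ j)^-1)).
by rewrite /index_iota subn0; apply: eq_bigr => j _; rewrite mulrAC.
Qed.

Lemma bounded_cst (z : C) : bounded_on (fun=> z).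
Proof.
exists (cabs z + 1); first by rewrite ltr_wpDl ?cabs_ge0.
by move=> t _; rewrite lerDl.
Qed.

Lemma bounded_M f g : bounded_on f -> bounded_on g -> bounded_on (fun x => f x * g x).
Proof.
move=> [A A0 fA] [B B0 gB]; exists (A * B); first by rewrite mulr_gt0.
by move=> t t01; rewrite cabsM ler_pM ?cabs_ge0 ?fA ?gB.
Qed.

Lemma bounded_D f g : bounded_on f -> bounded_on g -> bounded_on (fun x => f x + g x).
Proof.
move=> [A A0 fA] [B B0 gB]; exists (A + B); first by rewrite addr_gt0.
by move=> t t01; rewrite (le_trans (cabsD _ _))// lerD ?fA ?gB.
Qed.

Lemma rprod_unif (E : seq C) y : bounded_on y ->
  (forall e, e \in E -> forall j, bounded_away (fun x => 1 - e * y x * q ^+ j)) ->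
  unifb (fun n x => rprod (qseq E n) (y x))
        (fun x => \prod_(e <- E) (qpoch q (e * y x))^-1).
Proof.
move=> yb; elim: E => [|e E ih] ya.
  apply: unifb_ext (unifb_cst (bounded_cst 1)) => [n t _|t _].
    by rewrite rprod_qseq big_nil.
  by rewrite big_nil.
have eb : bounded_on (fun x => e * y x) by apply: bounded_M => //; exact: bounded_cst.
have [|u1 _] := pochNV_unif eb; first by apply: ya; rewrite inE eqxx.
have u2 : unifb (fun n x => rprod (qseq E n) (y x))
    (fun x => \prod_(e <- E) (qpoch q (e * y x))^-1).
  by apply: ih => f fE; apply: ya; rewrite inE fE orbT.
apply: unifb_ext (unifbM u1 u2) => [n t t01|t t01].
  by rewrite !rprod_qseq big_cons.
by rewrite big_cons.
Qed.

End UniformProducts.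

(** * Reflection [x |-> s/x] of weights given by infinite products *)

Section SeparatedPoles.
Variables (R : realType) (gam : R -> Cx R) (q : Cx R).
Local Notation C := (Cx R).
Implicit Types (h y : C -> C) (E : seq C).
Hypothesis q_neq0 : q != 0.
Hypothesis q_lt1 : cabs q < 1.
Hypothesis gam_rect : rectifiable gam.
Hypothesis gam_closed : gam 0 = gam 1.
Hypothesis gam_cont : {within `[0, 1], continuous gam}.
Hypothesis gam0 : ~ curve gam 0.
Local Notation cint := (is_contour_integral gam).
Local Notation tpi := (two_pi_i R).
Hypothesis wind0 : cint (fun x => (x - 0)^-1) tpi.

Let gam_neq0 := gam_neq0 gam0.

Lemma bounded_id : bounded_on gam id.
Proof. exact: (ucont_bounded (within_ucont gam_cont)). Qed.

Lemma bounded_inv : bounded_on gam (fun x => x^-1).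
Proof.
have [d d0 hd] := curve_dist gam_cont gam0; exists d^-1; first by rewrite invr_gt0.
move=> t t01; have := hd t t01; rewrite subr0 cabsV => h.
by rewrite lef_pV2// posrE// (lt_le_trans d0).
Qed.

Lemma bounded_lfun h : lfun h -> bounded_on gam h.
Proof.
move=> /lfunE[c [n [k hE]]].
have bX y m : bounded_on gam y -> bounded_on gam (fun x => y x ^+ m).
  move=> yb; elim: m => [|m ih]; first exact: (bounded_cst gam 1).
  have [A A0 hA] := bounded_M yb ih.
  by exists A => // t t01; rewrite exprS hA.
have bXz (m : int) : bounded_on gam (fun x => x ^ m).
  case: m => m; first exact/bX/bounded_id.
  have [A A0 hA] := bX _ m.+1 bounded_inv.
  by exists A => // t t01; rewrite NegzE -exprnN -exprVn hA.
have [A A0 hA] : bounded_on gam (fun x => \sum_(i < n) c i * x ^ (i%:Z - k%:Z)).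
  elim: n {hE} => [|n ih].
    exists 1 => // t _; by rewrite big_ord0 cabs0.
  have [A A0 hA] := bounded_D ih (bounded_M (bounded_cst gam (c n)) (bXz (n%:Z - k%:Z))).
  by exists A => // t t01; rewrite big_ord_recr hA.
by exists A => // t t01; rewrite hE ?gam_neq0// hA.
Qed.

Definition separated_orbits s E := forall e, e \in E ->
  forall j, separated gam s (e * q ^+ j).

Lemma away_inner s E : s != 0 -> separated_orbits s E -> forall e, e \in E -> forall j,
  bounded_away gam (fun x => 1 - e * (s / x) * q ^+ j).
Proof.
move=> s0 sE e eE j; have [e0 ec _ _ _] := sE e eE j.
have [d d0 hd] := curve_dist gam_cont ec; have [B B0 gB] := bounded_id.
exists (d / B); first by rewrite divr_gt0.
move=> t t01; have g0 := gam_neq0 t01.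
have -> : 1 - e * (s / gam t) * q ^+ j = (gam t - e * q ^+ j * s) / gam t by field.
rewrite cabsM cabsV ler_pM ?hd ?invr_ge0 ?(ltW d0) ?(ltW B0)//.
by rewrite lef_pV2 ?gB// posrE// cabs_gt0.
Qed.

Lemma away_outer s E : separated_orbits s E -> forall e, e \in E -> forall j,
  bounded_away gam (fun x => 1 - e * x * q ^+ j).
Proof.
move=> sE e eE j; have [e0 _ ec _ _] := sE e eE j.
have [d d0 hd] := curve_dist gam_cont ec.
exists (cabs (e * q ^+ j) * d); first by rewrite mulr_gt0 ?cabs_gt0.
move=> t t01.
have -> : 1 - e * gam t * q ^+ j = - ((e * q ^+ j) * (gam t - (e * q ^+ j)^-1)).
  by rewrite mulrBr mulfV//; ring.
by rewrite cabsN [leRHS]cabsM ler_wpM2l ?cabs_ge0// hd.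
Qed.

Definition qprodV E (y : C) := \prod_(e <- E) (qpoch q (e * y))^-1.

Lemma bounded_mulV s : bounded_on gam (fun x => s / x).
Proof. by apply: bounded_M; [exact: bounded_cst|exact: bounded_inv]. Qed.

Lemma mem_qseqE s E n e : separated_orbits s E -> e \in qseq q E n -> separated gam s e.
Proof. by move=> sE /mem_qseq[f fE [j ->]]; exact: sE. Qed.

Lemma unif_integral (F : nat -> C -> C) (f : C -> C) (I : nat -> C) :
  unifb gam F f -> (forall n, cint (fun x => F n x / x) (I n)) ->
  exists2 J, cint (fun x => f x / x) J & ccvg I J.
Proof.
move=> uF FI; apply: (is_contour_integral_unif gam_rect _ FI).
by case: (unifbM uF (unifb_cst bounded_inv)).
Qed.

Lemma same_limit s E1 E2 (N : nat -> C -> C) (Noo : C -> C) : s != 0 ->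
  separated_orbits s E1 -> separated_orbits s E2 -> (forall n, lfun (N n)) ->
  unifb gam N Noo -> unifb gam (fun n x => N n (s / x)) (fun x => Noo (s / x)) ->
  same_integral gam (fun x => Noo x * (qprodV E1 (s / x) * qprodV E2 x))
           (fun x => Noo (s / x) * (qprodV E1 x * qprodV E2 (s / x))).
Proof.
move=> s0 s1 s2 Nl uN uN'.
pose F n x := N n x * (rprod (qseq q E1 n) (s / x) * rprod (qseq q E2 n) x).
pose G n x := N n (s / x) * (rprod (qseq q E1 n) x * rprod (qseq q E2 n) (s / x)).
have u1 := unifbM uN (unifbM
  (rprod_unif q_lt1 (bounded_mulV s) (away_inner s0 s1))
  (rprod_unif q_lt1 bounded_id (away_outer s2))).
have u2 := unifbM uN' (unifbM
  (rprod_unif q_lt1 bounded_id (away_outer s1))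
  (rprod_unif q_lt1 (bounded_mulV s) (away_inner s0 s2))).
have FG n : same_integral gam (F n) (G n).
  by apply: same_lfun => // e; exact: mem_qseqE.
have {FG}/choice[I FG] : forall n, exists I,
    cint (fun x => F n x / x) I /\ cint (fun x => G n x / x) I.
  by move=> n; have [I FI GI] := FG n; exists I.
have [J JF IJ] := unif_integral u1 (fun n => (FG n).1).
have [J' JG IJ'] := unif_integral u2 (fun n => (FG n).2).
have JJ' := ccvg_unique IJ IJ'; rewrite -JJ' in JG.
by exists J; [exact: JF|exact: JG].
Qed.

Lemma lfun_pochN n y : lfun y -> lfun (fun x => pochN q n (y x)).
Proof.
move=> yl; apply: lfun_prod => j; apply: lfunB; first exact: lfun_cst.
by apply: lfunM => //; exact: lfun_cst.
Qed.

(** The numerator is [(x^2/s, q s/x^2; q)_oo] with its first factor split off. *)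
Definition sym_weight s E x := (1 - x ^+ 2 / s) *
  (qpoch q (q * (x ^+ 2 / s)) * qpoch q (q * (s / x ^+ 2))) *
  (qprodV E (s / x) * qprodV E x).

(* Up to the factor [1 - x^2/s], the weight [sym_weight s E] is invariant under
   [x |-> s/x]. *)
Lemma integral_reflect s E h : s != 0 -> separated_orbits s E -> lfun h ->
  exists2 I, cint (fun x => h (s / x) * sym_weight s E x / x) I &
             cint (fun x => (s / x ^+ 2 * h x) * sym_weight s E x / x) (- I).
Proof.
move=> s0 sE hl.
have l1 : lfun (fun x => q * (x ^+ 2 / s)).
  by apply/lfunZ/lfunM; [exact: lfunX (lfun_id _)|exact: lfun_cst].
have l2 : lfun (fun x => q * (s / x ^+ 2)).
  by apply: lfun_ext (lfun_comp s0 l1) => x x0; field; rewrite x0 s0.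
have l3 : lfun (fun x => 1 - x ^+ 2 / s).
  apply: lfunB; first exact: lfun_cst.
  by apply: lfunM; [exact: lfunX (lfun_id _)|exact: lfun_cst].
have hl' := lfun_comp s0 hl.
pose N n x := h (s / x) * ((1 - x ^+ 2 / s) *
  (pochN q n (q * (x ^+ 2 / s)) * pochN q n (q * (s / x ^+ 2)))).
pose Noo x := h (s / x) * ((1 - x ^+ 2 / s) *
  (qpoch q (q * (x ^+ 2 / s)) * qpoch q (q * (s / x ^+ 2)))).
(* The sign comes from [1 - s/x^2 = - (s/x^2) (1 - x^2/s)]. *)
have NE n x : x != 0 -> N n (s / x) = - (s / x ^+ 2 * h x) * ((1 - x ^+ 2 / s) *
  (pochN q n (q * (x ^+ 2 / s)) * pochN q n (q * (s / x ^+ 2)))).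
  move=> x0; rewrite /N; have -> : s / (s / x) = x by field; rewrite s0 x0.
  have -> : s / (s / x) ^+ 2 = x ^+ 2 / s by field; rewrite s0 x0.
  have -> : (s / x) ^+ 2 / s = s / x ^+ 2 by field; rewrite s0 x0.
  set A := pochN q n _; set B := pochN q n _.
  by field; rewrite s0 x0.
have NooE x : x != 0 -> Noo (s / x) = - (s / x ^+ 2 * h x) * ((1 - x ^+ 2 / s) *
  (qpoch q (q * (x ^+ 2 / s)) * qpoch q (q * (s / x ^+ 2)))).
  move=> x0; rewrite /Noo; have -> : s / (s / x) = x by field; rewrite s0 x0.
  have -> : s / (s / x) ^+ 2 = x ^+ 2 / s by field; rewrite s0 x0.
  have -> : (s / x) ^+ 2 / s = s / x ^+ 2 by field; rewrite s0 x0.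
  set A := qpoch q _; set B := qpoch q _.
  by field; rewrite s0 x0.
have lN n : lfun (N n).
  by do 3 (apply: lfunM => //); exact: lfun_pochN.
have u1 := unifbM (unifb_cst (bounded_lfun l3)) (unifbM
  (pochN_unif q_lt1 (bounded_lfun l1)) (pochN_unif q_lt1 (bounded_lfun l2))).
have lh : lfun (fun x => - (s / x ^+ 2 * h x)).
  apply/lfunN/lfunM => //; apply/lfunZ.
  by apply: lfun_ext (lfunX 2 (lfunV _)) => x _; rewrite exprVn.
have uN : unifb gam N Noo := unifbM (unifb_cst (bounded_lfun hl')) u1.
have uN' : unifb gam (fun n x => N n (s / x)) (fun x => Noo (s / x)).
  apply: unifb_ext (unifbM (unifb_cst (bounded_lfun lh)) u1) => [n t t01|t t01].
    by rewrite NE// gam_neq0.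
  by rewrite NooE// gam_neq0.
have [I FI GI] := same_limit s0 sE sE lN uN uN'.
exists I.
  apply: is_contour_integral_ext FI => t t01; rewrite /Noo /sym_weight; ring.
rewrite -mulN1r.
apply: is_contour_integral_ext (is_contour_integralZ _ GI) => t t01.
rewrite NooE ?gam_neq0// /sym_weight; ring.
Qed.

End SeparatedPoles.

(** * The finite Jacobi triple product and its limit *)

Section ConstantTerm.
Variables (K : fieldType) (q : K).

Definition qpoch_poly M : {poly K} := \prod_(i < M) (1 - q ^+ i *: 'X).

(** This is the ratio of consecutive coefficients in the q-binomial theorem, cleared of
    denominators. It follows by induction on [M] from the Pascal-type recurrence [recE]. *)
Lemma coef_qpoch_poly M k :
  (qpoch_poly M)`_k.+1 * (1 - q ^+ k.+1) = (qpoch_poly M)`_k * (q ^+ M - q ^+ k).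
Proof.
have recE m j : (qpoch_poly m.+1)`_j =
    (qpoch_poly m)`_j - q ^+ m * (if j is i.+1 then (qpoch_poly m)`_i else 0).
  rewrite /qpoch_poly big_ord_recr /= mulrBr mulr1 -scalerAr coefB coefZ coefMX.
  by case: j.
elim: M k => [|M ih] k.
  rewrite /qpoch_poly big_ord0 !coef1 /= mul0r; case: k => [|k]; last by rewrite mul0r.
  by rewrite subrr mulr0.
rewrite !recE; case: k => [|k].
  have := ih 0%N; rewrite expr0 => h; rewrite mulr0 subr0 mulrBl h !exprS; ring.
have h1 := ih k.+1; have h2 := ih k.
rewrite mulrBl h1 (exprS q M) (exprS q k.+1).
have -> : ((qpoch_poly M)`_k.+1 - q ^+ M * (qpoch_poly M)`_k) * (q * q ^+ M - q ^+ k.+1) =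
  (qpoch_poly M)`_k.+1 * (q * q ^+ M - q ^+ k.+1)
  - q ^+ M.+1 * ((qpoch_poly M)`_k * (q ^+ M - q ^+ k)).
  rewrite !exprS; ring.
by rewrite -h2 !exprS; ring.
Qed.

Lemma coef_qpoch_poly_prod M k :
  (qpoch_poly M)`_k * \prod_(j < k) (1 - q ^+ j.+1) = \prod_(j < k) (q ^+ M - q ^+ j).
Proof.
elim: k => [|k ih].
  rewrite !big_ord0 mulr1 /qpoch_poly.
  elim: M => [|M ih]; first by rewrite big_ord0 coef1.
  by rewrite big_ord_recr /= mulrBr mulr1 -scalerAr coefB coefZ coefMX mulr0 subr0 ih.
by rewrite !big_ord_recr /= -ih mulrCA coef_qpoch_poly; ring.
Qed.

End ConstantTerm.

Section Nonvanishing.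
Variables (R : realType) (gam : R -> Cx R) (q : Cx R).
Local Notation C := (Cx R).
Hypothesis q_neq0 : q != 0.
Hypothesis q_lt1 : cabs q < 1.
Hypothesis gam_rect : rectifiable gam.
Hypothesis gam_closed : gam 0 = gam 1.
Hypothesis gam_cont : {within `[0, 1], continuous gam}.
Hypothesis gam0 : ~ curve gam 0.
Local Notation cint := (is_contour_integral gam).
Local Notation tpi := (two_pi_i R).
Hypothesis wind0 : cint (fun x => (x - 0)^-1) tpi.

Lemma expq_neq1 n : 1 - q ^+ n.+1 != 0.
Proof.
apply/eqP => /eqP; rewrite subr_eq0 => /eqP /(congr1 (@cabs R)).
rewrite cabs1 cabsX => /esym/eqP; rewrite pexpr_eq1 ?cabs_ge0//.
by move=> /eqP q1; move: q_lt1; rewrite q1 ltxx.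
Qed.

Lemma pochN_q n : pochN q n q = \prod_(j < n) (1 - q ^+ j.+1).
Proof. by apply: eq_bigr => j _; rewrite exprS. Qed.

Lemma pochN_q_neq0 n : pochN q n q != 0.
Proof. by rewrite pochN_q; apply/prodf_neq0 => j _; exact: expq_neq1. Qed.

(* The central coefficient of the finite Jacobi triple product. *)
Definition theta_ct N : C := pochN q (N + N) q / pochN q N q ^+ 2.

(** The right-hand side is what integrating the expansion produces; the quotient defining [theta_ct]
    is what the limit argument needs. *)
Lemma theta_ctE N : theta_ct N =
  (\prod_(j < N) - q ^+ j.+1) * ((qpoch_poly q (N + N))`_N * (q ^+ N)^-1 ^+ N).
Proof.
have qN n : q ^+ n != 0 by rewrite expf_neq0.
have pq := pochN_q_neq0 N.
have := coef_qpoch_poly_prod q (N + N) N; rewrite -pochN_q => /(canRL (mulfK pq)) ->.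
rewrite /theta_ct.
have -> : \prod_(j < N) (q ^+ (N + N) - q ^+ j) =
    (\prod_(j < N) - q ^+ j) * \prod_(j < N) (1 - q ^+ (N + N - j)).
  rewrite -big_split; apply: eq_bigr => j _ /=.
  have -> : (N + N = j + (N + N - j))%N by have := ltn_ord j; lia.
  by rewrite exprD addKn; ring.
have -> : pochN q (N + N) q = pochN q N q * \prod_(j < N) (1 - q ^+ (N + N - j)).
  rewrite !pochN_q big_split_ord /=; congr (_ * _).
  rewrite [RHS](reindex_inj rev_ord_inj) /=; apply: eq_bigr => j _.
  by congr (1 - q ^+ _); have := ltn_ord j; lia.
(* The exponents [2j + 1] add up to [N^2], which cancels the power of [q] brought in by the
   substitution [w = x^2 / q^N] of [theta_expand]. *)
have DE : (\prod_(j < N) - q ^+ j.+1) * (\prod_(j < N) - q ^+ j) = (q ^+ N) ^+ N.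
  rewrite -exprM -big_split /=; elim: N {pq} => [|N ih]; first by rewrite big_ord0.
  rewrite big_ord_recr /= ih mulrNN -!exprD; congr (q ^+ _); lia.
have : (q ^+ N) ^+ N != 0 by rewrite expf_neq0.
rewrite exprVn -DE mulf_eq0 negb_or => /andP[D0 E0].
by field; rewrite pq D0 E0.
Qed.

Lemma theta_expand N n x : x != 0 -> (size (qpoch_poly q (N + N)) <= n)%N ->
  pochN q N (x ^+ 2) * pochN q N (q * (1 / x ^+ 2)) =
  \sum_(k < n) ((\prod_(j < N) - q ^+ j.+1) *
    ((qpoch_poly q (N + N))`_k * (q ^+ N)^-1 ^+ k))
     * x ^ ((k + k)%N%:Z - (N + N)%N%:Z).
Proof.
move=> x0 sn.
have qN m : q ^+ m != 0 by rewrite expf_neq0.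
(* In this variable the two products of [N] factors merge into one of [2N] factors, as
   [1 - q^(j+1)/x^2] is [- q^(j+1)/x^2] times [1 - q^(N-j-1) w]. *)
pose w := x ^+ 2 / q ^+ N.
have -> : pochN q N (x ^+ 2) * pochN q N (q * (1 / x ^+ 2)) =
    (\prod_(j < N) - q ^+ j.+1) * x ^- (N + N) * (qpoch_poly q (N + N)).[w].
  have -> : (qpoch_poly q (N + N)).[w] = \prod_(j < N + N) (1 - q ^+ j * w).
    rewrite horner_prod; apply: eq_bigr => j _.
    by rewrite hornerD hornerN hornerZ hornerX hornerC.
  rewrite big_split_ord /= mulrA [LHS]mulrC; congr (_ * _); last first.
    apply: eq_bigr => j _; rewrite /w exprD; field; exact: qN.
  have -> : pochN q N (q * (1 / x ^+ 2)) =
      \prod_(j < N) (- q ^+ j.+1 * x ^- 2 * (1 - q ^+ (N - j.+1) * w)).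
    apply: eq_bigr => j _; rewrite /w.
    have -> : q ^+ N = q ^+ (N - j.+1) * q ^+ j.+1.
      by rewrite -exprD subnK.
    by rewrite (exprS q j); field; rewrite x0 q_neq0 !qN.
  rewrite !big_split /=; congr (_ * _ * _).
    by rewrite prodr_const card_ord -exprVn -exprM addnn -mul2n exprVn.
  by rewrite [RHS](reindex_inj rev_ord_inj) /=.
rewrite (horner_coef_wide _ sn) mulr_sumr; apply: eq_bigr => k _.
rewrite expfzDr// -exprnN -exprnP /w exprMn -exprVn -exprM mul2n -addnn.
by ring.
Qed.

Lemma integral_theta N : cint (fun x => pochN q N (x ^+ 2) *
  pochN q N (q * (1 / x ^+ 2)) / x) (theta_ct N * tpi).
Proof.
(* The bound [N.+1] ensures that the central index [N] occurs in the sum. *)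
pose n := maxn (size (qpoch_poly q (N + N))) N.+1.
pose c k := (\prod_(j < N) - q ^+ j.+1) * ((qpoch_poly q (N + N))`_k * (q ^+ N)^-1 ^+ k).
have : cint (fun x => \sum_(k < n) c k * (x ^ ((k + k)%N%:Z - (N + N)%N%:Z) / x))
    (\sum_(k < n) c k * (if (k + k)%N%:Z - (N + N)%N%:Z == 0 then tpi else 0)).
  apply: is_contour_integral_sum => k; apply: is_contour_integralZ.
  exact: contour_integral_laurent.
have -> : \sum_(k < n) c k * (if (k + k)%N%:Z - (N + N)%N%:Z == 0 then tpi else 0) =
    theta_ct N * tpi.
  have Nn : (N < n)%N by rewrite leq_max leqnn orbT.
  rewrite (bigD1 (Ordinal Nn)) //= subrr eqxx big1 ?addr0 => [|k kN].
    by rewrite theta_ctE.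
  rewrite ifN ?mulr0//; apply: contra_neq kN => h; apply/val_inj => /=; lia.
apply: is_contour_integral_ext => t t01.
rewrite (@theta_expand N n) ?(gam_neq0 gam0)// ?leq_maxl// mulr_suml.
by apply: eq_bigr => k _; rewrite mulrA.
Qed.

(** [(q;q)_2N] is [theta_ct N] times the bounded factor [(q;q)_N^2]. If the integrals tended to 0,
    so would [(q;q)_2N], although [(q;q)_oo] is nonzero. *)
Lemma integral_theta_limit : exists2 J, J != 0 & cint (fun x =>
  qpoch q (x ^+ 2) * qpoch q (q * (1 / x ^+ 2)) / x) J.
Proof.
have b1 : bounded_on gam (fun x => x ^+ 2).
  by apply: (bounded_lfun gam_cont gam0); exact: lfunX (lfun_id _).
have b2 : bounded_on gam (fun x => q * (1 / x ^+ 2)).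
  apply: (bounded_lfun gam_cont gam0); do 2 apply: lfunZ.
  by apply: lfun_ext (lfunX 2 (lfunV _)) => x _; rewrite exprVn.
have u := unifbM (pochN_unif q_lt1 b1) (pochN_unif q_lt1 b2).
have [J JI lJ] := unif_integral gam_rect gam_cont gam0 u integral_theta.
exists J => //; apply/eqP => J0; rewrite {}J0 in lJ {JI}.
have bq := bounded_cst gam q.
have [|_ qn] := pochNV_unif q_lt1 bq.
  move=> j; exists (cabs (1 - q * q ^+ j)) => //.
  by rewrite cabs_gt0 -exprS expq_neq1.
(* Convergence is known for functions on the curve; for the constant function [q] it is read at
   parameter 0. *)
have z01 : 0 <= (0 : R) <= 1 by rewrite lexx ler01.
have q0 := qn 0 z01.
have uq := pochN_unif q_lt1 bq; have [_ [B B0 qB]] := uq.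
have lq := unif_ccvg uq z01.
have Q0 : 0 < cabs (qpoch q q) / 2 by rewrite divr_gt0// cabs_gt0.
have [n1 h1] := lq _ Q0.
have T0 : 0 < cabs tpi by rewrite cabs_gt0; exact: two_pi_i_neq0.
have [n2 h2] := lJ _ (divr_gt0 (mulr_gt0 Q0 T0) (mulr_gt0 B0 B0)).
pose n := maxn n1 n2.
have {h1}l1 := h1 (n + n)%N (leq_trans (leq_maxl n1 n2) (leq_addr _ _)).
have {h2}l2 := h2 n (leq_maxr _ _).
rewrite subr0 (cabsM (theta_ct n)) in l2.
have pq := pochN_q_neq0 n.
have e : pochN q (n + n) q = theta_ct n * (pochN q n q * pochN q n q).
  by rewrite /theta_ct expr2 mulfVK// mulf_neq0.
have : cabs (pochN q (n + n) q) < cabs (qpoch q q) / 2.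
  rewrite e [ltLHS]cabsM [X in _ * X]cabsM
    (@le_lt_trans _ _ (cabs (theta_ct n) * (B * B)))//.
    by rewrite ler_wpM2l ?cabs_ge0// ler_pM ?cabs_ge0 ?(qB n 0).
  rewrite -ltr_pdivlMr ?mulr_gt0// -(ltr_pM2r T0) (lt_le_trans l2)//.
  by rewrite mulrAC.
have := cabsD (qpoch q q - pochN q (n + n) q) (pochN q (n + n) q).
rewrite subrK; move: l1; rewrite cabsB; lra.
Qed.

End Nonvanishing.

(** * The Askey-Wilson functional *)

Section AskeyWilsonFunctional.
Variables (R : realType) (gam : R -> Cx R) (q a b c d : Cx R).
Local Notation C := (Cx R).
Implicit Types (f g h : C -> C) (x z : C).
Hypothesis q_neq0 : q != 0.
Hypothesis q_lt1 : cabs q < 1.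
Hypothesis abcd_neq0 : forall e, e \in [:: a; b; c; d] -> e != 0.
Hypothesis gamP : AW_contour q a b c d gam.
Local Notation cint := (is_contour_integral gam).
Local Notation tpi := (two_pi_i R).
Local Notation Delta := (AW_weight q a b c d).

Let gam_jordan : rectifiable_jordan_curve gam. Proof. by case: gamP. Qed.
Let gam0 : ~ curve gam 0. Proof. by case: gamP. Qed.
Let gam_rect : rectifiable gam. Proof. by case: gam_jordan. Qed.
Let gam_closed : gam 0 = gam 1. Proof. by case: gam_jordan. Qed.
Let gam_cont : {within `[0, 1], continuous gam}. Proof. by case: gam_jordan. Qed.
Let gam_neq0 := gam_neq0 gam0.

Let interior z : jordan_interior gam z ->
  ~ curve gam z /\ cint (fun x => (x - z)^-1) tpi.
Proof. by move=> zi; split; [case: zi|case: gamP => _ ccw _ _; exact: ccw]. Qed.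

Let exterior z : jordan_exterior gam z ->
  ~ curve gam z /\ cint (fun x => (x - z)^-1) 0.
Proof. by move=> ze; split; [case: ze|exact: winding_exterior]. Qed.

(** The exponents [k] and [l] are independent because for [s = q] the inner point is shifted by one
    power of [q] and the outer one is not. *)
Let sep_point e k l : e \in [:: a; b; c; d] ->
  [/\ e * q ^+ k != 0, ~ curve gam (e * q ^+ l), ~ curve gam (e * q ^+ k)^-1,
   cint (fun x => (x - e * q ^+ l)^-1) tpi &
   cint (fun x => (x - (e * q ^+ k)^-1)^-1) 0].
Proof.
move=> eE; case: gamP => _ _ _ /(_ e eE) h.
have [/interior[ic iI] _] := h l; have [_ /exterior[ec eI]] := h k.
rewrite invfM; split=> //; by rewrite mulf_neq0 ?expf_neq0// abcd_neq0.
Qed.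

(** The point 0 is the limit of the interior points [a q^k], and the winding number is locally
    constant off the curve. *)
Let wind0 : cint (fun x => (x - 0)^-1) tpi.
Proof.
have [r r0 hr] := curve_dist gam_cont gam0.
have aE : a \in [:: a; b; c; d] by rewrite inE eqxx.
have a0 : 0 < cabs a by rewrite cabs_gt0 abcd_neq0.
have r40 : 0 < r / 4 by rewrite divr_gt0.
have [k hk] := expr_small (cabs_ge0 q) q_lt1 (divr_gt0 r40 a0).
have [_ _ _ kI _] := sep_point k k aE.
have {}hk : cabs (a * q ^+ k) < r / 4.
  by rewrite cabsM cabsX mulrC -ltr_pdivlMr// hk.
rewrite -(subrr (a * q ^+ k)).
apply: (@winding_near _ _ gam_rect gam_closed gam_cont (r * (3 / 4))) kI.
- by rewrite mulr_gt0// divr_gt0.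
- move=> t t01; have := hr t t01; rewrite subr0.
  have := cabsD (gam t - a * q ^+ k) (a * q ^+ k); rewrite subrK; lra.
- by rewrite cabsN; lra.
Qed.

(** In the denominator of the weight, [E4] goes with [x] and [E1] with [1/x]. *)
Let E4 := [:: a; b; c; d].
Let E1 := [:: q * a; q * b; c; d].

Let sep_q : separated_orbits gam q q E4.
Proof.
move=> e eE j; have [h1 _ h3 _ h5] := sep_point j 0 eE.
have [_ h2 _ h4 _] := sep_point 0 j.+1 eE.
by split=> //; rewrite -mulrA -exprSr.
Qed.

Let sep_E4 : separated_orbits gam q 1 E4.
Proof. by move=> e eE j; rewrite /separated mulr1; exact: sep_point. Qed.

Let sep_E1 : separated_orbits gam q 1 E1.
Proof.
have shift e j : e \in E4 -> separated gam 1 (q * e * q ^+ j).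
  by move=> eE; rewrite [q * e]mulrC -mulrA -exprS; exact: sep_E4.
have keep e j : e \in E4 -> separated gam 1 (e * q ^+ j) by move=> eE; exact: sep_E4.
move=> e; rewrite !inE => /or4P[] /eqP -> j;
  [apply: shift|apply: shift|apply: keep|apply: keep]; by rewrite !inE eqxx ?orbT.
Qed.

Lemma qpochS z : qpoch q z = (1 - z) * qpoch q (q * z).
Proof.
have z01 : 0 <= (0 : R) <= 1 by rewrite lexx ler01.
have l1 := unif_ccvg (unifb_shift (pochN_unif q_lt1 (bounded_cst gam z))) z01.
have l2 := unif_ccvg (unifbM (unifb_cst (bounded_cst gam (1 - z)))
  (pochN_unif q_lt1 (bounded_cst gam (q * z)))) z01.
apply: (ccvg_unique l1); rewrite /= in l2 *.
rewrite (_ : (fun n => pochN q n.+1 z) = (fun n => (1 - z) * pochN q n (q * z)))//.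
apply/funext => n; rewrite /pochN big_ord_recl expr0 mulr1; congr (_ * _).
by apply: eq_bigr => j _; rewrite /= /bump leq0n exprS; congr (1 - _); ring.
Qed.

Lemma weightE x : Delta x = (qpoch q (x ^+ 2) * qpoch q (q * (1 / x ^+ 2))) *
  (qprodV q E1 (1 / x) * qprodV q E4 x).
Proof.
rewrite /AW_weight /qpochs /qprodV !big_cons !big_nil !mulr1 !div1r !invfM; ring.
Qed.

(** The two factors turn [a x, b x] into [q a x, q b x] in the denominator, so that [E1] occurs both
    at [x] and at [1/x]. *)
Lemma weight_sym1 (t : R) : 0 <= t <= 1 ->
  (1 - a * gam t) * (1 - b * gam t) * Delta (gam t) = sym_weight q 1 E1 (gam t).
Proof.
move=> t01; have aE : a \in E4 by rewrite !inE eqxx.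
have bE : b \in E4 by rewrite !inE eqxx ?orbT.
have := sep_E4 aE 0; rewrite expr0 mulr1 => /(sep_outer)/(_ t01) a1.
have := sep_E4 bE 0; rewrite expr0 mulr1 => /(sep_outer)/(_ t01) b1.
rewrite weightE /sym_weight /qprodV !big_cons !big_nil divr1.
rewrite (qpochS (gam t ^+ 2)) (qpochS (a * gam t)) (qpochS (b * gam t)).
rewrite !(invfM (1 - _)).
rewrite !(mulrA q); move: (qpoch q) => Q.
have P1 := mulfV a1; have P2 := mulfV b1.
move: (1 - a * gam t) (1 - b * gam t) a1 b1 P1 P2 => A B a1 b1 P1 P2.
(* With the inverted products as atoms, [field] asks only for [A] and [B] to be nonzero. *)
move: (Q (q * a * gam t))^-1 (Q (q * b * gam t))^-1 => I1 I2.
move: (Q (c * gam t))^-1 (Q (d * gam t))^-1 => I3 I4.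
move: (Q (q * a * (1 / gam t)))^-1 (Q (q * b * (1 / gam t)))^-1 => I5 I6.
move: (Q (c * (1 / gam t)))^-1 (Q (d * (1 / gam t)))^-1 => I7 I8.
move: (Q (q * gam t ^+ 2)) (Q (q * (1 / gam t ^+ 2))) => J1 J2.
by field; rewrite a1 b1.
Qed.

(** Since [q c/x = c (q/x)], the two factors make [E4] occur both at [x] and at [q/x]. The prefactor
    comes from [1 - q/x^2 = - (q/x^2) (1 - x^2/q)]. *)
Lemma weight_sym0 (t : R) : 0 <= t <= 1 ->
  (1 - c / gam t) * (1 - d / gam t) * Delta (gam t) =
  - (q / gam t ^+ 2) * sym_weight q q E4 (gam t).
Proof.
move=> t01; have cE : c \in E4 by rewrite !inE eqxx ?orbT.
have dE : d \in E4 by rewrite !inE eqxx ?orbT.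
have g0 := gam_neq0 t01.
have := sep_E4 cE 0; rewrite expr0 mulr1 => /(sep_inner gam0)/(_ t01).
rewrite div1r => c1.
have := sep_E4 dE 0; rewrite expr0 mulr1 => /(sep_inner gam0)/(_ t01).
rewrite div1r => d1.
rewrite weightE /sym_weight /qprodV !big_cons !big_nil !div1r.
have -> : q * (gam t ^+ 2 / q) = gam t ^+ 2 by field.
have qE e : q * e / gam t = e * (q / gam t) by ring.
rewrite (qpochS (q / gam t ^+ 2)) (qpochS (c / gam t)) (qpochS (d / gam t)).
rewrite !(invfM (1 - _)).
rewrite !(mulrA q) !qE.
have -> : 1 - q / gam t ^+ 2 = - (q / gam t ^+ 2) * (1 - gam t ^+ 2 / q).
  by field; rewrite q_neq0 g0.
move: (qpoch q) => Q.
have P1 := mulfV c1; have P2 := mulfV d1.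
move: (1 - c / gam t) (1 - d / gam t) c1 d1 P1 P2 => A B a1 b1 P1 P2.
move: (Q (a * gam t))^-1 (Q (b * gam t))^-1 => I1 I2.
move: (Q (c * gam t))^-1 (Q (d * gam t))^-1 => I3 I4.
move: (Q (a * (q / gam t)))^-1 (Q (b * (q / gam t)))^-1 => I5 I6.
move: (Q (c * (q / gam t)))^-1 (Q (d * (q / gam t)))^-1 => I7 I8.
move: (q / gam t ^+ 2) (1 - gam t ^+ 2 / q) => g1 g2.
move: (Q (gam t ^+ 2)) (Q _) => J1 J2.
by field; rewrite a1 b1.
Qed.

Definition AWL h : C := contour_integral gam (fun x => h x * Delta x / x).

Lemma lfun_sqr : lfun (fun x : C => x ^+ 2).
Proof. exact: lfunX (lfun_id _). Qed.

Lemma lfun_sqrV : lfun (fun x : C => 1 / x ^+ 2).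
Proof.
by apply: lfun_ext (lfunX 2 (lfunV _)) => x _; rewrite exprVn div1r.
Qed.

(** Existence of the integral is read off one half of [same_limit] for [s = 1]; on Laurent
    polynomials [AWL] is thus never a default value. *)
Lemma AWLP h : lfun h -> cint (fun x => h x * Delta x / x) (AWL h).
Proof.
move=> hl.
have b1 := bounded_lfun gam_cont gam0 lfun_sqr.
have b2 : bounded_on gam (fun x => q * (1 / x ^+ 2)).
  by apply: bounded_M; [exact: bounded_cst|exact: bounded_lfun lfun_sqrV].
have b3 : bounded_on gam (fun x => (1 / x) ^+ 2).
  apply: (bounded_lfun gam_cont gam0); apply: lfunX.
  by apply: lfun_ext (lfunV _) => x _; rewrite div1r.
have b4 : bounded_on gam (fun x => q * (1 / (1 / x) ^+ 2)).
  apply: (bounded_lfun gam_cont gam0); apply: lfunZ.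
  by apply: lfun_ext lfun_sqr => x x0; field.
have u1 := unifbM (unifb_cst (bounded_lfun gam_cont gam0 hl))
  (unifbM (pochN_unif q_lt1 b1) (pochN_unif q_lt1 b2)).
have hl' := lfun_comp (oner_neq0 C) hl.
have u2 := unifbM (unifb_cst (bounded_lfun gam_cont gam0 hl'))
  (unifbM (pochN_unif q_lt1 b3) (pochN_unif q_lt1 b4)).
have lN n : lfun (fun x => h x * (pochN q n (x ^+ 2) * pochN q n (q * (1 / x ^+ 2)))).
  apply: lfunM => //; apply: lfunM; apply: lfun_pochN; first exact: lfun_sqr.
  exact: lfunZ lfun_sqrV.
have [I FI _] := same_limit q_lt1 gam_rect gam_closed gam_cont gam0 wind0
  (oner_neq0 C) sep_E1 sep_E4 lN u1 u2.
have {}FI : cint (fun x => h x * Delta x / x) I.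
  by apply: is_contour_integral_ext FI => t t01; rewrite weightE; ring.
by rewrite /AWL (contour_integral_eq FI).
Qed.

Lemma AWL_eq f I : cint (fun x => f x * Delta x / x) I -> AWL f = I.
Proof. exact: contour_integral_eq. Qed.

Lemma AWL_ext f g : lfun f -> (forall x, x != 0 -> f x = g x) -> AWL f = AWL g.
Proof.
move=> fl fg; apply/esym/AWL_eq; apply: is_contour_integral_ext (AWLP fl) => t t01.
by rewrite fg// gam_neq0.
Qed.

Lemma AWL_lin (z : C) f g : lfun f -> lfun g ->
  AWL (fun x => z * f x + g x) = z * AWL f + AWL g.
Proof.
move=> fl gl; apply: AWL_eq.
apply: is_contour_integral_ext (is_contour_integral_lin z (AWLP fl) (AWLP gl)) => t _.
by ring.
Qed.

Lemma AWL_reflect1 h : lfun h ->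
  AWL (fun x => (1 - a * x) * (1 - b * x) * h (1 / x)) =
  - AWL (fun x => (1 - a * x) * (1 - b * x) * (1 / x ^+ 2 * h x)).
Proof.
move=> hl.
have [I FI GI] := integral_reflect q_lt1 gam_rect gam_closed gam_cont gam0
  wind0 (oner_neq0 C) sep_E1 hl.
rewrite (@AWL_eq _ I); last first.
  apply: is_contour_integral_ext FI => t t01; rewrite -weight_sym1//; ring.
rewrite (@AWL_eq _ (- I)) ?opprK//.
apply: is_contour_integral_ext GI => t t01; rewrite -weight_sym1//; ring.
Qed.

Lemma AWL_reflect0 h : lfun h ->
  AWL (fun x => (1 - c / x) * (1 - d / x) * h (q / x)) =
  - AWL (fun x => (1 - c / x) * (1 - d / x) * (x ^+ 2 / q * h x)).
Proof.
move=> hl.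
(* Chosen so that its reflection [(q/x^2) h (q/x)] carries the prefactor of [weight_sym0], up to
   sign. *)
have hl2 : lfun (fun x => x ^+ 2 / q * h x).
  by apply: lfunM => //; apply: lfunM; [exact: lfun_sqr|exact: lfun_cst].
have [I FI GI] := integral_reflect q_lt1 gam_rect gam_closed gam_cont gam0
  wind0 q_neq0 sep_q hl2.
rewrite (@AWL_eq _ (- I)); last first.
  rewrite -mulN1r; apply: is_contour_integral_ext (is_contour_integralZ _ FI) => t t01.
  have g0 := gam_neq0 t01.
  have -> : (q / gam t) ^+ 2 / q = q / gam t ^+ 2 by field; rewrite q_neq0 g0.
  rewrite [RHS](_ : _ = (1 - c / gam t) * (1 - d / gam t) * Delta (gam t) *
    (h (q / gam t) / gam t)); last by ring.
  by rewrite weight_sym0//; ring.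
rewrite (@AWL_eq _ I) // -[I]opprK -mulN1r.
apply: is_contour_integral_ext (is_contour_integralZ _ GI) => t t01.
have g0 := gam_neq0 t01.
rewrite [RHS](_ : _ = (1 - c / gam t) * (1 - d / gam t) * Delta (gam t) *
  (gam t ^+ 2 / q * h (gam t) / gam t)); last by ring.
by rewrite weight_sym0//; ring.
Qed.

Lemma AWL_neq0 : exists2 h, lfun h & AWL h != 0.
Proof.
apply: contrapT => no.
have L0 h : lfun h -> cint (fun x => h x * Delta x / x) 0.
  move=> hl; have -> : 0 = AWL h; last exact: AWLP.
  by apply/esym/eqP; apply/negPn/negP => h0; apply: no; exists h.
have lV : lfun (fun x : C => 1 / x).
  by apply: lfun_ext (lfunV _) => x _; rewrite div1r.
(* The denominators are cleared progressively: finite products times the infinite inverses tend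
   uniformly to 1. *)
have poch_unif E y : bounded_on gam y ->
    (forall e, e \in E -> forall j, bounded_away gam (fun x => 1 - e * y x * q ^+ j)) ->
    unifb gam (fun n x => (\prod_(e <- E) pochN q n (e * y x)) * qprodV q E (y x))
              (fun=> 1).
  move=> yb; elim: E => [|e E ih] hE.
    apply: unifb_ext (unifb_cst (bounded_cst gam 1)) => // n t _.
    by rewrite /qprodV !big_nil mulr1.
  have eb : bounded_on gam (fun x => e * y x) by apply: bounded_M => //; exact: bounded_cst.
  have [|u1 n1] := pochNV_unif q_lt1 eb; first by apply: hE; rewrite inE eqxx.
  have {}ih : unifb gam
      (fun n x => (\prod_(e <- E) pochN q n (e * y x)) * qprodV q E (y x))
      (fun=> 1) by apply: ih => f fE; apply: hE; rewrite inE fE orbT.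
  have u2 := unifbM (unifbM (pochN_unif q_lt1 eb) (unifb_cst (unif_bounded u1))) ih.
  apply: unifb_ext u2 => [n t t01|t t01].
    by rewrite /qprodV !big_cons; ring.
  by rewrite mulr1 mulfV// n1.
have bV : bounded_on gam (fun x => 1 / x) := bounded_mulV gam_cont gam0 1.
have bI := bounded_id gam_cont.
have u1 := poch_unif E1 _ bV (away_inner gam_cont gam0 (oner_neq0 C) sep_E1).
have u4 := poch_unif E4 _ bI (away_outer gam_cont sep_E4).
have b2 : bounded_on gam (fun x => q * (1 / x ^+ 2)).
  by apply: bounded_M; [exact: bounded_cst|exact: bounded_lfun lfun_sqrV].
have ut := unif_bounded (unifbM
  (pochN_unif q_lt1 (bounded_lfun gam_cont gam0 lfun_sqr)) (pochN_unif q_lt1 b2)).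
have u := unifbM (unifb_cst ut) (unifbM u1 u4).
have lP (E : seq C) n y : lfun y -> lfun (fun x => \prod_(e <- E) pochN q n (e * y x)).
  by move=> yl; apply: lfun_prod => e; apply: lfun_pochN; exact: lfunZ.
have un n : cint (fun x => qpoch q (x ^+ 2) * qpoch q (q * (1 / x ^+ 2)) *
    (\prod_(e <- E1) pochN q n (e * (1 / x)) * qprodV q E1 (1 / x) *
     (\prod_(e <- E4) pochN q n (e * x) * qprodV q E4 x)) / x) 0.
  have := L0 _ (lfunM (lP E1 n _ lV) (lP E4 n _ (lfun_id _))).
  by apply: is_contour_integral_ext => t t01; rewrite weightE; ring.
have [J JI lJ] := unif_integral gam_rect gam_cont gam0 u un.
have [J' J'0 J'I] := integral_theta_limit q_neq0 q_lt1 gam_rect gam_closed gam_cont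
  gam0 wind0.
have J0 : J = 0.
  by apply/esym; apply: ccvg_unique lJ => e e0; exists 0%N => n _; rewrite subrr cabs0.
move/eqP: J'0; apply; rewrite -J0; apply: is_contour_integral_unique J'I _.
by apply: is_contour_integral_ext JI => t _; rewrite !mulr1.
Qed.

End AskeyWilsonFunctional.

(** * Laurent polynomials *)

Section LaurentPolynomials.
Variable K : fieldType.
Implicit Types (f g p : laurent K) (x : K) (m n i : int) (r : seq int).

Lemma lcoefD f g m : (f + g) m = f m + g m.
Proof. by []. Qed.

Lemma lcoefZ (z : K) f m : (z *: f) m = z * f m.
Proof. by []. Qed.

Lemma lcoef0 m : (0 : laurent K) m = 0.
Proof. by []. Qed.

Lemma lcoef_sum (I : Type) (s : seq I) (F : I -> laurent K) m :
  (\sum_(i <- s) F i) m = \sum_(i <- s) (F i) m.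
Proof. by elim/big_ind2: _ => // f1 c1 f2 c2 <- <-. Qed.

Lemma laurentP f g : (forall m, f m = g m) -> f = g.
Proof. by move=> fg; apply/val_inj/funext. Qed.

Lemma laurent_support f : exists r, uniq r /\ forall m, m \notin r -> f m = 0.
Proof.
have /asboolP/finite_seqP[r rE] := valP f; exists (undup r).
rewrite undup_uniq; split=> // m; rewrite mem_undup; apply: contraNeq => fm.
by have : [set m | f m != 0] m by []; rewrite rE.
Qed.

Lemma fsum_seq (V : nmodType) r (F : int -> V) : uniq r ->
  (forall m, m \notin r -> F m = 0) ->
  \sum_(m \in [set: int]) F m = \sum_(m <- r) F m.
Proof.
move=> ur F0; rewrite (fsbigE r)// => [|m _]; last exact: F0.
by apply: eq_bigl => m; rewrite in_setT.
Qed.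

Lemma levalE f r x : uniq r -> (forall m, m \notin r -> f m = 0) ->
  leval f x = \sum_(m <- r) f m * x ^ m.
Proof. by move=> ur f0; apply: fsum_seq => // m /f0 ->; rewrite mul0r. Qed.

Lemma leval_lin (z : K) f g x : leval (z *: f + g) x = z * leval f x + leval g x.
Proof.
have [r [ur fr]] := laurent_support f; have [s [us gs]] := laurent_support g.
pose t := undup (r ++ s); have ut : uniq t := undup_uniq _.
have notin m : m \notin t -> m \notin r /\ m \notin s.
  by rewrite mem_undup mem_cat negb_or => /andP[].
rewrite (levalE _ ut) => [|m /notin[/fr fm /gs gm]]; last first.
  by rewrite lcoefD lcoefZ fm gm mulr0 addr0.
rewrite (@levalE f t)// => [|m /notin[/fr]//].
rewrite (@levalE g t)// => [|m /notin[_ /gs]//].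
rewrite mulr_sumr -big_split /=; apply: eq_bigr => m _.
by rewrite -[LHS]/((z * f m + g m) * x ^ m) mulrDl mulrA.
Qed.

Lemma levalD f g x : leval (f + g) x = leval f x + leval g x.
Proof. by rewrite -[f]scale1r leval_lin mul1r scale1r. Qed.

Lemma leval0 x : leval (0 : laurent K) x = 0.
Proof. by rewrite (@levalE _ [::])// big_nil. Qed.

Lemma levalZ (z : K) f x : leval (z *: f) x = z * leval f x.
Proof. by rewrite -[z *: f]addr0 leval_lin leval0 addr0. Qed.

Lemma leval_sum (I : Type) (s : seq I) (F : I -> laurent K) x :
  leval (\sum_(i <- s) F i) x = \sum_(i <- s) leval (F i) x.
Proof.
elim: s => [|i s ih]; first by rewrite !big_nil leval0.
by rewrite !big_cons levalD ih.
Qed.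

Lemma lmon_subproof n : (fun m => (m == n)%:R : K^o) \in @finite_supp K.
Proof.
apply/asboolP; apply: (@sub_finite_set _ _ [set n]); last exact: finite_set1.
by move=> m /=; case: (eqVneq m n) => // _; rewrite eqxx.
Qed.

Definition lmon n : laurent K := Laurent (lmon_subproof n).

Lemma leval_lmon n x : leval (lmon n) x = x ^ n.
Proof.
rewrite (@levalE _ [:: n])//= => [|m]; first by rewrite big_seq1 /= eqxx mul1r.
by rewrite inE /= => /negPf ->.
Qed.

Lemma lfun_leval f : lfun (leval f).
Proof.
have [r [ur fr]] := laurent_support f.
apply: (@lfun_ext _ (fun x => \sum_(m <- r) f m * x ^ m)).
  by move=> x _; rewrite (levalE _ ur).
by apply: lfun_sum => m; apply: lfunZ; exact: lfunXz.
Qed.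

Lemma lfun_laurent (h : K -> K) : lfun h ->
  exists f, forall x, x != 0 -> leval f x = h x.
Proof.
move=> /lfunE[c [n [k hE]]].
exists (\sum_(i < n) c i *: lmon (i%:Z - k%:Z)) => x x0.
rewrite leval_sum hE//; apply: eq_bigr => i _.
by rewrite levalZ leval_lmon.
Qed.

(** Multiplying by [x^N], with [N] the largest [|m|] in the support, makes the exponents nonnegative
    and keeps them distinct, so that no coefficients merge. *)
Lemma leval_poly f : exists n, exists p : {poly K},
  (forall x, x != 0 -> leval f x = p.[x] * x ^ n) /\
  (p = 0 -> f = 0).
Proof.
have [r [ur fr]] := laurent_support f.
pose N := (\max_(m <- r) `|m|)%N.
have mN m : m \in r -> 0 <= m + N%:Z.
  move=> mr; have : (`|m| <= N)%N by exact: leq_bigmax_seq.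
  lia.
pose p : {poly K} := \sum_(m <- r) f m *: 'X^(`|(m + N%:Z)%R|).
exists (- N%:Z), p; split=> [x x0|p0].
  rewrite (levalE _ ur fr) horner_sum mulr_suml !big_seq; apply: eq_bigr => m mr.
  rewrite hornerZ hornerXn -mulrA; congr (_ * _).
  by rewrite exprnP -expfzDr// gez0_abs ?mN//; congr (_ ^ _); ring.
apply: laurentP => m; have [mr|/fr //] := boolP (m \in r).
have := congr1 (fun p : {poly K} => p`_`|(m + N%:Z)%R|) p0.
rewrite /p coef_sum coef0 (bigD1_seq m) //=.
rewrite coefZ coefXn eqxx mulr1 big1_seq ?addr0// => m' /andP[m'm m'r].
rewrite coefZ coefXn; case: eqP => [e|]; last by rewrite mulr0.
have := mN _ mr; have := mN _ m'r => h1 h2; move/eqP: m'm; case; lia.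
Qed.

End LaurentPolynomials.

(** * Divided differences under [x |-> s/x] *)

Section Difference.
Variables (K : fieldType) (s : K).
Hypothesis s0 : s != 0.

(** It suffices to treat monomials: [(s/x)^j - x^j] is divisible by [s/x - x = (s/x) (1 - x^2/s)],
    and [(s/x)^-j - x^-j = - s^-j ((s/x)^j - x^j)]. This is why [T1] and [T0] preserve Laurent
    polynomials. *)
Lemma lfun_quotient (h : K -> K) : lfun h -> exists2 D : K -> K, lfun D &
  forall x, x != 0 -> h (s / x) - h x = (1 - x ^+ 2 / s) * D x.
Proof.
move=> /lfunE[c [n [k hE]]].
have lV : lfun (fun x : K => s / x).
  by apply: lfunZ; exact: lfunV.
have pos j : exists2 D : K -> K, lfun D &
    forall x, x != 0 -> (s / x) ^+ j - x ^+ j = (1 - x ^+ 2 / s) * D x.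
  exists (fun x => (s / x) * \sum_(i < j) (s / x) ^+ (j.-1 - i) * x ^+ i).
    apply: lfunM => //; apply: lfun_sum => i.
    by apply: lfunM; apply: lfunX => //; exact: lfun_id.
  move=> x x0; rewrite subrXX mulrA; congr (_ * _).
    by field; rewrite s0 x0.
have mon (m : int) : exists2 D : K -> K, lfun D &
    forall x, x != 0 -> (s / x) ^ m - x ^ m = (1 - x ^+ 2 / s) * D x.
  case: m => j; first exact: pos.
  have [D Dl DE] := pos j.+1; exists (fun x => - s ^- j.+1 * D x); first exact: lfunZ.
  move=> x x0; rewrite mulrCA -DE// NegzE -!exprnN -!exprVn invf_div.
  rewrite !exprMn !exprVn; field.
  by rewrite !expf_neq0.
have /choice[D DP] : forall i : 'I_n, exists D, lfun D /\ forall x, x != 0 ->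
    (s / x) ^ (i%:Z - k%:Z) - x ^ (i%:Z - k%:Z) = (1 - x ^+ 2 / s) * D x.
  by move=> i; have [D Dl DE] := mon (i%:Z - k%:Z); exists D.
exists (fun x => \sum_(i < n) c i * D i x).
  by apply: lfun_sum => i; apply: lfunZ; have [] := DP i.
move=> x x0; rewrite !hE ?mulf_neq0 ?invr_eq0// -sumrB mulr_sumr.
by apply: eq_bigr => i _; rewrite -mulrBr (DP i).2// mulrCA.
Qed.

End Difference.

(** * Laurent polynomials are determined by their values *)

Section Density.
Variable R : realType.
Local Notation C := (Cx R).
Implicit Types (f g w : C -> C) (p : {poly C}).

(** In characteristic 0 the points [1, ..., size p] are nonzero and distinct: too many roots. *)
Lemma poly_eq0 p : (forall x, x != 0 -> p.[x] = 0) -> p = 0.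
Proof.
move=> p0; apply/eqP/negPn/negP => pn0.
pose rs : seq C := [seq i.+1%:R | i <- iota 0 (size p)].
have := @max_poly_roots _ p rs pn0; rewrite size_map size_iota ltnn => H.
suff: false by []; apply: H; last first.
  rewrite map_inj_uniq ?iota_uniq// => i j /eqP; rewrite eqr_nat eqSS.
  by move/eqP.
by apply/allP => _ /mapP[i _ ->]; rewrite rootE p0// pnatr_eq0.
Qed.

Lemma lfun_mul_eq0 w f : lfun w -> lfun f -> (exists2 x, x != 0 & w x != 0) ->
  (forall x, x != 0 -> w x * f x = 0) -> forall x, x != 0 -> f x = 0.
Proof.
move=> [p [k wE]] [r [l fE]] [x0 x00 wx0] wf0.
have : p * r = 0.
  apply: poly_eq0 => x xn0; have := wf0 x xn0; rewrite wE// fE// hornerM.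
  move/eqP; rewrite !mulf_eq0 !invr_eq0 !expf_eq0 !(negPf xn0) !andbF !orbF.
  by move=> /orP[] /eqP->; rewrite ?mul0r ?mulr0.
move/eqP; rewrite mulf_eq0 => /orP[] /eqP e.
  by move: wx0; rewrite wE// e horner0 mul0r eqxx.
by move=> x xn0; rewrite fE// e horner0 mul0r.
Qed.

Lemma leval_inj (f g : laurent C) :
  (forall x, x != 0 -> leval f x = leval g x) -> f = g.
Proof.
move=> fg; apply/eqP; rewrite -subr_eq0; apply/eqP.
have [n [p [pE p0]]] := leval_poly (f - g); apply: p0; apply: poly_eq0 => x x0.
have : leval (f - g) x = 0 by rewrite levalD -scaleN1r levalZ fg// mulN1r subrr.
rewrite pE// => /eqP; rewrite mulf_eq0 => /orP[/eqP //|].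
by rewrite expfz_eq0 (negPf x0) andbF.
Qed.

End Density.

(** * Difference-reflection operators *)

Section Operators.
Variable R : realType.
Local Notation C := (Cx R).
Implicit Types (q qh k u z x : C) (f g : laurent C) (h w : C -> C).

Lemma natr2_neq0 : (2 : C) != 0. Proof. by rewrite pnatr_eq0. Qed.

Lemma exists_sqr_neq q : exists2 x, x != 0 & x ^+ 2 != q.
Proof.
have [->|q1] := eqVneq q 1; last first.
  by exists 1; rewrite ?oner_neq0// expr1n eq_sym.
by exists 2; rewrite ?natr2_neq0// -natrX pnatr_eq1.
Qed.

Lemma divKr_neq0 (s x : C) : s != 0 -> x != 0 -> s / (s / x) = x.
Proof. by move=> s0 x0; field; rewrite s0 x0. Qed.

Lemma lfun_1B_sqr : lfun (fun x : C => 1 - x ^+ 2).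
Proof. by apply: lfunB; [exact: lfun_cst|exact: lfunX (lfun_id _)]. Qed.

Lemma lfun_1B_sqrV q : lfun (fun x : C => 1 - q / x ^+ 2).
Proof.
apply: lfunB; first exact: lfun_cst.
by apply: lfunZ; apply: lfun_ext (lfunX 2 (lfunV _)) => x _; rewrite exprVn.
Qed.

Lemma neq0_1B_sqr : exists2 x : C, x != 0 & 1 - x ^+ 2 != 0.
Proof.
by have [x x0 x2] := exists_sqr_neq 1; exists x; rewrite // subr_eq0 eq_sym.
Qed.

Lemma neq0_1B_sqrV q : exists2 x : C, x != 0 & 1 - q / x ^+ 2 != 0.
Proof.
have [x x0 x2] := exists_sqr_neq q; exists x; rewrite // subr_eq0.
by apply: contra_neq x2 => e; rewrite -[LHS]mul1r e divfK// expf_neq0.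
Qed.

(* [T1] and [T0] prescribe values only off the zeros of [w]; by density these
   determine the chosen Laurent polynomial. *)
Lemma operatorP (Phi w h : C -> C) : lfun w -> lfun h ->
  (exists2 x, x != 0 & w x != 0) ->
  (forall x, x != 0 -> w x != 0 -> Phi x = h x) ->
  forall x, x != 0 -> leval (xget 0 [set g : laurent C | forall x, x != 0 ->
    w x != 0 -> leval g x = Phi x]) x = h x.
Proof.
move=> wl hl w0 PE; set S := [set g : laurent C | _].
have [g gE] := lfun_laurent hl.
have : S (xget 0 S).
  by apply: (@xgetPex _ 0 S); exists g => x x0 wx; rewrite PE// gE.
set T := xget 0 S => ST x x0; apply/eqP; rewrite -subr_eq0; apply/eqP.
apply: (lfun_mul_eq0 wl (lfunB (lfun_leval T) hl) w0) x x0 => x x0.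
have [->|wx] := eqVneq (w x) 0; first by rewrite mul0r.
by rewrite (ST x x0 wx) PE// subrr mulr0.
Qed.

(** With the quotient replaced by the divided difference [D], the formula for [T1] also holds at the
    zeros of [1 - x^2]. *)
Lemma T1P k u f : exists2 D, lfun D & forall x, x != 0 ->
  leval f (1 / x) - leval f x = (1 - x ^+ 2) * D x /\
  leval (T1 k u f) x =
    k * leval f x + k^-1 * ((1 - k * u * x) * (1 + k * u^-1 * x)) * D x.
Proof.
have [D Dl DE] := lfun_quotient (oner_neq0 C) (lfun_leval f).
exists D => // x x0; split; first by rewrite DE// divr1.
move: x x0; apply: (operatorP (w := fun x => 1 - x ^+ 2) lfun_1B_sqr _ neq0_1B_sqr).
  apply: lfunD; first exact: lfunZ (lfun_leval f).
  apply: lfunM => //; apply: lfunZ; apply: lfunM.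
    by apply: lfunB; [exact: lfun_cst|exact: lfunZ (lfun_id _)].
  by apply: lfunD; [exact: lfun_cst|exact: lfunZ (lfun_id _)].
move=> x x0 wx; have := DE x x0; rewrite divr1 div1r => ->.
move: wx; set A := (X in k^-1 * (X / _)); move: (1 - x ^+ 2) => W W0.
suff -> : k^-1 * (A / W) * (W * D x) = k^-1 * A * D x by [].
by rewrite -!mulrA mulKf.
Qed.

Lemma T0P q qh k u f : q != 0 -> exists2 D, lfun D & forall x, x != 0 ->
  leval f (q / x) - leval f x = (1 - q / x ^+ 2) * D x /\
  leval (T0 q qh k u f) x =
    k * leval f x + k^-1 * ((1 - qh * k * u / x) * (1 + qh * k * u^-1 / x)) * D x.
Proof.
move=> q0; have [D Dl DE] := lfun_quotient q0 (lfun_leval f).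
(* [lfun_quotient] yields the factor [1 - x^2/q]; the denominator of [T0] is [- q/x^2] times it. *)
have DE' x : x != 0 -> leval f (q / x) - leval f x =
    (1 - q / x ^+ 2) * (- (x ^+ 2 / q) * D x).
  by move=> x0; rewrite DE//; field; rewrite x0 q0.
exists (fun x => - (x ^+ 2 / q) * D x).
  apply: lfunM => //; apply: lfunN; apply: lfunM; last exact: lfun_cst.
  exact: lfunX (lfun_id _).
move=> x x0; split; first exact: DE'.
move: x x0; apply: (operatorP (w := fun x => 1 - q / x ^+ 2) (lfun_1B_sqrV q) _
  (neq0_1B_sqrV q)).
  apply: lfunD; first exact: lfunZ (lfun_leval f).
  apply: lfunM; last first.
    apply: lfunM => //; apply: lfunN; apply: lfunM; last exact: lfun_cst.
    exact: lfunX (lfun_id _).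
  apply: lfunZ; apply: lfunM.
    by apply: lfunB; [exact: lfun_cst|exact: lfunZ (lfunV _)].
  by apply: lfunD; [exact: lfun_cst|exact: lfunZ (lfunV _)].
move=> x x0 wx; rewrite DE'//.
move: (- (x ^+ 2 / q) * D x) => Dx; move: wx.
have -> : 1 - q / x ^+ 2 = 1 - q * x ^- 2 by [].
move: (1 - q * x ^- 2) => W W0.
set A := (X in k^-1 * X * Dx).
suff -> : k^-1 * (A / W) * (W * Dx) = k^-1 * A * Dx by [].
by rewrite -!mulrA mulKf.
Qed.

(** A general substitution [s] serves both operators. After multiplication by [w] the divided
    differences turn back into differences of values, which are linear in the function. *)
Lemma operator_lin (s : C -> C) (k z : C) (w N f1 f2 f3 D1 D2 D3 t1 t2 t3 : C -> C) :
  lfun w -> (exists2 x, x != 0 & w x != 0) -> lfun t1 -> lfun t2 -> lfun t3 ->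
  (forall x, f1 x = z * f2 x + f3 x) ->
  (forall x, x != 0 -> f1 (s x) - f1 x = w x * D1 x /\ t1 x = k * f1 x + N x * D1 x) ->
  (forall x, x != 0 -> f2 (s x) - f2 x = w x * D2 x /\ t2 x = k * f2 x + N x * D2 x) ->
  (forall x, x != 0 -> f3 (s x) - f3 x = w x * D3 x /\ t3 x = k * f3 x + N x * D3 x) ->
  forall x, x != 0 -> t1 x = z * t2 x + t3 x.
Proof.
move=> wl w0 l1 l2 l3 fE h1 h2 h3 x x0; apply/eqP; rewrite -subr_eq0; apply/eqP.
move: x x0; apply: (lfun_mul_eq0 wl _ w0).
  by apply: lfunB => //; apply: lfunD => //; exact: lfunZ.
move=> x x0; have [e1 ->] := h1 x x0; have [e2 ->] := h2 x x0.
have [e3 ->] := h3 x x0.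
transitivity (w x * k * (f1 x - z * f2 x - f3 x) +
  N x * (w x * D1 x - z * (w x * D2 x) - w x * D3 x)); first by ring.
by rewrite -e1 -e2 -e3 !fE; ring.
Qed.

Lemma T1_lin k u z f g : T1 k u (z *: f + g) = z *: T1 k u f + T1 k u g.
Proof.
apply: leval_inj => x x0; rewrite leval_lin.
have [D1 _ h1] := T1P k u (z *: f + g); have [D2 _ h2] := T1P k u f.
have [D3 _ h3] := T1P k u g.
exact: (operator_lin lfun_1B_sqr neq0_1B_sqr (lfun_leval _) (lfun_leval _)
  (lfun_leval _) (leval_lin z f g) h1 h2 h3).
Qed.

Lemma T0_lin q qh k u z f g : q != 0 ->
  T0 q qh k u (z *: f + g) = z *: T0 q qh k u f + T0 q qh k u g.
Proof.
move=> q0; apply: leval_inj => x x0; rewrite leval_lin.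
have [D1 _ h1] := T0P qh k u (z *: f + g) q0; have [D2 _ h2] := T0P qh k u f q0.
have [D3 _ h3] := T0P qh k u g q0.
exact: (operator_lin (lfun_1B_sqrV q) (neq0_1B_sqrV q) (lfun_leval _) (lfun_leval _)
  (lfun_leval _) (leval_lin z f g) h1 h2 h3).
Qed.

Lemma Yop_lin q qh k0 k1 u0 u1 z f g : q != 0 ->
  Yop q qh k0 k1 u0 u1 (z *: f + g) =
  z *: Yop q qh k0 k1 u0 u1 f + Yop q qh k0 k1 u0 u1 g.
Proof. by move=> q0; rewrite /Yop T0_lin// T1_lin. Qed.

End Operators.

(** * Triangularity: bases and distinct eigenvalues *)

Section Triangular.
Variable K : fieldType.
Implicit Types (f p : laurent K) (P : int -> laurent K) (m n : int).

(* The position of [x^m] in the order [1 < x^-1 < x < x^-2 < x^2 < ...]. *)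
Definition mono_rank m : nat :=
  if 0 <= m then (`|m| + `|m|)%N else (`|m| + `|m|).-1%N.

Lemma mono_ltE m n : mono_lt m n = (mono_rank m < mono_rank n)%N.
Proof.
rewrite /mono_lt /mono_rank; case: m => m; case: n => n /=; rewrite ?NegzE; lia.
Qed.

Lemma rank_inj : injective mono_rank.
Proof. by move=> m n; rewrite /mono_rank; case: m => m; case: n => n /=; lia. Qed.

Lemma monic_rank m n p : monic_of_degree m p -> p n != 0 -> n != m ->
  (mono_rank n < mono_rank m)%N.
Proof. by move=> [_ pm] pn nm; rewrite -mono_ltE pm. Qed.

Lemma rank_bound f : exists N, forall m, (N <= mono_rank m)%N -> f m = 0.
Proof.
have [r [_ fr]] := laurent_support f.
exists (\max_(m <- r) mono_rank m).+1 => m Nm; apply: fr; apply/negP => mr.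
by move: Nm; rewrite leqNgt ltnS leq_bigmax_seq.
Qed.

Definition lcomb P (c : laurent K) := \sum_(m \in [set: int]) (c m : K) *: P m.

Lemma lcombE P (c : laurent K) r : uniq r -> (forall m, m \notin r -> c m = 0) ->
  lcomb P c = \sum_(m <- r) (c m : K) *: P m.
Proof. by move=> ur c0; apply: fsum_seq => // m /c0 ->; rewrite scale0r. Qed.

Lemma lcomb_lin P (z : K) (c e : laurent K) :
  lcomb P (z *: c + e) = z *: lcomb P c + lcomb P e.
Proof.
have [r [ur fr]] := laurent_support c; have [s [us gs]] := laurent_support e.
pose t := undup (r ++ s); have ut : uniq t := undup_uniq _.
have notin m : m \notin t -> m \notin r /\ m \notin s.
  by rewrite mem_undup mem_cat negb_or => /andP[].
rewrite (lcombE _ ut) => [|m /notin[/fr fm /gs gm]]; last first.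
  by rewrite lcoefD lcoefZ fm gm mulr0 addr0.
rewrite (@lcombE P c t)// => [|m /notin[/fr]//].
rewrite (@lcombE P e t)// => [|m /notin[_ /gs]//].
rewrite scaler_sumr -big_split /=; apply: eq_bigr => m _.
by rewrite -[LHS]/((z * c m + e m) *: P m) scalerDl scalerA.
Qed.

Lemma lcomb_lmon P n : lcomb P (lmon K n) = P n.
Proof.
rewrite (@lcombE _ _ [:: n])//= => [|m]; first by rewrite big_seq1 /= eqxx scale1r.
by rewrite inE /= => /negPf ->.
Qed.

Lemma lcomb0 P : lcomb P 0 = 0.
Proof. by rewrite (@lcombE _ _ [::])// big_nil. Qed.

(** Both parts descend on the rank: the leading coefficient of a combination is that of its top
    term, and subtracting [g m] times [P m] removes the top monomial of [g]. *)
Lemma triangular_basis P : (forall m, monic_of_degree m (P m)) -> is_basis P.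
Proof.
move=> Pm f.
have inj (c : laurent K) : lcomb P c = 0 -> c = 0.
  move=> c0; have [N cN] := rank_bound c.
  elim: N cN => [|N ih] cN; first by apply: laurentP => m; rewrite cN.
  apply: ih => m; rewrite leq_eqVlt => /orP[/eqP mN|]; last exact: cN.
  have [r [ur cr]] := laurent_support c.
  have [mr|/cr //] := boolP (m \in r).
  have : lcomb P c m = 0 by rewrite c0.
  rewrite (lcombE _ ur cr) lcoef_sum (bigD1_seq m)//.
  rewrite big1_seq => [|n /andP[nm nr]].
    by rewrite -[LHS]/((c m : K) * P m m + 0) addr0 (Pm m).1 mulr1.
  rewrite lcoefZ; have [nN|nN|nN] := ltngtP (mono_rank n) N; last first.
  - by move: nm; rewrite (@rank_inj n m) ?eqxx// nN.
  - by rewrite cN// mul0r.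
  have [->|pn] := eqVneq (P n m) 0; first by rewrite mulr0.
  have := monic_rank (Pm n) pn; rewrite eq_sym nm -mN => /(_ isT).
  by rewrite ltnNge (ltnW nN).
have [c fc] : exists c, f = lcomb P c.
  have [N fN] := rank_bound f.
  elim: N f fN => [|N ih] g gN.
    by exists 0; rewrite lcomb0; apply: laurentP => m; rewrite gN.
  have [[m [mN gm]]|no] := pselect (exists m, mono_rank m = N /\ g m != 0); last first.
    apply: ih => m; rewrite leq_eqVlt => /orP[/eqP mN|]; last exact: gN.
    by apply/eqP/negPn/negP => gm; apply: no; exists m.
  have [n Nn|c gc] := ih (- (g m : K) *: P m + g).
    rewrite lcoefD lcoefZ; have [->|nm] := eqVneq n m.
      by rewrite (Pm m).1 mulr1 addNr.
    have Nn' : (N < mono_rank n)%N.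
      rewrite ltn_neqAle Nn andbT; apply: contra_neq nm => Nn'.
      by apply: rank_inj; rewrite -Nn'.
    rewrite (gN n Nn') [LHS]addr0.
    have [->|pn] := eqVneq (P m n) 0; first by rewrite mulr0.
    by have := monic_rank (Pm m) pn nm; rewrite mN ltnNge Nn.
  exists ((g m : K) *: lmon K m + c).
  by rewrite lcomb_lin lcomb_lmon -gc addrA -scalerDl subrr scale0r add0r.
exists c; split=> // e fe; apply/eqP; rewrite -subr_eq0 -scaleN1r addrC; apply/eqP.
by apply: inj; rewrite lcomb_lin -fc -[lcomb P e]fe scaleN1r addNr.
Qed.

(* If two eigenvalues coincided, adding one eigenvector to the other would
   contradict the uniqueness of the one of larger degree. *)
Lemma eigenvalue_neq (Y : laurent K -> laurent K) (ev : int -> K) P m n :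
  (forall z f g, Y (z *: f + g) = z *: Y f + Y g) ->
  (forall m, unique (fun p => monic_of_degree m p /\ Y p = ev m *: p) (P m)) ->
  m != n -> ev m != ev n.
Proof.
move=> Ylin PP; wlog nm : m n / (mono_rank n < mono_rank m)%N.
  move=> H mn; have [h|h|/rank_inj/eqP] := ltngtP (mono_rank n) (mono_rank m).
  - exact: (H m n).
  - by rewrite eq_sym; apply: (H n m); rewrite // eq_sym.
  by rewrite eq_sym (negPf mn).
move=> mn; apply/eqP => e.
have [[[Pm1 Pm2] Pm3] Pmu] := PP m; have [[[Pn1 Pn2] Pn3] _] := PP n.
have Pnm : P n m = 0.
  apply/eqP/negPn/negP => pn; have := Pn2 m pn mn.
  by rewrite mono_ltE ltnNge ltnW.
have : P m = 1 *: P n + P m.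
  apply: Pmu; split; last by rewrite Ylin Pm3 Pn3 e scalerDr scale1r scale1r.
  split; first by rewrite lcoefD lcoefZ Pnm Pm1 mulr0 add0r.
  move=> k; rewrite lcoefD lcoefZ mul1r => pk km; rewrite mono_ltE.
  have [Pmk|Pmk] := eqVneq (P m k) 0; last by rewrite -mono_ltE Pm2.
  have [->//|kn] := eqVneq k n.
  rewrite Pmk addr0 in pk; have := Pn2 k pk kn; rewrite mono_ltE => h.
  exact: ltn_trans nm.
rewrite scale1r -[LHS]add0r => /addIr /(congr1 (fun p : laurent K => p n)).
by rewrite lcoef0 Pn1 => /esym/eqP; rewrite oner_eq0.
Qed.

End Triangular.

(** * Isometry and radical *)

Section Functional.
Variables (R : realType).
Local Notation C := (Cx R).
Implicit Types (f g h psi F G D N w r : C -> C) (x z : C).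
Variable L : (C -> C) -> C.
Hypothesis L_ext : forall f g, lfun f -> (forall x, x != 0 -> f x = g x) ->
  L f = L g.
Hypothesis L_lin : forall z f g, lfun f -> lfun g ->
  L (fun x => z * f x + g x) = z * L f + L g.

(* If [L] integrates against a weight [Delta], the hypothesis on [L] says that
   [N Delta / w] is invariant under [x |-> s/x]. *)
Lemma hecke_isometry (s k : C) N w r F G DF DG : s != 0 -> k != 0 ->
  lfun N -> lfun w -> lfun r -> lfun F -> lfun G -> lfun DF -> lfun DG ->
  (exists2 x, x != 0 & w x != 0) ->
  (forall x, x != 0 -> w (s / x) = - r x * w x) ->
  (forall x, x != 0 -> N (s / x) = r x * (N x - w x * (1 + k ^+ 2))) ->
  (forall x, x != 0 -> F (s / x) - F x = w x * DF x) ->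
  (forall x, x != 0 -> G (s / x) - G x = w x * DG x) ->
  (forall h, lfun h ->
     L (fun x => N x * h (s / x)) = - L (fun x => N x * (r x * h x))) ->
  L (fun x => (k * F x + k^-1 * N x * DF x) * (k^-1 * G x + k^-1 * N x * DG x)) =
  L (fun x => F x * G x).
Proof.
move=> s0 k0 Nl wl rl Fl Gl DFl DGl w0 wE NE DFE DGE refl.
(* Under reflection the difference of values changes sign, while [w] is multiplied by [- r]. *)
have DsE E D : lfun D -> (forall x, x != 0 -> E (s / x) - E x = w x * D x) ->
    forall x, x != 0 -> r x * D (s / x) = D x.
  move=> Dl DE x x0; apply/eqP; rewrite -subr_eq0; apply/eqP; move: x x0.
  apply: (lfun_mul_eq0 wl _ w0).
    by apply: lfunB => //; apply: lfunM => //; exact: lfun_comp.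
  move=> x x0; have sx0 : s / x != 0 by rewrite mulf_neq0 ?invr_eq0.
  have := DE _ sx0; rewrite divKr_neq0// wE// => h.
  transitivity (- (E x - E (s / x)) - w x * D x); first by rewrite h; ring.
  by rewrite -DE//; ring.
have DFs := DsE _ _ DFl DFE; have DGs := DsE _ _ DGl DGE.
(* Expanding the product in the goal gives [F G + N h]; it remains to see that [L] kills [N h]. *)
pose h x := F x * DG x + k^-1 ^+ 2 * DF x * G x + k^-1 ^+ 2 * N x * DF x * DG x.
have hl : lfun h.
  by do ![apply: lfunD | apply: lfunM => // | exact: lfun_cst].
have hs x : x != 0 -> r x * h (s / x) = h x.
  move=> x0; have e1 := DFE x x0; have e2 := DGE x x0.
  have {}e1 : F (s / x) = F x + w x * DF x by rewrite -e1; ring.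
  have {}e2 : G (s / x) = G x + w x * DG x by rewrite -e2; ring.
  have e3 := DFs x x0; have e4 := DGs x x0; have e5 := NE x x0.
  rewrite /h e1 e2 e5.
  transitivity ((F x + w x * DF x) * (r x * DG (s / x)) +
      k^-1 ^+ 2 * (r x * DF (s / x)) * (G x + w x * DG x) +
      k^-1 ^+ 2 * (N x - w x * (1 + k ^+ 2)) * (r x * DF (s / x)) * (r x * DG (s / x))).
    by ring.
  by rewrite e3 e4; field.
have Nhl : lfun (fun x => N x * h x) by apply: lfunM.
have Nh0 : L (fun x => N x * h x) = 0.
  have h'l : lfun (fun x => h (s / x)) := lfun_comp s0 hl.
  have e1 : L (fun x => N x * h x) = L (fun x => N x * h (s / (s / x))).
    by apply: L_ext => // x x0; rewrite divKr_neq0.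
  have e2 : L (fun x => N x * h x) = L (fun x => N x * (r x * h (s / x))).
    by apply: L_ext => // x x0; rewrite hs.
  have := refl _ h'l; rewrite -e1 -e2 => /eqP.
  by rewrite -subr_eq0 opprK -mulr2n mulrn_eq0 /= => /eqP.
have FGl : lfun (fun x => F x * G x) by exact: lfunM.
have := L_lin 1 Nhl FGl; rewrite Nh0 mulr0 add0r => <-.
apply/esym/L_ext; first by apply: lfunD => //; exact: lfunZ.
by move=> x x0; rewrite /h; field.
Qed.

Definition radical psi := lfun psi /\ forall h, lfun h -> L (fun x => psi x * h x) = 0.

Lemma radicalM psi h : radical psi -> lfun h -> radical (fun x => psi x * h x).
Proof.
move=> [pl p0] hl; split; first exact: lfunM.
move=> g gl; rewrite -(p0 (fun x => h x * g x)); last exact: lfunM.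
by apply: L_ext => [|x _]; rewrite ?mulrA//; apply: lfunM => //; exact: lfunM.
Qed.

Lemma radical_ext psi psi' : (forall x, x != 0 -> psi x = psi' x) ->
  radical psi -> radical psi'.
Proof.
move=> e [pl p0]; split; first exact: lfun_ext pl.
move=> h hl; rewrite -(p0 h hl); apply/esym/L_ext; first exact: lfunM.
by move=> x x0; rewrite e.
Qed.

Lemma radicalB psi psi' : radical psi -> radical psi' ->
  radical (fun x => psi x - psi' x).
Proof.
move=> [pl p0] [pl' p0']; split; first exact: lfunB.
move=> h hl; rewrite -(p0 h hl) -[RHS]add0r -(mulr0 (-1)) -(p0' h hl) -L_lin.
- apply: L_ext => [|x _]; first by apply: lfunM => //; exact: lfunB.
  by ring.
- exact: lfunM.
- exact: lfunM.
Qed.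

(** The reflection moves the argument [s/x] from [psi] to the test function, where the radical
    condition applies. *)
Lemma radical_reflect (s : C) N r psi : s != 0 -> lfun N -> lfun r ->
  (forall h, lfun h ->
     L (fun x => N x * h (s / x)) = - L (fun x => N x * (r x * h x))) ->
  radical psi -> radical (fun x => N x * psi (s / x)).
Proof.
move=> s0 Nl rl refl [pl p0].
have psl := lfun_comp s0 pl.
split; first exact: lfunM.
move=> h hl; have hsl := lfun_comp s0 hl.
rewrite (@L_ext _ (fun x => N x * (psi (s / x) * h (s / (s / x))))).
- rewrite (refl (fun x => psi x * h (s / x))); last exact: lfunM.
  rewrite (@L_ext _ (fun x => psi x * (N x * r x * h (s / x)))).
  + by rewrite p0 ?oppr0//; apply: lfunM => //; exact: lfunM.
  + by do ![apply: lfunM => //].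
  + by move=> x _; ring.
- by do ![apply: lfunM => //].
- by move=> x x0; rewrite divKr_neq0// mulrA.
Qed.

Variables (q a b c d : C).
Hypothesis q_neq0 : q != 0.
Hypothesis q_lt1 : cabs q < 1.
Hypothesis abcd_gen : forall e f : C, e \in [:: a; b; c; d] ->
  f \in [:: a; b; c; d] -> forall j : int, e * f != q ^ j.
Hypothesis L_neq0 : exists2 h, lfun h & L h != 0.
Hypothesis reflect1 : forall h, lfun h ->
  L (fun x => (1 - a * x) * (1 - b * x) * h (1 / x)) =
  - L (fun x => (1 - a * x) * (1 - b * x) * (1 / x ^+ 2 * h x)).
Hypothesis reflect0 : forall h, lfun h ->
  L (fun x => (1 - c / x) * (1 - d / x) * h (q / x)) =
  - L (fun x => (1 - c / x) * (1 - d / x) * (x ^+ 2 / q * h x)).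

Lemma lfun_N1 (e f : C) : lfun (fun x : C => (1 - e * x) * (1 - f * x)).
Proof.
by apply: lfunM; (apply: lfunB; first exact: lfun_cst); exact: lfunZ (lfun_id _).
Qed.

Lemma lfun_N0 (e f : C) : lfun (fun x : C => (1 - e / x) * (1 - f / x)).
Proof.
by apply: lfunM; (apply: lfunB; first exact: lfun_cst); exact: lfunZ (lfunV _).
Qed.

Lemma lfun_r1 : lfun (fun x : C => 1 / x ^+ 2).
Proof.
by apply: lfun_ext (lfunX 2 (lfunV _)) => x _; rewrite exprVn div1r.
Qed.

Lemma lfun_r0 : lfun (fun x : C => x ^+ 2 / q).
Proof. by apply: lfunM; [exact: lfunX (lfun_id _)|exact: lfun_cst]. Qed.

Definition radical_zero z := z != 0 /\ forall psi, radical psi -> psi z = 0.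

(** Evaluate the radical element [(1 - a x)(1 - b x) psi(1/x)] at [z], where its prefactor does not
    vanish. *)
Lemma radical_zero_inv z : radical_zero z -> 1 - a * z != 0 -> 1 - b * z != 0 ->
  radical_zero z^-1.
Proof.
move=> [z0 hz] az bz; split; first by rewrite invr_eq0.
move=> psi /(radical_reflect (oner_neq0 C) (lfun_N1 a b) lfun_r1 reflect1) /hz /eqP.
by rewrite div1r !mulf_eq0 (negPf az) (negPf bz) => /eqP.
Qed.

Lemma radical_zero_qinv z : radical_zero z -> 1 - c / z != 0 -> 1 - d / z != 0 ->
  radical_zero (q / z).
Proof.
move=> [z0 hz] az bz; split; first by rewrite mulf_neq0 ?invr_eq0.
move=> psi /(radical_reflect q_neq0 (lfun_N0 c d) lfun_r0 reflect0) /hz /eqP.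
by rewrite !mulf_eq0 (negPf az) (negPf bz) => /eqP.
Qed.

Lemma exprq_inj (i j : nat) : q ^+ i = q ^+ j -> i = j.
Proof.
move=> /(congr1 (@cabs R)); rewrite !cabsX; apply: ieexprIn.
  by rewrite cabs_gt0.
by rewrite lt_eqF.
Qed.

(* Under [z -> 1/z -> q z -> ...] a common zero of the radical moves along
   [q^n z], and under [z -> q/z -> z/q -> ...] along [q^-n z].  As there are
   finitely many zeros, both chains stop, at parameters [e] and [f] with
   [e q^n z = 1] and [z = f q^m]: then [e f] is a power of [q]. *)
Lemma radical_zero_false z (p : {poly C}) : p != 0 ->
  (forall y, radical_zero y -> root p y) -> ~ radical_zero z.
Proof.
move=> p0 proot zz; have z0 : z != 0 by case: zz.
have [E4 E4P] : exists E4, E4 = [:: a; b; c; d] by exists [:: a; b; c; d].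
have inf (y : nat -> C) : injective y -> (forall n, radical_zero (y n)) -> False.
  move=> yi yz; have := @max_poly_roots _ p [seq y i | i <- iota 0 (size p)] p0.
  rewrite size_map size_iota ltnn => H; suff: false by []; apply: H.
    by apply/allP => _ /mapP[i _ ->]; exact: proot.
  by rewrite map_inj_uniq ?iota_uniq.
have [n [e eE en]] : exists n, exists2 e, e \in E4 & 1 - e * (q ^+ n * z) = 0.
  apply: contrapT => no.
  have ne n e : e \in E4 -> 1 - e * (q ^+ n * z) != 0.
    by move=> eE; apply/eqP => e0; apply: no; exists n, e.
  apply: (inf (fun n => q ^+ n * z)) => [i j /(mulIf z0)|n]; first exact: exprq_inj.
  elim: n => [|n ih]; first by rewrite expr0 mul1r.
  have v := radical_zero_inv ih (ne n a _) (ne n b _).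
  rewrite E4P !inE !eqxx ?orbT /= in v.
  have qz0 : q ^+ n * z != 0 by rewrite mulf_neq0 ?expf_neq0.
  have -> : q ^+ n.+1 * z = q / (q ^+ n * z)^-1 by rewrite invrK exprS mulrA.
  by apply: radical_zero_qinv; [exact: v| |]; rewrite invrK; apply: ne;
    rewrite E4P !inE eqxx ?orbT.
have [m [f fE fm]] : exists m : nat, exists2 f : C, f \in E4 & z = f * q ^+ m.
  apply: contrapT => no.
  have nf m (f : C) : f \in E4 -> z != f * q ^+ m.
    by move=> fE; apply/eqP => e0; apply: no; exists m, f.
  have qi i : q ^+ i != 0 by rewrite expf_neq0.
  apply: (inf (fun m => z / q ^+ m)) => [i j /(mulfI z0)/invr_inj|m].
    exact: exprq_inj.
  elim: m => [|m ih]; first by rewrite expr0 divr1.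
  have nf1 (g : C) : g \in E4 -> 1 - g / (z / q ^+ m) != 0.
    move=> gE; apply: contra_neq (nf m g gE) => /eqP; rewrite subr_eq0 => /eqP e1.
    by rewrite -[LHS]mulr1 e1; field; rewrite z0 qi.
  have nf2 (g : C) : g \in E4 -> 1 - g * (q / (z / q ^+ m)) != 0.
    move=> gE; apply: contra_neq (nf m.+1 g gE) => /eqP; rewrite subr_eq0 => /eqP e1.
    by rewrite -[LHS]mulr1 e1 exprS; field; rewrite z0 qi.
  have v : radical_zero (q / (z / q ^+ m)).
    by apply: radical_zero_qinv => //; apply: nf1; rewrite E4P !inE eqxx ?orbT.
  have -> : z / q ^+ m.+1 = (q / (z / q ^+ m))^-1.
    by rewrite exprS; field; rewrite z0 q_neq0 qi.
  by apply: radical_zero_inv => //; apply: nf2; rewrite E4P !inE eqxx ?orbT.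
rewrite E4P in eE fE; have /eqP := abcd_gen eE fE (- (n + m)%N%:Z); apply.
rewrite -exprnN exprD; move: en => /eqP; rewrite subr_eq0 => /eqP.
rewrite fm => e1.
have qi i : q ^+ i != 0 by rewrite expf_neq0.
by rewrite -[LHS]mulr1 -[X in _ = X]mulr1 [in RHS]e1; field; rewrite !qi.
Qed.

(** In a nonzero radical, a nonzero polynomial [p] of least size divides all polynomials of the
    radical. It is not constant, as [L] is nonzero, and does not vanish at 0, since [x] is
    invertible and could be divided out. So it has a root [z != 0], which is a common zero. *)
Lemma radical_eq0 psi : radical psi -> forall x, x != 0 -> psi x = 0.
Proof.
move=> psi0 x1 x10; apply/eqP/negPn/negP => px1.
have lXn k : lfun (fun x : C => x ^+ k) := lfunX k (lfun_id _).
have lp p : lfun (horner p : C -> C) := lfun_horner p.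
pose Q n := `[< exists p : {poly C}, [/\ size p = n, p != 0 & radical (horner p)] >].
have exQ : exists n, Q n.
  have [[p [k pE]] _] := psi0; exists (size p); apply/asboolP; exists p; split=> //.
    by apply: contra_neq px1 => p0; rewrite pE// p0 horner0 mul0r.
  apply: radical_ext (radicalM psi0 (lXn k)) => x x0.
  by rewrite pE// divfK// expf_neq0.
have [n /asboolP[p [sp p0 pR]] nmin] := ex_minnP exQ.
have small (r : {poly C}) : radical (horner r) -> (size r < n)%N -> r = 0.
  move=> rR rn; apply/eqP/negPn/negP => r0.
  by move: rn; rewrite ltnNge nmin//; apply/asboolP; exists r.
have [p1|/closed_rootP[z /[dup] pz]] := boolP (size p == 1).
  have /size_poly1P[e e0 pe] := p1.
  have [h hl] := L_neq0; move/eqP; apply.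
  have [_ /(_ (fun x => e^-1 * h x)) H] := pR.
  rewrite -H; last exact: lfunZ.
  by apply: L_ext => // x _; rewrite pe hornerC mulVKf.
rewrite -dvdp_XsubCl => /dvdpP[p' pE].
have z0 : z != 0.
  apply/negP => /eqP z0; move: pE; rewrite z0 subr0 => pE.
  have p'0 : p' != 0 by apply: contra_neq p0 => p'0; rewrite pE p'0 mul0r.
  move/eqP: p'0; apply; apply: small.
    apply: radical_ext (radicalM pR (lfunV _)) => x x0.
    by rewrite pE hornerM hornerX mulfK.
  rewrite -sp pE size_mulX//; apply: contra_neq p0 => p'0; by rewrite pE p'0 mul0r.
apply: (@radical_zero_false z p p0).
  by move=> y [_ /(_ _ pR)] /eqP.
split=> // phi phiR; have [[r [k rE]] _] := phiR.
have rR : radical (horner r).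
  apply: radical_ext (radicalM phiR (lXn k)) => x x0.
  by rewrite rE// divfK// expf_neq0.
have mR : radical (horner (r %% p)).
  apply: radical_ext (radicalB rR (radicalM pR (lp (r %/ p)))) => x _.
  rewrite {1}(divp_eq r p) hornerD hornerM; ring.
have r0 : r %% p = 0 by apply: small => //; rewrite -sp ltn_modp.
by rewrite rE// (divp_eq r p) r0 addr0 hornerM (eqP pz) mulr0 mul0r.
Qed.

End Functional.

(** * The bilinear form *)

Section AskeyWilsonForm.
Variables (R : realType) (q qh k0 k1 u0 u1 a b c d : Cx R) (gam : R -> Cx R).
Local Notation C := (Cx R).
Implicit Types (f g : laurent C).
Hypothesis q_neq0 : q != 0.
Hypothesis q_lt1 : cabs q < 1.
Hypothesis qhE : qh ^+ 2 = q.
Hypotheses (k0_neq0 : k0 != 0) (k1_neq0 : k1 != 0).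
Hypotheses (u0_neq0 : u0 != 0) (u1_neq0 : u1 != 0).
Hypotheses (aE : a = AW_a k1 u1) (bE : b = AW_b k1 u1).
Hypotheses (cE : c = AW_c qh k0 u0) (dE : d = AW_d qh k0 u0).
Hypothesis gamP : AW_contour q a b c d gam.
Local Notation L := (AWL gam q a b c d).
Local Notation form := (AW_form q a b c d gam).

Let qh_neq0 : qh != 0.
Proof. by move: q_neq0; rewrite -qhE expf_eq0. Qed.

Lemma abcd_neq0 e : e \in [:: a; b; c; d] -> e != 0.
Proof.
rewrite aE bE cE dE /AW_a /AW_b /AW_c /AW_d !inE => /or4P[] /eqP ->;
  by rewrite ?oppr_eq0 ?mulf_neq0 ?invr_eq0.
Qed.

Let L_ext := AWL_ext q_neq0 q_lt1 abcd_neq0 gamP.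
Let L_lin := AWL_lin q_neq0 q_lt1 abcd_neq0 gamP.
Let reflect1 := AWL_reflect1 q_neq0 q_lt1 abcd_neq0 gamP.
Let reflect0 := AWL_reflect0 q_neq0 q_lt1 abcd_neq0 gamP.

Lemma formE f g :
  form f g = (two_pi_i R)^-1 * L (fun x => leval f x * leval g x^-1).
Proof. by []. Qed.

Lemma form_eq f g f' g' :
  L (fun x => leval f x * leval g x^-1) = L (fun x => leval f' x * leval g' x^-1) ->
  form f g = form f' g'.
Proof. by move=> h; rewrite (formE f g) h. Qed.

Lemma lfun_leval_inv g : lfun (fun x => leval g x^-1).
Proof.
apply: lfun_ext (lfun_comp (oner_neq0 C) (lfun_leval g)) => x _.
by rewrite div1r.
Qed.

Lemma lfun_form f g : lfun (fun x => leval f x * leval g x^-1).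
Proof. by apply: lfunM; [exact: lfun_leval|exact: lfun_leval_inv]. Qed.

(** Apply [hecke_isometry] with [G x = g (1/x)]: in the variable [1/x] the operator with inverted
    parameters has the numerator of [T1] again, but the scalar [k1^-1]. *)
Lemma form_T1 f g : form (T1 k1 u1 f) (T1 k1^-1 u1^-1 g) = form f g.
Proof.
apply: form_eq.
have [DF DFl DFE] := T1P k1 u1 f; have [D Dl DE] := T1P k1^-1 u1^-1 g.
have Dl' : lfun (fun x => - (1 / x ^+ 2) * D (1 / x)).
  by apply: lfunM (lfun_comp (oner_neq0 C) Dl); apply: lfunN; exact: lfun_r1.
have w1 (x : C) : x != 0 -> 1 - (1 / x) ^+ 2 = - (1 / x ^+ 2) * (1 - x ^+ 2).
  by move=> x0; field.
have nV (x : C) : x != 0 -> 1 / x != 0 by move=> x0; rewrite div1r invr_eq0.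
have DG (x : C) : x != 0 -> leval g (1 / x)^-1 - leval g x^-1 =
    (1 - x ^+ 2) * (- (1 / x ^+ 2) * D (1 / x)).
  move=> x0; have [h _] := DE _ (nV x x0).
  have v1 : (1 / x)^-1 = 1 / (1 / x) := esym (div1r _).
  have v2 : x^-1 = 1 / x := esym (div1r _).
  refine (etrans (congr2 (fun y z => leval g y - leval g z) v1 v2) (etrans h _)).
  by rewrite w1//; ring.
rewrite -(hecke_isometry L_ext L_lin (oner_neq0 C) k1_neq0 (lfun_N1 a b)
  (lfun_1B_sqr R) (lfun_r1 R) (lfun_leval f) (lfun_leval_inv g) DFl Dl'
  (neq0_1B_sqr R) w1 _ (fun x x0 => (DFE x x0).1) DG reflect1); last first.
  (* This relation between [N] and its reflection rests on [a b = - k1 ^+ 2]. *)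
  by move=> x x0; rewrite aE bE /AW_a /AW_b; field; rewrite x0 u1_neq0.
apply: L_ext => [|x x0]; first exact: lfun_form.
have [_ e] := DE _ (nV x x0); rewrite (DFE x x0).2; rewrite div1r in e *.
rewrite e aE bE /AW_a /AW_b.
congr (_ * _); first by ring.
by rewrite invrK; field; rewrite x0 u1_neq0 k1_neq0.
Qed.

Lemma form_T0 f g :
  form (T0 q qh k0 u0 f) (T0 q^-1 qh^-1 k0^-1 u0^-1 g) = form f g.
Proof.
apply: form_eq; have qV0 : q^-1 != 0 by rewrite invr_eq0.
have [DF DFl DFE] := T0P qh k0 u0 f q_neq0.
have [D Dl DE] := T0P qh^-1 k0^-1 u0^-1 g qV0.
have Dl' : lfun (fun x => - (x ^+ 2 / q) * D (1 / x)).
  by apply: lfunM (lfun_comp (oner_neq0 C) Dl); apply: lfunN; exact: lfun_r0.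
have w1 (x : C) : x != 0 -> 1 - q / (q / x) ^+ 2 = - (x ^+ 2 / q) * (1 - q / x ^+ 2).
  by move=> x0; field; rewrite x0 q_neq0.
have nV (x : C) : x != 0 -> x^-1 != 0 by move=> x0; rewrite invr_eq0.
have DG (x : C) : x != 0 -> leval g (q / x)^-1 - leval g x^-1 =
    (1 - q / x ^+ 2) * (- (x ^+ 2 / q) * D (1 / x)).
  move=> x0; have [h _] := DE _ (nV x x0).
  rewrite [RHS](_ : _ = (1 - q^-1 / x^-1 ^+ 2) * D x^-1); last first.
    by rewrite div1r; field; rewrite x0 q_neq0.
  by rewrite -h invrK invf_div [q^-1 * x]mulrC.
rewrite -(hecke_isometry L_ext L_lin q_neq0 k0_neq0 (lfun_N0 c d)
  (lfun_1B_sqrV q) (lfun_r0 q) (lfun_leval f) (lfun_leval_inv g) DFl Dl'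
  (neq0_1B_sqrV q) w1 _ (fun x x0 => (DFE x x0).1) DG reflect0); last first.
  (* Here the relation needed is [c d = - q * k0 ^+ 2], which uses [qh ^+ 2 = q]. *)
  move=> x x0; rewrite cE dE /AW_c /AW_d -qhE.
  by field; rewrite x0 u0_neq0 qh_neq0.
apply: L_ext => [|x x0]; first exact: lfun_form.
rewrite (DFE x x0).2 (DE _ (nV x x0)).2 div1r cE dE /AW_c /AW_d.
congr (_ * _); first by rewrite mulNr opprK mulrA.
by rewrite -qhE !invrK; field; rewrite x0 u0_neq0 k0_neq0 qh_neq0.
Qed.

Lemma form_bilinear : is_bilinear_form form.
Proof.
split=> [z f1 f2 g|z f g1 g2].
  rewrite (formE (z *: f1 + f2)) (formE f1) (formE f2) mulrCA -mulrDr.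
  rewrite -(L_lin z (lfun_form f1 g) (lfun_form f2 g)); congr (_ * _).
  by apply: L_ext => [|x x0]; [exact: lfun_form|rewrite leval_lin; ring].
rewrite (formE f (z *: g1 + g2)) (formE f g1) (formE f g2) mulrCA -mulrDr.
rewrite -(L_lin z (lfun_form f g1) (lfun_form f g2)); congr (_ * _).
by apply: L_ext => [|x x0]; [exact: lfun_form|rewrite leval_lin; ring].
Qed.

Lemma form_nondegenerate :
  (forall e f : C, e \in [:: a; b; c; d] -> f \in [:: a; b; c; d] ->
     forall j : int, e * f != q ^ j) -> nondegenerate_form form.
Proof.
move=> gen.
have tpi0 : (two_pi_i R)^-1 != 0 by rewrite invr_eq0 two_pi_i_neq0.
have L0 := AWL_neq0 q_neq0 q_lt1 abcd_neq0 gamP.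
have rad0 := radical_eq0 L_ext L_lin q_neq0 q_lt1 gen L0 reflect1 reflect0.
have eq0 f : (forall x, x != 0 -> leval f x = 0) -> f = 0.
  by move=> f0; apply: leval_inj => x x0; rewrite f0// leval0.
split=> [f f0|g g0].
  apply/eq0/rad0; split; first exact: lfun_leval.
  (* As [g] enters the form at [1/x], the test function [h] is realized by the [g] representing
     [h (1/x)]. *)
  move=> h hl; have [g gE] := lfun_laurent (lfun_comp (oner_neq0 C) hl).
  have /eqP := f0 g; rewrite formE mulf_eq0 (negPf tpi0) => /eqP <-.
  apply: L_ext => [|x x0]; first by apply: lfunM => //; exact: lfun_leval.
  by rewrite gE ?invr_eq0// div1r invrK.
have g0' : forall x, x != 0 -> leval g x^-1 = 0.
  apply: (rad0 (fun x => leval g x^-1)); split; first exact: lfun_leval_inv.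
  move=> h hl; have [f fE] := lfun_laurent hl.
  have /eqP := g0 f; rewrite formE mulf_eq0 (negPf tpi0) => /eqP <-.
  apply: L_ext => [|x x0]; first by apply: lfunM => //; exact: lfun_leval_inv.
  by rewrite fE// mulrC.
by apply: eq0 => x x0; rewrite -[x]invrK g0'// invr_eq0.
Qed.

Lemma form_eigen m n f g :
  Yop q qh k0 k1 u0 u1 f = spectrum q k0 k1 m *: f ->
  Yop q^-1 qh^-1 k0^-1 k1^-1 u0^-1 u1^-1 g = spectrum q^-1 k0^-1 k1^-1 n *: g ->
  spectrum q k0 k1 m != spectrum q k0 k1 n -> form f g = 0.
Proof.
move=> Yf Yg mn.
(* Inverting the parameters inverts the eigenvalue, so invariance of the form says that [<f, g>] is
   unchanged by the factor given by the quotient of the two eigenvalues. *)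
have sV : spectrum q^-1 k0^-1 k1^-1 n = (spectrum q k0 k1 n)^-1.
  by rewrite /spectrum -invfM !exprz_inv -!invr_expz -invfM.
have s0 : spectrum q k0 k1 n != 0.
  by rewrite mulf_neq0 ?expfz_neq0 ?mulf_neq0.
have : form (Yop q qh k0 k1 u0 u1 f)
    (Yop q^-1 qh^-1 k0^-1 k1^-1 u0^-1 u1^-1 g) = form f g.
  by rewrite /Yop form_T1 form_T0.
have [B1 B2] := form_bilinear.
have Z1 z f' g' : form (z *: f') g' = z * form f' g'.
  have F0 : form 0 g' = 0.
    by have := B1 (-1) 0 0 g'; rewrite scaler0 addr0 mulN1r addNr.
  by rewrite -[z *: f']addr0 B1 F0 addr0.
have Z2 z f' g' : form f' (z *: g') = z * form f' g'.
  have F0 : form f' 0 = 0.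
    by have := B2 (-1) f' 0 0; rewrite scaler0 addr0 mulN1r addNr.
  by rewrite -[z *: g']addr0 B2 F0 addr0.
rewrite Yf Yg Z1 Z2 sV mulrA => /eqP; rewrite -subr_eq0 -[X in _ - X]mul1r -mulrBl.
rewrite mulf_eq0 subr_eq0 => /orP[/eqP h|/eqP //].
by move/eqP: mn; case; rewrite -[LHS](divfK s0) h mul1r.
Qed.

End AskeyWilsonForm.

Unset Implicit Arguments.

Theorem proposition6p7 (R : realType) (q qh k0 k1 u0 u1 : Cx R)
    (q_gt0 : 0 < `|q|) (q_lt1 : `|q| < 1) (qhE : qh ^+ 2 = q)
    (k0_neq0 : k0 != 0) (k1_neq0 : k1 != 0)
    (u0_neq0 : u0 != 0) (u1_neq0 : u1 != 0)
    (k0_gen : forall j : int, k0 ^+ 2 != q ^ j /\ k0 ^+ 2 != - q ^ j)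
    (k1_gen : forall j : int, k1 ^+ 2 != q ^ j /\ k1 ^+ 2 != - q ^ j)
    (u1_gen : forall j : int, u1 ^+ 2 != q ^ j /\ u1 ^+ 2 != - q ^ j)
    (a b c d : Cx R)
    (aE : a = AW_a k1 u1) (bE : b = AW_b k1 u1)
    (cE : c = AW_c qh k0 u0) (dE : d = AW_d qh k0 u0)
    (abcd_gen : forall e f : Cx R, e \in [:: a; b; c; d] ->
       f \in [:: a; b; c; d] -> forall j : int, e * f != q ^ j)
    (P P' : int -> laurent (Cx R))
    (P_AW : nonsym_AW q qh k0 k1 u0 u1 P)
    (P'_AW : nonsym_AW q^-1 qh^-1 k0^-1 k1^-1 u0^-1 u1^-1 P')
    (gam : R -> Cx R) (gam_contour : AW_contour q a b c d gam) :
  [/\ is_basis P, is_basis P',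
      is_bilinear_form (AW_form q a b c d gam) /\
        nondegenerate_form (AW_form q a b c d gam) &
      forall m n : int, m != n -> AW_form q a b c d gam (P m) (P' n) = 0].
Proof.
have q0 : q != 0 by rewrite -normr_gt0.
have q1 : cabs q < 1 by rewrite -(cabs_lt q ltr01).
split.
- by apply: triangular_basis => m; have [[]] := P_AW m.
- by apply: triangular_basis => m; have [[]] := P'_AW m.
- split; first exact: (form_bilinear q0 q1 qhE k0_neq0 k1_neq0 u0_neq0 u1_neq0
    aE bE cE dE gam_contour).
  exact: (form_nondegenerate q0 q1 qhE k0_neq0 k1_neq0 u0_neq0 u1_neq0
    aE bE cE dE gam_contour abcd_gen).
move=> m n mn.
have [[_ Pm] _] := P_AW m; have [[_ Pn] _] := P'_AW n.
apply: (form_eigen q0 q1 qhE k0_neq0 k1_neq0 u0_neq0 u1_neq0 aE bE cE dE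
  gam_contour Pm Pn).
exact: eigenvalue_neq (fun z f g => Yop_lin qh k0 k1 u0 u1 z f g q0) P_AW mn.
Qed.
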